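(* Let $H$ be the maximal subdomain diameter, $\Lambda$ the overlap multiplicity, $\tau$ the coarse-space threshold and $\Theta = 1/\tau$ (all as defined in the context). Let $h_1>0$ be a threshold such that for all $0<h<h_1$ and all $f\in L^2(\Omega)$ the discrete problem ''find $u_h\in V^h$ with $b(u_h,v)=(f,v)$ for all $v\in V^h$'' has a unique solution and $\|u-u_h\|_{1,k}\le \|f\|$, where $u$ is the solution of the continuous weak problem, and assume $h<h_1$. Suppose that $$ s := 8\Lambda\bigl(2+3\Lambda^2\Theta\bigr)(1+C_{\mathrm{stab}})\,k\,\Theta^{1/2} < 1, \qquad t := 6\sqrt{2}\,\Lambda\bigl(2+3\Lambda^2\Theta\bigr) H k < 1 .$$ Then, for GMRES applied in the $\langle\cdot,\cdot\rangle_{\mathbf{D}_k}$ inner product to the preconditioned system $\mathbf{M}^{-1}_{AS,2}\mathbf{B}\mathbf{u}=\mathbf{M}^{-1}_{AS,2}\mathbf{f}$, the residuals satisfy, for all $m\ge 0$, $$ \|\mathbf{r}^{(m)}\|_{\mathbf{D}_k}^2 \le \Bigl(1-\frac{c_1^2}{c_2^2}\Bigr)^{m}\,\|\mathbf{r}^{(0)}\|_{\mathbf{D}_k}^2, \qquad\text{with}\quad c_1 := \frac{1-\max\{s,t\}}{2+3\Lambda^2\Theta},\quad c_2 := 18+8\Lambda^2 .$$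
   Context: **PDE setting.** $d\in\{2,3\}$; $\Omega\subset\mathbb{R}^d$ is a bounded polygonal ($d=2$) or Lipschitz polyhedral ($d=3$) domain with diameter $\le 1$; $k>0$; $A:\Omega\to\mathbb{R}^{d\times d}$ is symmetric-matrix-valued with $|\xi|^2\le A(x)\xi\cdot\xi\le a_{\max}|\xi|^2$ for all $x\in\Omega$, $\xi\in\mathbb{R}^d$ (normalisation $a_{\min}=1$). Functions are real-valued. For $\Omega'\subseteq\Omega$: $(\cdot,\cdot)_{\Omega'}$, $\|\cdot\|_{\Omega'}$ are the $L^2(\Omega')$ inner product and norm; $a_{\Omega'}(u,v)=\int_{\Omega'}A\nabla u\cdot\nabla v\,dx$; $b_{\Omega'}(u,v)=a_{\Omega'}(u,v)-k^2(u,v)_{\Omega'}$; $(u,v)_{1,k,\Omega'}=a_{\Omega'}(u,v)+k^2(u,v)_{\Omega'}$ with norm $\|u\|_{1,k,\Omega'}$. The subscript $\Omega'$ is dropped when $\Omega'=\Omega$. **Stability assumption.** For every $f\in L^2(\Omega)$ there is a unique $u\in H^1_0(\Omega)$ with $b(u,v)=(f,v)$ for all $v\in H_0^1(\Omega)$, and $\|u\|_{1,k}\le C_{\mathrm{stab}}\|f\|$ with a constant $C_{\mathrm{stab}}>0$ independent of $f$. **Discretisation.** $\mathcal{T}_h$ is a triangulation of $\Omega$ into simplices of maximal diameter $h$, from a shape-regular family; $V^h\subseteq H_0^1(\Omega)$ is a conforming finite element space with (nodal) basis $\{\phi_i\}_{i=1}^n$. By a result of Schatz and Wang, if $\Omega$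 has diameter $\le1$, $A$ is symmetric-matrix-valued with $|\xi|^2\le A(x)\xi\cdot\xi\le a_{\max}|\xi|^2$ for all $x\in\Omega$, $\xi\in\mathbb{R}^d$, and for every $f\in L^2(\Omega)$ there is a unique $u\in H^1_0(\Omega)$ with $b(u,v)=(f,v)$ for all $v\in H^1_0(\Omega)$, satisfying $\|u\|_{1,k}\le C_{\mathrm{stab}}\|f\|$ with $C_{\mathrm{stab}}$ independent of $f$, then for any $\varepsilon>0$ there is $h_1(\varepsilon)>0$ such that for all $0<h<h_1(\varepsilon)$ the discrete problem is uniquely solvable for every $f\in L^2(\Omega)$ and $\|u-u_h\|_{1,k}\le\varepsilon\|f\|$. Matrices: $\mathbf{B}_{ij}=b(\phi_j,\phi_i)$, $\mathbf{A}_{ij}=a(\phi_j,\phi_i)$, $\mathbf{S}_{ij}=(\phi_j,\phi_i)$, $\mathbf{f}_i=(f,\phi_i)$; $\mathbf{u}$ is the coefficient vector of $u_h$ in the basis $\{\phi_i\}$. $\mathbf{D}_k=\mathbf{A}+k^2\mathbf{S}$, $\langle\mathbf{x},\mathbf{y}\rangle_{\mathbf{D}_k}=\mathbf{y}^T\mathbf{D}_k\mathbf{x}$, $\|\mathbf{x}\|_{\mathbf{D}_k}=\langle\mathbf{x},\mathbf{x}\rangle_{\mathbf{D}_k}^{1/2}$. **Overlapping decomposition.** $\Omega$ is partitioned into $N$ non-overlapping subdomains (connected open sets) $\Omega_i'$ resolved by $\mathcal{T}_h$; $\Omega_i$ is the interior of $\bigcup\{\operatorname{supp}\phi_\ell:\operatorname{supp}\phi_\ell\cap\Omega_i'\neq\emptyset\}$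 (this extension may be applied recursively). $\widetilde V_i=\{v|_{\Omega_i}:v\in V^h\}$, $V_i=\{v\in\widetilde V_i: v|_{\partial\Omega_i}=0\}$, $H=\max_i\operatorname{diam}(\Omega_i)$. $E_i:V_i\to V^h$ is extension by zero. $\Lambda=\max_{T\in\mathcal{T}_h}\#\{i:T\subseteq\Omega_i\}$. **Partition of unity.** $\overline{\mathrm{dof}}(\Omega_i)=\{\ell:\operatorname{supp}\phi_\ell\cap\Omega_i\ne\emptyset\}$, $\mathrm{dof}(\Omega_i)=\{\ell:\operatorname{supp}\phi_\ell\subseteq\overline{\Omega_i}\}$, $\mu_j=\#\{i:j\in\mathrm{dof}(\Omega_i)\}$, and $\Xi_i:\widetilde V_i\to V_i$ is $\Xi_i v=\sum_{j\in\mathrm{dof}(\Omega_i)}\mu_j^{-1}v_j\phi_j|_{\Omega_i}$ for $v=\sum_{j\in\overline{\mathrm{dof}}(\Omega_i)}v_j\phi_j|_{\Omega_i}$. **$\Delta_k$-GenEO coarse space.** Local eigenproblem on $\Omega_i$: $(p,\lambda)$ is an eigenpair if either $p\in\widetilde V_i\setminus\{0\}$, $\lambda\in\mathbb{R}$ and $a_{\Omega_i}(p,v)=\lambda(\Xi_ip,\Xi_iv)_{1,k,\Omega_i}$ for all $v\in\widetilde V_i$, or $p\in\ker\Xi_i$ and $\lambda=\infty$. With $s_i=\dim V_i$, $n_i=\dim\widetilde V_i$, there are eigenvalues $\lambda_1^i\le\dots\le\lambda_{s_i}^i<\lambda_{s_i+1}^i=\dots=\lambda_{n_i}^i=\infty$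 with eigenvectors $p_1^i,\dots,p_{n_i}^i$ forming a basis of $\widetilde V_i$ and $(\Xi_ip_\ell^i,\Xi_ip_m^i)_{1,k,\Omega_i}=\delta_{\ell m}$ for $\ell,m\le s_i$. Choose $m_i\in\{1,\dots,s_i\}$ and set $V_0=\operatorname{span}\{E_i\Xi_ip_\ell^i:1\le\ell\le m_i,\ 1\le i\le N\}\subseteq V^h$, $E_0:V_0\to V^h$ the inclusion, $\tau=\min_{1\le i\le N}\lambda^i_{m_i+1}$, $\Theta=1/\tau$ (with $1/\infty=0$; $\lambda^i_{n_i+1}:=\infty$). **Two-level preconditioner and GMRES.** $\mathbf{E}_i$ is the matrix of $E_i$ with respect to a basis of $V_i$ (for $i\ge1$ the basis functions $\phi_j|_{\Omega_i}$, $j\in\mathrm{dof}(\Omega_i)$; for $i=0$ any basis of $V_0$) and the basis $\{\phi_j\}$ of $V^h$; $\mathbf{R}_i=\mathbf{E}_i^T$; $\mathbf{B}_i=\mathbf{R}_i\mathbf{B}\mathbf{E}_i$; $\mathbf{M}_{AS,2}^{-1}=\sum_{i=0}^N\mathbf{E}_i\mathbf{B}_i^{-1}\mathbf{R}_i$. GMRES in the $\mathbf{D}_k$-inner product for a system $\mathcal{M}\mathbf{u}=\mathbf{g}$ with initial guess $\mathbf{u}^{(0)}$ produces iterates $\mathbf{u}^{(m)}\in\mathbf{u}^{(0)}+\operatorname{span}\{\mathbf{r}^{(0)},\mathcal{M}\mathbf{r}^{(0)},\dots,\mathcal{M}^{m-1}\mathbf{r}^{(0)}\}$ minimising $\|\mathbf{g}-\mathcal{M}\mathbf{u}^{(m)}\|_{\mathbf{D}_k}$;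 the residual is $\mathbf{r}^{(m)}=\mathbf{g}-\mathcal{M}\mathbf{u}^{(m)}$. *)

(* Defs.v *)
From HB Require Import structures.
From mathcomp Require Import all_boot all_order all_algebra.
From mathcomp Require Import all_classical all_reals all_analysis.
From mathcomp Require mpoly.
Set Implicit Arguments. Unset Strict Implicit. Unset Printing Implicit Defensive.
Import Order.TTheory GRing.Theory Num.Theory.
Import numFieldNormedType.Exports.
Local Open Scope classical_set_scope.
Local Open Scope ring_scope.

Definition rV_display : measure_display. Proof. exact: default_measure_display. Qed.

(* Borel sigma-algebra of R^d, generated by the coordinate projections. *)
Section rV_measurable.
Context (R : realType) (d : nat).
Let coors : 'I_d -> 'rV[R]_d -> R := fun i x => x ord0 i.
Let rV_set0 : g_sigma_preimage coors set0.
Proof. exact: sigma_algebra0. Qed.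
Let rV_setC A : g_sigma_preimage coors A -> g_sigma_preimage coors (~` A).
Proof. exact: sigma_algebraC. Qed.
Let rV_bigcup (F : (set 'rV[R]_d)^nat) : (forall i, g_sigma_preimage coors (F i)) ->
  g_sigma_preimage coors (\bigcup_i (F i)).
Proof. exact: sigma_algebra_bigcup. Qed.
HB.instance Definition _ := @isMeasurable.Build rV_display
  'rV[R]_d (g_sigma_preimage coors) rV_set0 rV_setC rV_bigcup.
End rV_measurable.

Section rV_lebesgue.
Context (R : realType).

Definition rV_cons d (x : R * 'rV[R]_d) : 'rV[R]_d.+1 := row_mx x.1%:M x.2.

Lemma rV_cons0 d (x : R * 'rV[R]_d) : rV_cons x ord0 ord0 = x.1.
Proof.
rewrite /rV_cons (_ : ord0 = lshift d (ord0 : 'I_1)); last exact: val_inj.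
by rewrite (row_mxEl x.1%:M x.2) mxE eqxx mulr1n.
Qed.

Lemma rV_consS d (x : R * 'rV[R]_d) j : rV_cons x ord0 (lift ord0 j) = x.2 ord0 j.
Proof.
rewrite /rV_cons (_ : lift ord0 j = rshift 1 j); last exact: val_inj.
exact: (row_mxEr x.1%:M x.2).
Qed.

Lemma measurable_rV_coord d i :
  measurable_fun [set: 'rV[R]_d] (fun x : 'rV[R]_d => x ord0 i).
Proof.
move=> _ Y mY; rewrite setTI; apply: sub_sigma_algebra => /=.
rewrite -bigcup_seq/=; exists i => /=; first by rewrite mem_index_enum.
by exists Y => //; rewrite setTI.
Qed.

Lemma measurable_rVP d0 (T : measurableType d0) d (f : T -> 'rV[R]_d) :
  (forall i, measurable_fun [set: T] (fun t => f t ord0 i)) ->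
  measurable_fun [set: T] f.
Proof.
move=> mf; apply: (@measurability _ _ _ _ _ _
  (\big[setU/set0]_(i < d)
     preimage_set_system setT (fun x : 'rV[R]_d => x ord0 i) measurable)) => //.
move=> _ [B + <-]; rewrite -bigcup_seq => -[i _ [C mC <-]].
by rewrite setTI -comp_preimage; exact: mf.
Qed.

Lemma measurable_rV_cons d : measurable_fun [set: R * 'rV[R]_d] (@rV_cons d).
Proof.
apply: measurable_rVP => i; case: (unliftP ord0 i) => [j ->|->].
  rewrite (_ : (fun _ => _) = (fun y : 'rV[R]_d => y ord0 j) \o snd).
    by apply: measurableT_comp => //; exact: measurable_rV_coord.
  by apply/funext => x /=; rewrite rV_consS.
rewrite (_ : (fun _ => _) = fst); first exact: measurable_fst.
by apply/funext => x /=; rewrite rV_cons0.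
Qed.

Section cons_measure.
Context (d : nat) (mu : {sigma_finite_measure set 'rV[R]_d -> \bar R}).

Definition rV_cons_measure : set 'rV[R]_d.+1 -> \bar R :=
  pushforward (lebesgue_measure \x mu)%E (@rV_cons d).

Let M : {measure set 'rV[R]_d.+1 -> \bar R} :=
  measure_function_pushforward__canonical__measure_function_Measure
    (lebesgue_measure \x mu)%E (@measurable_rV_cons d).

Let rV_cons_measure0 : rV_cons_measure set0 = 0%E.
Proof. exact: (measure0 M). Qed.
Let rV_cons_measure_ge0 A : (0 <= rV_cons_measure A)%E.
Proof. exact: (measure_ge0 M). Qed.
Let rV_cons_measure_sigma_additive : semi_sigma_additive rV_cons_measure.
Proof. exact: (@measure_semi_sigma_additive _ _ _ M). Qed.

HB.instance Definition _ := isMeasure.Build _ _ _ rV_cons_measure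
  rV_cons_measure0 rV_cons_measure_ge0 rV_cons_measure_sigma_additive.

Let rV_cons_measure_sigma_finite : sigma_finite setT rV_cons_measure.
Proof.
have /sigma_finiteP[F [TF ndF Foo]] := sigma_finiteT (@lebesgue_measure R).
have /sigma_finiteP[G [TG ndG Goo]] := sigma_finiteT mu.
pose uncons (v : 'rV[R]_d.+1) : R * 'rV[R]_d :=
  (v ord0 ord0, \row_j v ord0 (lift ord0 j)).
have consK : cancel (@rV_cons d) uncons.
  move=> [a x]; congr (_, _); first by rewrite rV_cons0.
  by apply/rowP => j; rewrite mxE rV_consS.
have muncons : measurable_fun setT uncons.
  apply/measurable_fun_pairP; split; first exact: measurable_rV_coord.
  apply: measurable_rVP => j.
  apply: eq_measurable_fun (measurable_rV_coord (lift ord0 j)).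
  by move=> v _ /=; rewrite mxE.
exists (fun n => uncons @^-1` (F n `*` G n)).
  apply/seteqP; split => // v _.
  have [n _ Fn] : (\bigcup_i F i) (uncons v).1 by rewrite -TF.
  have [m _ Gm] : (\bigcup_i G i) (uncons v).2 by rewrite -TG.
  exists (maxn n m) => //; split.
  - by move: Fn; exact/subsetPset/ndF/leq_maxl.
  - by move: Gm; exact/subsetPset/ndG/leq_maxr.
move=> n; have [mF Fn] := Foo n; have [mG Gn] := Goo n.
have mFG : measurable (F n `*` G n) by exact: measurableX.
split; first by rewrite -[X in measurable X]setTI; exact: muncons.
rewrite /rV_cons_measure /pushforward -comp_preimage.
rewrite (_ : uncons \o _ = id) ?preimage_id; last by apply/funext => z /=.
by rewrite product_measure1E// lte_mul_pinfty// ge0_fin_numE.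
Qed.

HB.instance Definition _ := Measure_isSigmaFinite.Build _ _ _ rV_cons_measure
  rV_cons_measure_sigma_finite.
End cons_measure.

(* Lebesgue measure on R^d: iterated product of the one on R, transported
   along the bijection R * R^d -> R^(d+1). *)
Fixpoint lebesgue_rV d : {sigma_finite_measure set 'rV[R]_d -> \bar R} :=
  match d with
  | 0 => \d_(0 : 'rV[R]_0)
  | d'.+1 => rV_cons_measure (lebesgue_rV d')
  end.
End rV_lebesgue.

Section euclidean.
Context (R : realType) (d : nat).
Local Notation V := 'rV[R]_d.

Definition dotv (x y : V) : R := \sum_(i < d) x ord0 i * y ord0 i.

(* Euclidean norm; the library norm [`|x|] on row vectors is the max norm. *)
Definition enorm (x : V) : R := Num.sqrt (dotv x x).

Definition ediam (D : set V) : R :=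
  sup [set enorm (z.1 - z.2) | z in D `*` D].

(* Supremum of the diameters of the balls contained in D. *)
Definition inball_diam (D : set V) : R :=
  sup [set r *+ 2 | r in
    [set r | 0 < r /\ exists c, [set x | enorm (x - c) < r] `<=` D]].

Definition bd (D : set V) : set V := closure D `\` D°.

Definition supp (f : V -> R) : set V := closure [set x | f x != 0].

Definition affinely_independent r (v : 'I_r -> V) : Prop :=
  forall w : 'I_r -> R, \sum_i w i = 0 -> \sum_i w i *: v i = 0 ->
  forall i, w i = 0.

Definition face r (v : 'I_r -> V) (S : pred 'I_r) : set V :=
  [set x | exists w : 'I_r -> R, [/\ forall i, 0 <= w i, \sum_i w i = 1,
    forall i, ~~ S i -> w i = 0 & x = \sum_i w i *: v i]].

Definition simplex r (v : 'I_r -> V) : set V := face v predT.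

(* Bounded domain whose boundary is a finite union of (d-1)-simplices. *)
Definition polytopal_domain (Om : set V) : Prop :=
  [/\ Om !=set0, open Om, connected Om, bounded_set Om &
    exists (n : nat) (v : 'I_n -> 'I_d -> V),
      (forall j, affinely_independent (v j)) /\
      bd Om = \bigcup_(j in [set: 'I_n]) simplex (v j)].

(* Near each boundary point, and in suitable orthonormal coordinates, the set
   lies strictly below the graph of a Lipschitz function. *)
Definition lipschitz_boundary (Om : set V) : Prop :=
  forall x0, bd Om x0 ->
  exists (Q : 'M[R]_d) (i : 'I_d) (g : 'rV[R]_d.-1 -> R),
    [/\ Q *m Q^T = 1%:M, lipschitz g &
      \forall y \near x0,
        Om y <-> (y *m Q) ord0 i < g (col' i (y *m Q))].

End euclidean.

Section sobolev.
Context (R : realType) (d : nat).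
Local Notation V := 'rV[R]_d.
Local Notation leb := (lebesgue_rV R d).
Implicit Types (D : set V) (f u v : V -> R).

Definition pderiv (i : 'I_d) f : V -> R := fun x => 'D_(delta_mx ord0 i) f x.

Fixpoint C_k (k : nat) f : Prop :=
  if k is k'.+1 then
    [/\ continuous f, forall i x, derivable f x (delta_mx ord0 i)
      & forall i, C_k k' (pderiv i f)]
  else continuous f.

Definition test_function D f : Prop :=
  [/\ forall k, C_k k f, compact (supp f) & supp f `<=` D].

Definition L2 D f : Prop :=
  measurable_fun D f /\ leb.-integrable D (fun x => (f x ^+ 2)%:E).

Definition ip D f (g : V -> R) : R := \int[leb]_(x in D) (f x * g x).

Definition l2norm D f : R := Num.sqrt (ip D f f).

Definition is_weak_grad D u (g : V -> V) : Prop :=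
  forall i : 'I_d, L2 D (fun x => g x ord0 i) /\
    forall psi, test_function D psi ->
      ip D u (pderiv i psi) = - ip D (fun x => g x ord0 i) psi.

(* A representative of the weak gradient, which is unique only almost
   everywhere; meaningful for functions in [H1 D]. *)
Definition wgrad D u : V -> V := xget (fun=> 0) [set g | is_weak_grad D u g].

Definition H1 D u : Prop := L2 D u /\ exists g, is_weak_grad D u g.

Definition h1norm D u : R :=
  Num.sqrt (ip D u u + \int[leb]_(x in D) dotv (wgrad D u x) (wgrad D u x)).

Definition H10 D u : Prop :=
  H1 D u /\ forall e : R, 0 < e ->
    exists2 psi, test_function D psi & h1norm D (u \- psi) < e.

(* The operator acts on row vectors: xi *m (A x)^T is the transpose of
   A(x) applied to the column vector xi^T. *)
Definition elliptic D (A : V -> 'M[R]_d) (amax : R) : Prop :=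
  (forall i j, measurable_fun D (fun x => A x i j)) /\
  forall x, D x -> (A x)^T = A x /\
    forall xi : V, dotv xi xi <= dotv (xi *m (A x)^T) xi <= amax * dotv xi xi.

Definition form_a (A : V -> 'M[R]_d) D u v : R :=
  \int[leb]_(x in D) dotv (wgrad D u x *m (A x)^T) (wgrad D v x).

Definition form_b A (k : R) D u v : R := form_a A D u v - k ^+ 2 * ip D u v.

Definition ip1k A (k : R) D u v : R := form_a A D u v + k ^+ 2 * ip D u v.

Definition norm1k A (k : R) D u : R := Num.sqrt (ip1k A k D u u).

Definition weak_solution A (k : R) D f u : Prop :=
  H10 D u /\ forall v, H10 D v -> form_b A k D u v = ip D f v.

Definition stable A (k : R) D (Cstab : R) : Prop :=
  0 < Cstab /\ forall f, L2 D f -> exists u,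
    [/\ weak_solution A k D f u,
      forall u', weak_solution A k D f u' ->
        {ae leb, forall x, D x -> u' x = u x} &
      norm1k A k D u <= Cstab * l2norm D f].

End sobolev.

Section families.
Context (R : realType) (T : Type).
Implicit Types (S : set (T -> R)).

Definition lincomb n (c : 'I_n -> R) (e : 'I_n -> T -> R) : T -> R :=
  fun x => \sum_(j < n) c j * e j x.

Definition fspan n (e : 'I_n -> T -> R) : set (T -> R) :=
  [set v | exists c, v = lincomb c e].

Definition is_basis n S (e : 'I_n -> T -> R) : Prop :=
  (forall c, lincomb c e = (fun=> 0) -> forall j, c j = 0) /\ fspan e = S.

Definition has_dim S (n : nat) : Prop :=
  exists e : 'I_n -> T -> R, is_basis S e.

Definition coords n (e : 'I_n -> T -> R) (v : T -> R) : 'I_n -> R :=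
  xget (fun=> 0) [set c | v = lincomb c e].

End families.

Section finite_elements.
Context (R : realType) (d : nat).
Local Notation V := 'rV[R]_d.

Record mesh := Mesh {
  ncell : nat;
  vertex : 'I_ncell -> 'I_d.+1 -> V }.

Definition cell (T : mesh) (t : 'I_(ncell T)) : set V := simplex (vertex t).

Definition triangulation (Om : set V) (T : mesh) : Prop :=
  [/\ forall t : 'I_(ncell T), affinely_independent (vertex t),
    forall t t' : 'I_(ncell T), t != t' ->
      exists S S' : pred 'I_d.+1, [/\ exists i, ~~ S i,
        cell t `&` cell t' = face (vertex t) S &
        face (vertex t) S = face (vertex t') S'] &
    closure Om = \bigcup_(t in [set: 'I_(ncell T)]) cell t].

Definition mesh_size (T : mesh) : R :=
  \big[Num.max/0]_(t < ncell T) ediam (cell t).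

Record fe_space := FESpace {
  fe_mesh : mesh;
  fe_dim : nat;
  fe_basis : 'I_fe_dim -> V -> R;
  fe_node : 'I_fe_dim -> V }.

Definition fe_fun (F : fe_space) : set (V -> R) := fspan (@fe_basis F).

(* H^1_0-conforming space of continuous piecewise polynomials with a nodal
   basis. The last clause is unisolvence, on every simplex and on each of its
   faces: it is what identifies restrictions to, and zero traces on, unions of
   simplices with sets of degrees of freedom. Basis functions are defined on
   the whole of R^d and vanish outside Om. *)
Definition conforming_fe (Om : set V) (F : fe_space) : Prop :=
  [/\ is_basis (fe_fun F) (@fe_basis F),
    forall v, fe_fun F v ->
      [/\ H10 Om v, continuous v, forall x, ~ Om x -> v x = 0 &
        forall t : 'I_(ncell (fe_mesh F)), exists q : mpoly.mpoly d R,
          forall x, cell t x -> v x = mpoly.meval (fun i => x ord0 i) q],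
    forall i j : 'I_(fe_dim F), fe_basis i (fe_node j) = (i == j)%:R &
    forall v (t : 'I_(ncell (fe_mesh F))) (S : pred 'I_d.+1), fe_fun F v ->
      (forall j : 'I_(fe_dim F), face (vertex t) S (fe_node j) ->
         v (fe_node j) = 0) ->
      forall x, face (vertex t) S x -> v x = 0].

(* Family of discretisations indexed by the mesh sizes h in hs. *)
Definition fe_family (Om : set V) (hs : set R) (F : R -> fe_space) : Prop :=
  (forall h, hs h -> [/\ triangulation Om (fe_mesh (F h)),
    mesh_size (fe_mesh (F h)) = h & conforming_fe Om (F h)]) /\
  exists gamma : R, forall h, hs h -> forall t : 'I_(ncell (fe_mesh (F h))),
    ediam (cell t) <= gamma * inball_diam (cell t).

Definition discrete_solution A (k : R) Om (F : fe_space) f u : Prop :=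
  fe_fun F u /\ forall v, fe_fun F v -> form_b A k Om u v = ip Om f v.

Definition resolution_threshold A (k : R) Om hs (F : R -> fe_space) (h1 : R) :
    Prop :=
  0 < h1 /\ forall h, hs h -> 0 < h < h1 -> forall f, L2 Om f ->
    (exists! uh, discrete_solution A k Om (F h) f uh) /\
    forall u uh, weak_solution A k Om f u ->
      discrete_solution A k Om (F h) f uh ->
      norm1k A k Om (u \- uh) <= l2norm Om f.

End finite_elements.

(* A function on a subset D of R^d is represented by its extension by zero,
   so that the restriction of w to D is [w \_ D] and the extension operators
   E_i act as the identity. *)
Section decomposition.
Context (R : realType) (d : nat).
Local Notation V := 'rV[R]_d.
Context (A : V -> 'M[R]_d) (k : R) (F : fe_space R d) (N : nat).
Context (Omp : 'I_N -> set V) (layers : 'I_N -> nat).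
Local Notation n := (fe_dim F).
Local Notation phi := (@fe_basis _ _ F).
Implicit Types (i : 'I_N) (j : 'I_n) (v p : V -> R).

Definition partition_resolved (Om : set V) : Prop :=
  [/\ forall i, [/\ Omp i !=set0, open (Omp i), connected (Omp i) &
        Omp i `<=` Om],
    forall i i', i != i' -> Omp i `&` Omp i' = set0,
    closure Om = \bigcup_(i in [set: 'I_N]) closure (Omp i) &
    forall i, exists S : set 'I_(ncell (fe_mesh F)),
      closure (Omp i) = \bigcup_(t in S) cell t].

Definition add_layer (D : set V) : set V :=
  (\bigcup_(j in [set j | supp (phi j) `&` D !=set0]) supp (phi j))°.

Definition subdomain i : set V := iter (layers i) add_layer (Omp i).

Definition Vtilde i : set (V -> R) :=
  [set v | exists2 w, fe_fun F w & v = w \_ (subdomain i)].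

(* w is continuous, so the trace of v on the boundary is the value of w. *)
Definition Vloc i : set (V -> R) :=
  [set v | exists w, [/\ fe_fun F w, v = w \_ (subdomain i) &
    forall x, bd (subdomain i) x -> w x = 0]].

Definition subdomain_diam : R :=
  \big[Num.max/0]_(i < N) ediam (subdomain i).

(* The inclusion of T in the open set Omega_i is understood up to the
   boundary of the closed simplex T. *)
Definition overlap : nat :=
  \max_(t < ncell (fe_mesh F))
    #|[pred i : 'I_N | `[< (cell t)° `<=` subdomain i >]]|.

Definition dofbar i : pred 'I_n :=
  fun j => `[< supp (phi j) `&` subdomain i !=set0 >].

Definition dof i : pred 'I_n :=
  fun j => `[< supp (phi j) `<=` closure (subdomain i) >].

Definition multiplicity j : nat := #|[pred i | dof i j]|.

Definition phi_loc i j : V -> R := phi j \_ (subdomain i).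

Definition dofbar_coef i v : 'I_n -> R :=
  xget (fun=> 0)
    [set c | v = fun x => \sum_(j < n | dofbar i j) c j * phi_loc i j x].

Definition Xi i v : V -> R := fun x =>
  \sum_(j < n | dof i j)
    (multiplicity j)%:R^-1 * dofbar_coef i v j * phi_loc i j x.

Definition eigenpair i p (lam : \bar R) : Prop :=
  (exists2 r : R, lam = r%:E &
    [/\ Vtilde i p, p <> (fun=> 0) & forall v, Vtilde i v ->
      form_a A (subdomain i) p v =
      r * ip1k A k (subdomain i) (Xi i p) (Xi i v)])
  \/ [/\ Vtilde i p, Xi i p = (fun=> 0) & lam = +oo%E].

(* Numbering from 0: p l and lam l stand for p_{l+1} and lambda_{l+1}. The
   value of lam beyond the dimension nt of Vtilde is the convention
   lambda_{nt+1} = +oo. *)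
Definition eigensystem i (nt s : nat) (p : nat -> V -> R) (lam : nat -> \bar R)
    : Prop :=
  [/\ has_dim (Vloc i) s,
    is_basis (Vtilde i) (fun l : 'I_nt => p l),
    forall l, (l < nt)%N -> eigenpair i (p l) (lam l),
    (forall l l', (l <= l')%N -> (lam l <= lam l')%E) /\
    (forall l, (lam l = +oo%E) <-> (s <= l)%N) &
    forall l l', (l < s)%N -> (l' < s)%N ->
      ip1k A k (subdomain i) (Xi i (p l)) (Xi i (p l')) = (l == l')%:R].

Definition coarse_space (p : 'I_N -> nat -> V -> R) (m : 'I_N -> nat)
    : set (V -> R) :=
  [set v | exists c : 'I_N -> nat -> R, v = fun x =>
    \sum_(i < N) \sum_(l < m i) c i l * Xi i (p i l) x].

(* With the numbering from 0, lam i (m i) is lambda^i_{m_i + 1}. *)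
Definition coarse_threshold (lam : 'I_N -> nat -> \bar R) (m : 'I_N -> nat)
    : \bar R :=
  \big[Order.min/+oo%E]_(i < N) lam i (m i).

Definition stiffness_mx (Om : set V) : 'M[R]_n :=
  \matrix_(i, j) form_a A Om (phi j) (phi i).

Definition mass_mx (Om : set V) : 'M[R]_n :=
  \matrix_(i, j) ip Om (phi j) (phi i).

Definition B_mx (Om : set V) : 'M[R]_n :=
  \matrix_(i, j) form_b A k Om (phi j) (phi i).

Definition D_mx (Om : set V) : 'M[R]_n :=
  stiffness_mx Om + k ^+ 2 *: mass_mx Om.

Definition load (Om : set V) (f : V -> R) : 'cV[R]_n :=
  \col_i ip Om f (phi i).

(* Matrix, with respect to the family e and the basis phi, of the extension
   by zero. *)
Definition E_mx r (e : 'I_r -> V -> R) : 'M[R]_(n, r) :=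
  \matrix_(l, q) coords phi (e q) l.

Definition local_basis i : 'I_#|dof i| -> V -> R :=
  fun q => phi_loc i (enum_val q).

Definition sub_mx (Om : set V) r (e : 'I_r -> V -> R) : 'M[R]_r :=
  (E_mx e)^T *m B_mx Om *m E_mx e.

Definition two_level_mx (Om : set V) r0 (e0 : 'I_r0 -> V -> R) : 'M[R]_n :=
  E_mx e0 *m invmx (sub_mx Om e0) *m (E_mx e0)^T
  + \sum_(i < N) E_mx (@local_basis i) *m invmx (sub_mx Om (@local_basis i))
                 *m (E_mx (@local_basis i))^T.

End decomposition.
Arguments local_basis {R d} F {N} Omp layers i.

Section gmres.
Context (R : realType) (n : nat).

Definition energy_norm (D : 'M[R]_n) (x : 'cV[R]_n) : R :=
  Num.sqrt ((x^T *m D *m x) ord0 ord0).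

Definition krylov (M : 'M[R]_n) (r : 'cV[R]_n) (m : nat) : set 'cV[R]_n :=
  [set z | exists c : 'I_m -> R, z = \sum_(j < m) c j *: (M ^+ j *m r)].

Definition gmres (D M : 'M[R]_n) (g : 'cV[R]_n) (u : nat -> 'cV[R]_n) : Prop :=
  forall m,
    let K := krylov M (g - M *m u 0%N) m in
    K (u m - u 0%N) /\
    forall w, K (w - u 0%N) ->
      energy_norm D (g - M *m u m) <= energy_norm D (g - M *m w).

End gmres.

(* Main.v *)
Require Import Defs.
From HB Require Import structures.
From mathcomp Require Import all_boot all_order all_algebra.
From mathcomp Require Import all_classical all_reals all_analysis.
From mathcomp Require mpoly.
From mathcomp Require Import measurable_realfun ring lra.
Set Implicit Arguments. Unset Strict Implicit. Unset Printing Implicit Defensive.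
Import Order.TTheory GRing.Theory Num.Theory.
Import numFieldNormedType.Exports.
Local Open Scope classical_set_scope.
Local Open Scope ring_scope.

(* The preconditioned operator is T = T_0 + sum_i T_i, with T_0, T_i the
   Galerkin projections, for the indefinite form b, on the coarse and local
   spaces.  It suffices to show, for the energy form D = a + k^2 (.,.),
   c1 D(x,x) <= D(x, T x) and D(T x, T x) <= c2^2 D(x,x): a minimal residual step
   then contracts the residual by 1 - c1^2/c2^2.

   - Coarse space: a duality argument through the discrete solution operator,
     bounded by 1 + C_stab, makes k |x - T_0 x| a small multiple of the energy
     (smallness of s).  It applies because the eigenfunctions left out of V_0
     have eigenvalue at least tau, whence a splitting x = z_0 + sum_i z_i with
     D(z_i,z_i) <= Theta a_i(x,x).
   - Local spaces: a function vanishing outside Omega_i satisfies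
     2 |w|^2 <= H^2 a(w,w), so the k^2-terms are a perturbation (smallness of t).
     This Friedrichs inequality comes from |w|^2 = -2 int (x_l - c) w d_l w, with
     c the midpoint of the l-th coordinate range of Omega_i, summed over the
     d >= 2 coordinates.

   What has to be known about Sobolev functions reduces to uniqueness of the weak
   gradient.  Integrals over the mesh only see the interiors of the cells, and a
   basis function, polynomial on each cell, vanishes on a cell as soon as it
   vanishes near one interior point; so each subdomain is, up to a null set, a
   union of cells. *)

(** * Lebesgue measure on row vectors *)

(** As b is indefinite, even the solvability of the coarse and local problems has to be earned. It
    follows from the two estimates that later control the k^2-terms: the duality estimate is stated
    for any vector b-orthogonal to the coarse space, hence is available before T_0 is known to be
    well defined. The dual problem is solved in the finite element space itself, so the splitting
    applies to its solution directly; h_1 enters only there. K = 2 + 3 Lambda^2 Theta bounds the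
    energy of the splitting: 2 + 2 Lambda^2 Theta for z_0, and Lambda Theta <= Lambda^2 Theta for
    the z_i together. With sigma = Lambda Theta^(1/2) (1 + C_stab) k and eta = H k / sqrt 2, one has
    s = 8 K sigma and t = 12 Lambda K eta; since K >= 2 and Lambda >= 1, sigma < 1/16 and eta <
    1/24. The upper bound is obtained with c2 in place of c2^2, and c2 >= 1. The Schwarz theory is
    done on coefficient vectors with abstract matrices; function spaces serve to verify its
    hypotheses. *)

Section row_space_measure.
Context {R : realType}.

Definition rV_box d (a b : 'I_d -> R) : set 'rV[R]_d :=
  [set x | forall i, a i < x ord0 i < b i].

Lemma nbhs_rVP d (x : 'rV[R]_d) (U : set 'rV[R]_d) :
  nbhs x U <-> exists2 e : R, 0 < e &
    forall y : 'rV[R]_d, (forall i, `|x ord0 i - y ord0 i| < e) -> U y.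
Proof.
split=> [/nbhs_ballP|] [e /= e0 H].
  by exists e => // y xy; apply: H; split => // i j; rewrite ord1; exact: xy.
by apply/nbhs_ballP; exists e => // y [_ xy]; apply: H => i; exact: xy.
Qed.

(** Cubes with rational centre and half-side 1/(n+1) form a countable base. The closed cube has to
    stay in [U] because the bump functions built below are supported in closed boxes. *)
Lemma rat_box_nbhs d (x : 'rV[R]_d) (U : set 'rV[R]_d) : nbhs x U ->
  exists q : {ffun 'I_d -> rat} * nat,
    let a i := ratr (q.1 i) - q.2.+1%:R^-1 in
    let b i := ratr (q.1 i) + q.2.+1%:R^-1 in
    rV_box a b x /\
    forall y : 'rV[R]_d, (forall i, a i <= y ord0 i <= b i) -> U y.
Proof.
move=> /nbhs_rVP[e e0 He].
have e4 : 0 < e / 4 by rewrite divr_gt0.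
have [n _ /(_ n (leqnn n))/= ne] := near_infty_natSinv_lt (PosNum e4).
have n0 : 0 < n.+1%:R^-1 :> R by rewrite invr_gt0.
pose t : R := n.+1%:R^-1; rewrite -/t in ne n0.
have Hq i : exists q : rat, `|x ord0 i - ratr q| < t.
  have [|q qP] := @rat_in_itvoo R (x ord0 i) (x ord0 i + t).
    by rewrite ltrDl.
  exists q; move: qP; rewrite in_itv/= => /andP[q1 q2].
  by rewrite ltr_norml; apply/andP; split; lra.
exists ([ffun i => projT1 (cid (Hq i))], n); split => /=.
  move=> i; rewrite -/t ffunE; case: cid => q /= /ltr_normlP[h1 h2].
  by apply/andP; split; lra.
move=> y Hy; apply: He => i; have := Hy i.
rewrite -/t ffunE; case: cid => q /= /ltr_normlP[h1 h2] /andP[h3 h4].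
by rewrite ltr_norml; apply/andP; split; lra.
Qed.

Lemma measurable_rV_box d (a b : 'I_d -> R) : measurable (rV_box a b).
Proof.
rewrite (_ : rV_box a b = \bigcap_(i in [set: 'I_d])
    (fun x : 'rV[R]_d => x ord0 i) @^-1` `]a i, b i[%classic); last first.
  apply/seteqP; split => x /= Hx i; last first.
    by have := Hx i I; rewrite /= in_itv.
  by move=> _; rewrite /= in_itv/=; exact: Hx.
apply: fin_bigcap_measurable => // i _.
by rewrite -[X in measurable X]setTI; exact: measurable_rV_coord.
Qed.

Lemma open_rat_boxes d (U : set 'rV[R]_d) : open U ->
  let a (q : {ffun 'I_d -> rat} * nat) i : R := ratr (q.1 i) - q.2.+1%:R^-1 in
  let b (q : {ffun 'I_d -> rat} * nat) i : R := ratr (q.1 i) + q.2.+1%:R^-1 in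
  U = \bigcup_(q in [set q | forall y : 'rV[R]_d,
    (forall i, a q i <= y ord0 i <= b q i) -> U y]) rV_box (a q) (b q).
Proof.
move=> oU a b; apply/seteqP; split => x.
  move=> Ux; have : nbhs x U by exact: open_nbhs_nbhs.
  by move=> /rat_box_nbhs[q [qx qU]]; exists q.
move=> [q qU qx]; apply: qU => i; have /andP[h1 h2] := qx i.
by rewrite (ltW h1) (ltW h2).
Qed.

Lemma measurable_rV_open d (U : set 'rV[R]_d) : open U -> measurable U.
Proof.
move=> /open_rat_boxes ->; rewrite bigcup_mkcond.
apply: countable_bigcupT_measurable => // q.
by case: ifP => // _; exact: measurable_rV_box.
Qed.

Lemma continuous_rV_measurable d (f : 'rV[R]_d -> R) : continuous f ->
  measurable_fun [set: 'rV[R]_d] f.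
Proof.
move=> cf; apply: (measurability _ (measurable_realfun.RGenOpens.measurableE R)) => //.
move=> _ [_ [a [b ->] <-]]; rewrite setTI; apply: measurable_rV_open.
by apply: open_comp => // x _; exact: cf.
Qed.

Lemma lebesgue_rV_boxE d (a b : 'I_d -> R) : (forall i, a i <= b i) ->
  lebesgue_rV R d (rV_box a b) = (\prod_i (b i - a i))%:E.
Proof.
elim: d a b => [|d IH] a b ab.
  by rewrite big_ord0 /= diracE mem_set// => -[].
rewrite big_ord_recl /= /rV_cons_measure /pushforward.
rewrite (_ : _ @^-1` _ = `]a ord0, b ord0[%classic `*`
  rV_box (fun i => a (lift ord0 i)) (fun i => b (lift ord0 i))); last first.
  apply/seteqP; split => -[t x] /=.
    move=> H; split; first by have := H ord0; rewrite rV_cons0 /= in_itv.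
    by move=> i; have := H (lift ord0 i); rewrite rV_consS.
  move=> [+ H] i; rewrite in_itv/= => Ht.
  by case: (unliftP ord0 i) => [j ->|->]; rewrite ?rV_cons0 ?rV_consS//=; exact: H.
rewrite product_measure1E//; last exact: measurable_rV_box.
rewrite [X in (X * _)%E](lebesgue_measure_itv `]a ord0, b ord0[) /= IH// -EFinD lte_fin.
case: ltP => [_|ba]; first by rewrite EFinM.
by rewrite mul0e (_ : b _ - a _ = 0) ?mul0r//; have := ab ord0; lra.
Qed.

Lemma lebesgue_rV_open_gt0 d (U : set 'rV[R]_d) : open U -> U !=set0 ->
  (0 < lebesgue_rV R d U)%E.
Proof.
move=> oU [x Ux]; have /rat_box_nbhs[q [qx qU]] := open_nbhs_nbhs (conj oU Ux).
set a := (X in rV_box X) in qx; set b := (X in rV_box _ X) in qx.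
have sU : rV_box a b `<=` U.
  by move=> y Hy; apply: qU => i; have /andP[/ltW -> /ltW ->] := Hy i.
apply: (@lt_le_trans _ _ (lebesgue_rV R d (rV_box a b))); last first.
  by apply: le_measure => //; rewrite inE; [exact: measurable_rV_box|exact: measurable_rV_open].
have ab i : a i < b i by have /andP[h1 h2] := qx i; exact: lt_trans h2.
rewrite lebesgue_rV_boxE; last by move=> i; exact: ltW.
by rewrite lte_fin prodr_gt0// => i _; rewrite subr_gt0.
Qed.

Lemma coord_le_norm d (x : 'rV[R]_d) i : `|x ord0 i| <= `|x|.
Proof.
rewrite [leRHS]/Num.Def.normr /= mx_normrE; apply/bigmax_geP; right => /=.
by exists (ord0, i).
Qed.

Lemma lebesgue_rV_bounded d (D : set 'rV[R]_d) : measurable D -> bounded_set D ->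
  (lebesgue_rV R d D < +oo)%E.
Proof.
move=> mD [M [_ /(_ (`|M| + 1))]]; rewrite (le_lt_trans (ler_norm _)) ?ltrDl// => /(_ isT) HM.
pose K := `|M| + 2.
apply: (@le_lt_trans _ _ (lebesgue_rV R d (rV_box (fun=> - K) (fun=> K)))).
  apply: le_measure => //; rewrite ?inE//; first exact: measurable_rV_box.
  move=> x Dx i; rewrite -ltr_norml.
  have := coord_le_norm x i.
  by have /= := HM _ Dx; rewrite /K; lra.
rewrite lebesgue_rV_boxE ?ltry// => i; rewrite /K.
by have := normr_ge0 M; lra.
Qed.

(** Induction on the dimension. If [i0] is not the first index, every slice with fixed first
    coordinate is a hyperplane one dimension lower; if it is, the slices along the first coordinate
    are single points, and the product measure is computed in the other order of integration. *)
Lemma lebesgue_rV_hyperplane d (c : 'I_d -> R) (al : R) (i0 : 'I_d) : c i0 != 0 ->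
  lebesgue_rV R d [set x | \sum_i c i * x ord0 i = al] = 0.
Proof.
elim: d c al i0 => [|d IH] c al i0 ci0; first by case: i0 ci0.
rewrite /= /rV_cons_measure /pushforward.
set P := _ @^-1` _.
have PE : P = [set z : R * 'rV[R]_d | c ord0 * z.1 +
    \sum_(i < d) c (lift ord0 i) * z.2 ord0 i = al].
  have E z : \sum_(i < d.+1) c i * rV_cons z ord0 i =
      c ord0 * z.1 + \sum_(i < d) c (lift ord0 i) * z.2 ord0 i.
    rewrite big_ord_recl rV_cons0; congr (_ + _).
    by apply: eq_bigr => i _; rewrite rV_consS.
  by apply/seteqP; split => z; rewrite /P /= E.
have mP : measurable P.
  rewrite -[P]setTI; apply: measurable_rV_cons => //.
  rewrite -[X in measurable X]setTI.
  rewrite (_ : (fun x => _) = (fun x : 'rV[R]_d.+1 => \sum_i c i * x ord0 i) @^-1` [set al]) //.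
  apply: measurable_sum => // i; apply: measurable_funM => //.
  exact: measurable_rV_coord.
case: (unliftP ord0 i0) ci0 => [j ->|->] ci0.
  rewrite /product_measure1 /= integral0_eq// => t _ /=.
  rewrite (_ : xsection P t = [set x : 'rV[R]_d | \sum_(i < d) c (lift ord0 i) * x ord0 i =
     al - c ord0 * t]).
    exact: IH ci0.
  apply/seteqP; split => y /=; rewrite /xsection/= PE ?inE/=; lra.
rewrite (@product_measure_unique _ _ _ _ _ _ _ (lebesgue_measure \x^ lebesgue_rV R d)%E)//; last first.
  by move=> A B mA mB; exact: product_measure2E.
change (\int[lebesgue_rV R d]_y (lebesgue_measure \o ysection P) y = 0)%E.
rewrite integral0_eq// => y _ /=.
rewrite (_ : ysection P y = [set ((al - \sum_(i < d) c (lift ord0 i) * y ord0 i) / c ord0)]).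
  by rewrite lebesgue_measure_set1.
apply/seteqP; split => t /=; rewrite /ysection/= PE ?inE/=.
  by move=> <-; rewrite addrK mulrAC mulfV ?mul1r.
by move=> ->; rewrite mulrC divfK// subrK.
Qed.

Lemma continuous_rVP (T : topologicalType) d (F : T -> 'rV[R]_d) :
  (forall i, continuous (fun t => F t ord0 i)) -> continuous F.
Proof.
move=> cF t U /nbhs_rVP[e e0 eU].
suff : \forall s \near t, forall i, `|F t ord0 i - F s ord0 i| < e.
  by apply: filterS => s Hs; exact: eU.
apply: filter_forall => i; have /cvgrPdist_lt := cF i t; exact.
Qed.

Lemma continuous_rV_cons_l d (y : 'rV[R]_d) : continuous (fun t : R => rV_cons (t, y)).
Proof.
apply: continuous_rVP => i; case: (unliftP ord0 i) => [j ->|->].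
  under eq_fun do rewrite rV_consS /=; move=> ?; exact: cvg_cst.
under eq_fun do rewrite rV_cons0 /=; move=> ?; exact: cvg_id.
Qed.

Lemma continuous_rV_cons_r d (t : R) : continuous (fun y : 'rV[R]_d => rV_cons (t, y)).
Proof.
apply: continuous_rVP => i; case: (unliftP ord0 i) => [j ->|->].
  under eq_fun do rewrite rV_consS /=; exact: coord_continuous.
rewrite (_ : (fun _ => _) = cst t); first exact: cst_continuous.
by apply/funext => z; rewrite rV_cons0.
Qed.

(* Derivatives only see the restriction of a function to a line. *)
Lemma derive_line (V W : normedModType R) (f : V -> R) (g : W -> R) a v b w :
  (forall h : R, f (h *: v + a) = g (h *: w + b)) ->
  (derivable f a v -> derivable g b w) /\ 'D_v f a = 'D_w g b.
Proof.
move=> fg; have e : (fun h : R => h^-1 *: ((f \o shift a) (h *: v) - f a)) =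
    (fun h : R => h^-1 *: ((g \o shift b) (h *: w) - g b)).
  apply/funext => h /=; rewrite fg; congr (_ *: (_ - _)).
  by have := fg 0; rewrite !scale0r !add0r.
by split; rewrite /derivable /derive e.
Qed.

(** Compact support, in a form that the slices of [f] inherit coordinate by coordinate. *)
Definition box_supported d (M : R) (f : 'rV[R]_d -> R) :=
  forall (x : 'rV[R]_d) i, M < `|x ord0 i| -> f x = 0.

Lemma box_supported_bounded d M (f : 'rV[R]_d -> R) : continuous f ->
  box_supported M f -> exists C, forall x, `|f x| <= C.
Proof.
move=> cf fM; pose K : set 'rV[R]_d := [set x | forall i, x ord0 i \in `[- M, M]].
have cK : compact K.
  apply: (@rV_compact _ _ (fun=> `[- M, M]%classic)) => _; exact: segment_compact.
have /compact_bounded[C [_ HC]] : compact (f @` K).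
  by apply: continuous_compact => //; exact: continuous_subspaceT.
exists (`|C| + 1) => x; have [Kx|nKx] := pselect (K x).
  by apply: HC; [rewrite (le_lt_trans (ler_norm _)) ?ltrDl|exists x].
have [i xi] : exists i, M < `|x ord0 i|.
  apply: contrapT => H; apply: nKx => i; rewrite in_itv /= -ler_norml leNgt.
  by apply/negP => Mx; apply: H; exists i.
by rewrite (fM _ _ xi) normr0 addr_ge0.
Qed.

Lemma shiftE d (h : R) (i l : 'I_d) (w : 'rV[R]_d) :
  (h *: delta_mx ord0 i + w) ord0 l = h * (l == i)%:R + w ord0 l.
Proof. by rewrite !mxE. Qed.

Lemma box_supported_integrable d M (f : 'rV[R]_d -> R) : continuous f ->
  box_supported M f -> (lebesgue_rV R d).-integrable setT (EFin \o f).
Proof.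
move=> cf fM; pose K := rV_box (fun _ : 'I_d => - (`|M| + 1)) (fun=> `|M| + 1).
have mK : measurable K by exact: measurable_rV_box.
have Kfin : (lebesgue_rV R d K < +oo)%E.
  by rewrite lebesgue_rV_boxE ?ltry// => i; have := normr_ge0 M; lra.
have [C fC] := box_supported_bounded cf fM.
have -> : EFin \o f = (EFin \o f) \_ K.
  apply/funext => x; rewrite patchE; case: ifPn => // /negP xK /=.
  have [i xi] : exists i, M < `|x ord0 i|.
    apply: contrapT => H; apply: xK; rewrite inE => i; rewrite -ltr_norml.
    rewrite (@le_lt_trans _ _ `|M|) ?ltrDl// (le_trans _ (ler_norm M))// leNgt.
    by apply/negP => Mx; apply: H; exists i.
  by rewrite (fM _ _ xi).
apply/(integrable_mkcond _ mK); apply: measurable_bounded_integrable => //.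
- by apply: measurable_funTS; exact: continuous_rV_measurable.
- exists C; split; first exact: num_real.
  by move=> x Cx y _ /=; apply: le_trans (fC y) (ltW Cx).
Qed.

Lemma pderiv_box_supported d M (f : 'rV[R]_d -> R) i :
  box_supported M f -> box_supported M (pderiv i f).
Proof.
move=> fM x j xj; rewrite /pderiv.
have near0 : \forall h \near (0 : R)^', f (h *: delta_mx ord0 i + x) = 0.
  have : \forall h \near (0 : R), M < `|(h *: delta_mx ord0 i + x) ord0 j|.
    have e0 : 0 < `|x ord0 j| - M by rewrite subr_gt0.
    near=> h; rewrite !mxE eqxx /= addrC.
    have h1 : `|h * (j == i)%:R| <= `|h| by rewrite normrM; case: eqP => _;
      rewrite ?normr1 ?normr0 ?mulr1 ?mulr0.
    have h2 : `|h| < `|x ord0 j| - M by near: h; apply/nbhs_normP;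
      exists (`|x ord0 j| - M) => //= h; rewrite /ball_/= sub0r normrN.
    have := ler_normB (x ord0 j + h * (j == i)%:R) (h * (j == i)%:R); rewrite addrK; lra.
  move=> H; apply: (@nbhs_dnbhs _ 0); apply: filterS H => h; exact: fM.
apply/cvg_lim => //; apply: cvg_near_cst.
apply: filterS near0 => h /= ->; rewrite (fM _ _ xj) subrr; exact: scaler0.
Unshelve. all: by end_near. Qed.

(** By Fubini: a derivative in a later coordinate is a partial derivative of the slice with fixed
    first coordinate and falls to the induction hypothesis; for the first coordinate the inner
    integral is evaluated by the fundamental theorem of calculus. *)
Lemma integral_pderiv_eq0 d M (f : 'rV[R]_d -> R) i : continuous f ->
  (forall x, derivable f x (delta_mx ord0 i)) -> continuous (pderiv i f) ->
  box_supported M f -> (\int[lebesgue_rV R d]_x (pderiv i f x)%:E = 0)%E.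
Proof.
elim: d M f i => [|d IH] M f i; first by case: i.
move=> cf df cdf fM.
have idf := box_supported_integrable cdf (@pderiv_box_supported _ _ _ i fM).
have mc : measurable_fun [set: (g_sigma_algebraType (R.-ocitv.-measurable) * 'rV[R]_d)%type]
  (@rV_cons R d) by exact: measurable_rV_cons.
have mdf : measurable_fun setT (EFin \o pderiv i f).
  by apply/measurable_EFinP; exact: continuous_rV_measurable.
have idfc : (lebesgue_measure \x lebesgue_rV R d)%E.-integrable setT
    ((EFin \o pderiv i f) \o @rV_cons R d).
  apply/integrableP; split; first exact: measurableT_comp.
  move/integrableP: idf => [_]; rewrite /= /rV_cons_measure.
  rewrite ge0_integral_pushforward//.
  by apply/measurable_EFinP/measurableT_comp => //; exact: continuous_rV_measurable.
rewrite /= /rV_cons_measure.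
have := @integral_pushforward _ _ _ _ _ _ mc
  [the measure _ R of (lebesgue_measure \x lebesgue_rV R d)%E] setT (EFin \o pderiv i f) mdf.
rewrite preimage_setT => /(_ idfc measurableT) ->.
case: (unliftP ord0 i) => [j ij|i0].
  rewrite -integral12_prod_meas1//= /fubini_F/= integral0_eq// => t _.
  pose ft (y : 'rV[R]_d) := f (rV_cons (t, y)).
  have line x h : f (h *: delta_mx ord0 i + rV_cons (t, x)) =
      ft (h *: delta_mx ord0 j + x).
    congr f; apply/rowP => l; rewrite shiftE; case: (unliftP ord0 l) => [k ->|->].
      by rewrite !rV_consS shiftE/= ij (inj_eq lift_inj).
    by rewrite !rV_cons0 /= ij /= mulr0 add0r.
  have pE : pderiv i f \o (fun y => rV_cons (t, y)) = pderiv j ft.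
    by apply/funext => y /=; have [_] := derive_line (line y).
  have := IH M ft j; rewrite -pE; apply.
  - by move=> y; apply: continuous_comp; [exact: continuous_rV_cons_r|exact: cf].
  - by move=> y; have [+ _] := derive_line (line y); apply.
  - by move=> y; apply: continuous_comp; [exact: continuous_rV_cons_r|exact: cdf].
  - by move=> y k yk; apply: (fM _ (lift ord0 k)); rewrite rV_consS.
rewrite -integral21_prod_meas1//= /fubini_G/= integral0_eq// => y _.
pose ft (t : R) := f (rV_cons (t, y)).
have line x h : f (h *: delta_mx ord0 i + rV_cons (x, y)) = ft (h *: 1 + x).
  congr f; apply/rowP => l; rewrite shiftE; case: (unliftP ord0 l) => [k ->|->].
    by rewrite !rV_consS i0 /= mulr0 add0r.
  by rewrite !rV_cons0 i0 /=.
have pE t : pderiv i f (rV_cons (t, y)) = ft^`()%classic t.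
  by rewrite derive1E; have [_] := derive_line (line t).
(* Positive and larger than [M], so that [[- K, K]] is nondegenerate and [ft] vanishes at both
   ends. *)
pose K := `|M| + 1.
have ftK t : K <= `|t| -> ft t = 0.
  move=> tK; apply: (fM _ ord0); rewrite rV_cons0 /=.
  by rewrite (le_lt_trans (ler_norm M))// (lt_le_trans _ tK)// ltrDl.
have dftK t : K < `|t| -> pderiv i f (rV_cons (t, y)) = 0.
  move=> tK; apply: (@pderiv_box_supported _ _ _ i fM _ ord0); rewrite rV_cons0 /=.
  by rewrite (le_lt_trans (ler_norm M))// (lt_trans _ tK)// ltrDl.
have cft : continuous ft.
  by move=> t; apply: continuous_comp; [exact: continuous_rV_cons_l|exact: cf].
rewrite (_ : (fun x => _) = (fun t => (pderiv i f (rV_cons (t, y)))%:E) \_ `[- K, K]); last first.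
  apply/funext => t; rewrite patchE; case: ifPn => // /negP tK; congr EFin; apply: dftK.
  by rewrite ltNge; apply/negP => H; apply: tK; rewrite inE/= in_itv/= -ler_norml.
have K0 : 0 < K by rewrite ltr_wpDl.
rewrite -integral_mkcond (@continuous_FTC2 _ _ ft).
- by rewrite (ftK K) ?(ftK (- K)) ?subee // ?normrN ger0_norm // ltW.
- by rewrite gtrN.
- apply: continuous_subspaceT => t.
  by apply: continuous_comp; [exact: continuous_rV_cons_l|exact: cdf].
- split.
  + by move=> t _; have [+ _] := derive_line (line t); apply.
  + by apply: cvg_at_right_filter; exact: cft.
  + by apply: cvg_at_left_filter; exact: cft.
- by move=> t _; rewrite pE.
Qed.

End row_space_measure.

(** * Smooth bump functions *)

Section smooth_functions.
Context {R : realType}.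

(** The whole sequence of derivatives is the witness, so that inductions over [C_k] can step along
    it. *)
Definition smooth1 (F : R -> R) := exists Fs : nat -> R -> R, Fs 0%N = F /\
  forall k (t : R), is_derive t (1 : R) (Fs k) (Fs k.+1 t).

(** The flat function exp(-1/t), with a polynomial factor in 1/t that makes the family closed under
    differentiation. *)
Definition expinv (P : {poly R}) (t : R) : R :=
  if 0 < t then P.[t^-1] * expR (- t^-1) else 0.

(** With s = 1/h, the factor s^2 pays for the division by h in the difference quotient at the origin
    and leaves one factor h over. The polynomial is compared with a single term of the exponential
    series. *)
Lemma poly_le_expR (P : {poly R}) :
  exists C : R, forall s, 1 <= s -> `|P.[s]| * s ^+ 2 <= C * expR s.
Proof.
suff [C [N [C0 HC]]] : exists C N, 0 <= C /\ forall s, 1 <= s -> `|P.[s]| <= C * s ^+ N.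
  exists (C * (N.+2)`!%:R) => s s1; have s0 : 0 <= s by apply: le_trans s1.
  apply: (@le_trans _ _ (C * s ^+ N.+2)).
    by rewrite -[N.+2]addn2 exprD mulrA; apply: ler_wpM2r; [rewrite exprn_ge0|exact: HC].
  rewrite -mulrA ler_wpM2l// mulrC -ler_pdivrMr ?ltr0n ?fact_gt0//.
  by apply: le_trans (expR_ge1Dxn N.+1 s0); rewrite lerDr.
elim/poly_ind: P => [|P c [C [N [C0 HC]]]].
  by exists 0, 0%N; split => // s _; rewrite horner0 normr0 mul0r.
exists (C + `|c|), N.+1; split => [|s s1]; first exact: addr_ge0.
have s0 : 0 <= s by apply: le_trans s1.
rewrite hornerMXaddC (le_trans (ler_normD _ _))// mulrDl lerD//.
  by rewrite normrM (ger0_norm s0) exprSr mulrA ler_wpM2r//; exact: HC.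
by rewrite ler_peMr// exprn_ege1.
Qed.

Lemma is_derive_expinv (P : {poly R}) (t : R) :
  is_derive t (1 : R) (expinv P) (expinv ('X^2 * (P - P^`()%R)) t).
Proof.
have [t0|t0|->] := ltgtP t 0.
- rewrite {2}/expinv ltNge (ltW t0) /=.
  have d0 : is_derive t (1 : R) (cst (0 : R)) (0 : R) by exact: is_derive_cst.
  apply: near_eq_is_derive d0.
  near=> s; rewrite /expinv ltNge.
  have -> // : s <= 0.
  by apply: ltW; near: s; apply: lt_nbhsl.
- rewrite {2}/expinv t0.
  apply: (@near_eq_is_derive _ _ _ ((fun s => P.[s^-1]) * (fun s : R => expR (- s^-1)))).
    near=> s; rewrite /expinv.
    have -> // : 0 < s.
    by near: s; apply: lt_nbhsr.
  have tn0 : t != 0 by rewrite gt_eqF.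
  have dV : is_derive t (1 : R) (fun s : R => s^-1) (- t ^- 2 *: 1).
    exact: is_deriveV.
  have dP : is_derive t (1 : R) (fun s => P.[s^-1]) (P^`()%R.[t^-1] * (- t ^- 2 *: 1)).
    exact: (@is_derive1_comp _ (horner P) (fun s => s^-1)).
  have dE : is_derive t (1 : R) (fun s : R => expR (- s^-1)) (expR (- t^-1) * - (- t ^- 2 *: 1)).
    apply: (@is_derive1_comp _ expR (fun s => - s^-1)).
  apply: is_derive_eq.
  rewrite !hornerE /GRing.scale /= exprVn; ring.
- rewrite {2}/expinv ltxx.
  (* At the origin the difference quotient is at most [C * h] for 0 < h < 1 and vanishes for
     negative h. *)
  have [C HC] := poly_le_expR P.
  have C0 : 0 <= C.
    by rewrite -(pmulr_lge0 _ (expR_gt0 1)) (le_trans _ (HC 1 _))// mulr_ge0// exprn_ge0.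
  have H : (fun h : R => h^-1 *: ((expinv P \o shift 0) (h *: 1) - expinv P 0)) @ 0^' --> (0 : R).
    apply/cvgrPdist_lt => e e0.
    have e1 : 0 < e / (C + 1) by rewrite divr_gt0// ltr_wpDl.
    near=> h; rewrite sub0r normrN /= /expinv ltxx subr0 addr0.
    rewrite /GRing.scale /= mulr1.
    case: ifPn => h0; last by rewrite mulr0 normr0.
    have h1 : h < 1.
      rewrite (le_lt_trans (ler_norm h))//; near: h; apply: nbhs_dnbhs.
      by apply/nbhs_normP; exists 1 => //= h; rewrite /ball_/= sub0r normrN.
    have he : h < e / (C + 1).
      rewrite (le_lt_trans (ler_norm h))//; near: h; apply: nbhs_dnbhs.
      by apply/nbhs_normP; exists (e / (C + 1)) => //= h; rewrite /ball_/= sub0r normrN.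
    have := HC h^-1; rewrite invr_ge1 ?unitfE ?gt_eqF// => /(_ (ltW h1)).
    set a := P.[_]; set b := expR h^-1 => Hb.
    have b0 : 0 < b by exact: expR_gt0.
    rewrite expRN -/b !normrM (@gtr0_norm _ h^-1) ?invr_gt0// (@gtr0_norm _ b^-1) ?invr_gt0//.
    apply: (@le_lt_trans _ _ (C * h)).
      have -> : h^-1 * (`|a| * b^-1) = `|a| * h^-1 ^+ 2 * h / b.
        by field; rewrite !gt_eqF.
      rewrite ler_pdivrMr// [C * h * b]mulrAC.
      by apply: ler_wpM2r => //; exact: ltW.
    apply: (@le_lt_trans _ _ ((C + 1) * h)); first by rewrite ler_wpM2r ?lerDl// ltW.
    by rewrite mulrC -ltr_pdivlMr// ltr_wpDl.
  apply: DeriveDef; first by apply/cvg_ex; exists 0.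
  exact/cvg_lim.
Unshelve. all: by end_near. Qed.

Lemma smooth1_expinv (P : {poly R}) : smooth1 (expinv P).
Proof.
exists (fun k => expinv (iter k (fun P : {poly R} => 'X^2 * (P - P^`()%R)) P)).
split=> // k t; exact: is_derive_expinv.
Qed.

Lemma smooth1_id : smooth1 id.
Proof.
exists (fun k => if k is k'.+1 then cst (if k' is _.+1 then 0 else 1) else id).
by split=> // -[|k] t; [exact: is_derive_id|exact: is_derive_cst].
Qed.

Lemma C_k_continuous d k (f : 'rV[R]_d -> R) : C_k k f -> continuous f.
Proof. by case: k => [//|k] []. Qed.

Lemma C_kW d k (f : 'rV[R]_d -> R) : C_k k.+1 f -> C_k k f.
Proof.
elim: k f => [|k IH] f [cf df Cf] //; split => // i; exact/IH/Cf.
Qed.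

Lemma C_k_cst d k (c : R) : C_k k (fun _ : 'rV[R]_d => c).
Proof.
elim: k c => [|k IH] c /=; first exact: cst_continuous.
split=> [|i x|i]; [exact: cst_continuous|exact: derivable_cst|].
rewrite (_ : pderiv i _ = fun=> 0); first exact: IH.
by apply/funext => x; rewrite /pderiv derive_cst.
Qed.

Lemma C_kD d k (f g : 'rV[R]_d -> R) : C_k k f -> C_k k g -> C_k k (f \+ g).
Proof.
elim: k f g => [|k IH] f g /=.
  by move=> cf cg x; exact: (continuousD (cf x) (cg x)).
move=> [cf df Cf] [cg dg Cg]; split.
- by move=> x; exact: (continuousD (cf x) (cg x)).
- by move=> i x; exact: derivableD.
- move=> i; rewrite (_ : pderiv i _ = pderiv i f \+ pderiv i g); first exact: IH.
  by apply/funext => x; rewrite /pderiv deriveD.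
Qed.

Lemma pderivM d (f g : 'rV[R]_d -> R) i x :
  derivable f x (delta_mx ord0 i) -> derivable g x (delta_mx ord0 i) ->
  pderiv i (f \* g) x = f x * pderiv i g x + pderiv i f x * g x.
Proof.
by move=> df dg; rewrite /pderiv; have -> := deriveM df dg; rewrite /GRing.scale /= [g x * _]mulrC.
Qed.

Lemma C_kM d k (f g : 'rV[R]_d -> R) : C_k k f -> C_k k g -> C_k k (f \* g).
Proof.
elim: k f g => [|k IH] f g.
  by move=> /= cf cg x; exact: (continuousM (cf x) (cg x)).
move=> kf kg; have kf' := C_kW kf; have kg' := C_kW kg.
case: kf kg => [cf df Cf] [cg dg Cg]; split.
- by move=> x; exact: (continuousM (cf x) (cg x)).
- by move=> i x; exact: derivableM.
- move=> i; rewrite (_ : pderiv i _ = (f \* pderiv i g) \+ (pderiv i f \* g)).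
    by apply: C_kD; apply: IH => //; [exact: Cg|exact: Cf].
  by apply/funext => x; rewrite pderivM.
Qed.

Lemma C_k_prod d k I (r : seq I) (f : I -> 'rV[R]_d -> R) : (forall i, C_k k (f i)) ->
  C_k k (fun x => \prod_(i <- r) f i x).
Proof.
move=> Cf; elim: r => [|i r IH].
  by under eq_fun do rewrite big_nil; exact: C_k_cst.
by under eq_fun do rewrite big_cons; exact: C_kM.
Qed.

Lemma C_k_coord d k (F : R -> R) (a b : R) (i : 'I_d) : smooth1 F ->
  C_k k (fun x => F (a * x ord0 i + b)).
Proof.
move=> [Fs [<- dF]].
have caff : continuous (fun x : 'rV[R]_d => a * x ord0 i + b).
  move=> x; apply: (@continuousD _ _ _ (fun x : 'rV[R]_d => a * x ord0 i)).
    apply: (@continuousM _ _ (cst a)); first exact: cst_continuous.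
    exact: coord_continuous.
  exact: cst_continuous.
have cFs c m : continuous (fun x : 'rV[R]_d => c * Fs m (a * x ord0 i + b)).
  move=> x; apply: (@continuousM _ _ (cst c)); first exact: cst_continuous.
  apply: continuous_comp; first exact: caff.
  apply/differentiable_continuous/derivable1_diffP.
  by have [] := dF m (a * x ord0 i + b).
(* Generalised over [c] and [m], because a partial derivative only changes the constant factor and
   moves one step along [Fs]. *)
suff : forall c m, C_k k (fun x : 'rV[R]_d => c * Fs m (a * x ord0 i + b)).
  by move=> /(_ 1 0%N); under eq_fun do rewrite mul1r.
elim: k => [|k IH] c m; first exact: cFs.
have line j x : is_derive x (delta_mx ord0 j) (fun x : 'rV[R]_d => c * Fs m (a * x ord0 i + b))
    (c * (a * (i == j)%:R) * Fs m.+1 (a * x ord0 i + b)).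
  pose g (t : R) := c * Fs m (a * (i == j)%:R * t + (a * x ord0 i + b)).
  pose fx (y : 'rV[R]_d) := c * Fs m (a * y ord0 i + b).
  have gl (h : R) : g (h *: (1 : R) + 0) = fx (h *: delta_mx ord0 j + x).
    rewrite /fx shiftE addr0 /g /GRing.scale /= mulr1; congr (c * Fs m _); ring.
  have dg : is_derive (0 : R) (1 : R) g (c * (a * (i == j)%:R) * Fs m.+1 (a * x ord0 i + b)).
    have dg0 : is_derive (0 : R) (1 : R)
        (fun t : R => a * (i == j)%:R * t + (a * x ord0 i + b)) (a * (i == j)%:R).
      by apply: is_derive_eq; rewrite /GRing.scale /=; ring.
    have dg1 := @is_derive1_comp _ (Fs m) _ 0 _ _ (dF m _) dg0.
    have := is_deriveM (is_derive_cst (c : R) (0 : R) (1 : R)) dg1.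
    move/is_derive_eq; apply; rewrite /GRing.scale /= !mulr0 !add0r; ring.
  have [dl dE] := derive_line gl.
  by apply: DeriveDef; [exact: dl ex_derive|rewrite -dE derive_val].
split.
- exact: cFs.
- by move=> j x; have [] := line j x.
- move=> j; rewrite (_ : pderiv j _ = fun x => c * (a * (i == j)%:R) * Fs m.+1 (a * x ord0 i + b)).
    exact: IH.
  by apply/funext => x; have [_ <-] := line j x.
Qed.

End smooth_functions.

(** * Bump functions and the fundamental lemma of the calculus of variations *)

Section bump_functions.
Context {R : realType}.

(** One flat factor for each face of the box. The scaling by [n.+1] drives the product to 1 inside
    the box while it stays 0 outside, which approximates the indicator by smooth functions. *)
Definition bump d (a b : 'I_d -> R) (n : nat) (x : 'rV[R]_d) : R :=
  \prod_(i < d) (expinv 1 (n.+1%:R * x ord0 i + - (n.+1%:R * a i)) *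
                 expinv 1 (- n.+1%:R * x ord0 i + n.+1%:R * b i)).

Lemma expinv1_ge0 (t : R) : 0 <= expinv 1 t.
Proof. by rewrite /expinv hornerE; case: ifP => // _; rewrite mul1r expR_ge0. Qed.

Lemma expinv1_le1 (t : R) : expinv 1 t <= 1.
Proof.
rewrite /expinv hornerE; case: ifP => // t0.
by rewrite mul1r expRN invf_le1 ?expR_gt0// (le_trans _ (expR_ge1Dx _))// lerDl invr_ge0 ltW.
Qed.

Lemma expinv1_neq0 (t : R) : expinv 1 t != 0 -> 0 < t.
Proof. by rewrite /expinv; case: ifP => // _; rewrite eqxx. Qed.

Lemma expinv1_cvg (t : R) : 0 < t -> expinv 1 (n.+1%:R * t) @[n --> \oo] --> (1 : R).
Proof.
move=> t0; rewrite (_ : (fun n => _) = fun n : nat => expR (- (n.+1%:R^-1 * t^-1))); last first.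
  by apply/funext => n; rewrite /expinv hornerE mulr_gt0// mul1r invfM.
rewrite -[X in _ --> X]expR0; apply: continuous_cvg; first exact: continuous_expR.
rewrite -oppr0; apply: cvgN; rewrite -(mul0r t^-1).
by apply: cvgMr_tmp; exact: cvg_harmonic.
Qed.

Lemma bump_bounds d a b n (x : 'rV[R]_d) : 0 <= bump a b n x <= 1.
Proof.
rewrite prodr_ge0/= => [|i _]; last by rewrite mulr_ge0 ?expinv1_ge0.
by rewrite prodr_ile1// => i _; rewrite mulr_ge0 ?expinv1_ge0//= mulr_ile1 ?expinv1_ge0 ?expinv1_le1.
Qed.

Lemma bump_neq0 d a b n (x : 'rV[R]_d) : bump a b n x != 0 -> rV_box a b x.
Proof.
move=> /prodf_neq0 H i; have := H i isT; rewrite mulf_eq0 negb_or.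
move=> /andP[/expinv1_neq0 h1 /expinv1_neq0 h2].
have n0 : 0 < n.+1%:R :> R by [].
move: h1; rewrite -mulrBr pmulr_rgt0// subr_gt0 => ->.
by move: h2; rewrite mulNr addrC -mulrBr pmulr_rgt0// subr_gt0.
Qed.

Lemma bump_cvg d a b (x : 'rV[R]_d) :
  bump a b n x @[n --> \oo] --> (\1_(rV_box a b) x : R).
Proof.
have [bx|nbx] := pselect (rV_box a b x); last first.
  rewrite indicE memNset//; apply: cvg_near_cst; apply: nearW => n.
  by apply/eqP; apply: contrapT => /negP /bump_neq0.
rewrite indicE mem_set//= (_ : 1%:R = \prod_(i < d) (1 * 1) :> R); last first.
  by rewrite big1// => i _; rewrite mulr1.
apply: (@cvg_big R _ *%R 1 xpredT) => [|i _]; first exact: mul_continuous.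
have /andP[h1 h2] := bx i.
apply: cvgM.
  have := @expinv1_cvg (x ord0 i - a i); rewrite subr_gt0 => /(_ h1).
  by under eq_cvg do rewrite mulrBr.
have := @expinv1_cvg (b i - x ord0 i); rewrite subr_gt0 => /(_ h2).
by under eq_cvg do rewrite mulrBr addrC -mulNr.
Qed.

Definition rV_cbox d (a b : 'I_d -> R) : set 'rV[R]_d :=
  [set x | forall i, a i <= x ord0 i <= b i].

Lemma compact_rV_cbox d (a b : 'I_d -> R) : compact (rV_cbox a b).
Proof.
rewrite (_ : rV_cbox a b = [set x | forall i, `[a i, b i]%classic (x ord0 i)]).
  by apply: (@rV_compact _ _ (fun i => `[a i, b i]%classic)) => i; exact: segment_compact.
by apply/seteqP; split => x /= H i; have := H i; rewrite /= in_itv.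
Qed.

Lemma rV_hausdorff d : hausdorff_space 'rV[R]_d.
Proof. exact: norm_hausdorff. Qed.

Lemma closed_rV_cbox d (a b : 'I_d -> R) : closed (rV_cbox a b).
Proof. by apply: compact_closed; [exact: rV_hausdorff|exact: compact_rV_cbox]. Qed.

Lemma test_function_bump d (D : set 'rV[R]_d) a b n : rV_cbox a b `<=` D ->
  test_function D (bump a b n).
Proof.
move=> abD; have s : supp (bump a b n) `<=` rV_cbox a b.
  rewrite /supp closureE; apply: smallest_sub; first exact: closed_rV_cbox.
  by move=> x /bump_neq0 xab i; have /andP[/ltW -> /ltW ->] := xab i.
split; last exact: subset_trans abD.
- move=> k; apply: C_k_prod => i; apply: C_kM; apply: C_k_coord; exact: smooth1_expinv.
- by apply: subclosed_compact s; [exact: closed_closure|exact: compact_rV_cbox].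
Qed.

(** Boxes are stable under intersection, so this lets Dynkin's argument pass from boxes to all
    measurable sets. A slab open in one coordinate is the union of the boxes whose other sides are
    ]-n, n[. *)
Lemma measurable_rVE d : @measurable _ 'rV[R]_d =
  <<s [set Q | exists a b, Q = rV_box a b] >>.
Proof.
apply/seteqP; split; last first.
  apply: smallest_sub; first exact: sigma_algebra_measurable.
  by move=> _ [a [b ->]]; exact: measurable_rV_box.
apply: smallest_sub; first exact: smallest_sigma_algebra.
rewrite -bigcup_seq => _ [i _ [B mB <-]].
set G := [set Q | _].
suff : measurable_fun [set: g_sigma_algebraType G] (fun x : 'rV[R]_d => x ord0 i).
  by move=> /(_ measurableT B mB).
apply: (measurability _ (RGenOpens.measurableE R)).
move=> _ [_ [s [t ->]] <-]; rewrite setTI.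
rewrite (_ : _ @^-1` _ = \bigcup_n rV_box
    (fun j => if j == i then s else - n%:R) (fun j => if j == i then t else n%:R)).
  by apply: bigcupT_measurable => n; apply: sub_sigma_algebra; do 2 eexists.
apply/seteqP; split => x /=; rewrite in_itv/=; last first.
  by move=> [n _ /(_ i)]; rewrite eqxx.
move=> xi; pose n := Num.truncn `|x|; exists n.+1 => // j.
case: eqP => [->//|_]; rewrite -ltr_norml.
exact: le_lt_trans (coord_le_norm _ _) (truncnS_gt _).
Qed.

Lemma rV_boxI d (a1 b1 a2 b2 : 'I_d -> R) : rV_box a1 b1 `&` rV_box a2 b2 =
  rV_box (fun i => Num.max (a1 i) (a2 i)) (fun i => Num.min (b1 i) (b2 i)).
Proof.
apply/seteqP; split => x.
  move=> [h1 h2] i; have /andP[h3 h4] := h1 i; have /andP[h5 h6] := h2 i.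
  by rewrite gt_max lt_min h3 h4 h5 h6.
by move=> H; split => i; have := H i; rewrite gt_max lt_min => /andP[/andP[h1 h2] /andP[h3 h4]];
  apply/andP.
Qed.

Section orthogonal_to_tests.
Context (d : nat) (D : set 'rV[R]_d) (oD : open D) (g : 'rV[R]_d -> R).
Let leb := lebesgue_rV R d.
Hypothesis ig : leb.-integrable D (EFin \o g).
Hypothesis g0 : forall psi, test_function D psi -> \int[leb]_(x in D) (g x * psi x) = 0.

Let mD : measurable D := measurable_rV_open oD.

(** Dominated convergence, with the bumps tending to the indicator of the box and |g| as the
    dominating function. *)
Lemma integral_box_eq0 a b : rV_cbox a b `<=` D ->
  (\int[leb]_(x in rV_box a b) (g x)%:E = 0)%E.
Proof.
move=> abD; have abD' : rV_box a b `<=` D.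
  by move=> x xab; apply: abD => i; have /andP[/ltW -> /ltW ->] := xab i.
have mab : measurable (rV_box a b) by exact: measurable_rV_box.
have mg : measurable_fun D g by apply/measurable_EFinP; exact: measurable_int ig.
have mb n : measurable_fun D (bump a b n).
  apply: measurable_funTS; apply: continuous_rV_measurable.
  by have [+ _ _] := test_function_bump n abD; move=> /(_ 0%N).
have dom n x : (`|(g x * bump a b n x)%:E| <= `|g x|%:E)%E.
  rewrite /= lee_fin normrM; have /andP[h1 h2] := bump_bounds a b n x.
  by rewrite (ger0_norm h1) ler_piMr.
have := @dominated_cvg _ _ _ leb D mD
  (fun n x => (g x * bump a b n x)%:E) (fun x => (g x * \1_(rV_box a b) x)%:E)
  (fun x => `|g x|%:E).
have -> : (fun n => (\int[leb]_(x in D) (g x * bump a b n x)%:E)%E) = cst 0%E.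
  apply/funext => n /=; have := g0 (test_function_bump n abD).
  rewrite /Rintegral => h; rewrite -[LHS]fineK ?h//.
  apply: integrable_fin_num => //.
  apply: le_integrable ig => //.
  by apply/measurable_EFinP; exact: measurable_funM.
move=> H; have {H} H : (cst 0%E : nat -> \bar R) @ \oo -->
    (\int[leb]_(x in D) (g x * \1_(rV_box a b) x)%:E)%E.
  apply: H => //.
  - by move=> n; apply/measurable_EFinP; exact: measurable_funM.
  - move=> x _; apply: cvg_EFin; first by near=> n.
    by apply: cvgMl_tmp; exact: bump_cvg.
  - exact: (integrable_abse ig).
have /cvg_lim := H => /(_ (@ereal_hausdorff R)).
rewrite lim_cst// => H0; rewrite -(setIidr abD') integral_mkcondr [RHS]H0.
apply: eq_integral => x _; rewrite patchE indicE; case: ifP => _ /=; by rewrite ?mulr1 ?mulr0.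
Unshelve. all: by end_near. Qed.

(** The measurable sets whose intersection with the box carries zero integral of [g] form a Dynkin
    class containing the boxes, hence are all measurable sets. *)
Lemma box_orthogonal_ae0 a b : rV_cbox a b `<=` D ->
  {ae leb, forall x, rV_box a b x -> g x = 0}.
Proof.
move=> abD; have abD' : rV_box a b `<=` D.
  by move=> x xab; apply: abD => i; have /andP[/ltW -> /ltW ->] := xab i.
have mab : measurable (rV_box a b) by exact: measurable_rV_box.
have igS E : measurable E -> leb.-integrable (E `&` rV_box a b) (EFin \o g).
  move=> mE; apply: integrableS ig => //; first exact: measurableI.
  by move=> x [_ /abD'].
suff H E : measurable E -> (\int[leb]_(x in E `&` rV_box a b) (g x)%:E = 0)%E.
  have : ae_eq leb (rV_box a b) (EFin \o g) (cst 0%E).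
    apply: integral_ae_eq => //; first by rewrite -[rV_box a b]setTI; exact: igS.
    by move=> E sE mE; rewrite -[in LHS](setIidl sE) H// integral0.
  by apply: filterS => x H1 /H1 /= [].
rewrite measurable_rVE; apply: (@dynkin_induction _ _ _
  (fun E => \int[leb]_(x in E `&` rV_box a b) (g x)%:E = 0)%E (measurable_rVE d)).
- move=> _ _ [a1 [b1 ->]] [a2 [b2 ->]].
  by rewrite rV_boxI; do 2 eexists.
- by rewrite setTI; exact: integral_box_eq0.
- move=> _ [a1 [b1 ->]].
  rewrite rV_boxI; apply: integral_box_eq0 => x xab; apply: abD => i.
  by have := xab i; rewrite ge_max le_min => /andP[/andP[_ ->] /andP[_ ->]].
- move=> S mS IS.
  have := integral_box_eq0 abD; rewrite -{1}[rV_box a b]setTI -(setUv S) setIUl.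
  rewrite integral_setU//; first by rewrite IS add0e.
  + exact: measurableI.
  + by apply: measurableI => //; exact: measurableC.
  + by rewrite -setIUl setUv; exact: measurable_int (igS _ measurableT).
  + by apply/disj_set2P; rewrite setIACA setICr set0I.
- move=> F mF tF IF; rewrite setI_bigcupl integral_bigcup//.
  + by under eq_eseriesr do rewrite IF; rewrite eseries0.
  + exact: trivIset_setIr.
  + by move=> n; exact: measurableI.
  + by rewrite -setI_bigcupl; apply: igS; exact: bigcupT_measurable.
Qed.

Lemma test_orthogonal_ae0 : {ae leb, forall x, D x -> g x = 0}.
Proof.
suff : leb.-negligible (D `&` [set x | g x <> 0]).
  by apply: negligibleS => x /= H; split; [|move=> gx]; apply: contrapT => h; apply: H => //; move/h.
pose a (q : {ffun 'I_d -> rat} * nat) i : R := ratr (q.1 i) - q.2.+1%:R^-1.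
pose b (q : {ffun 'I_d -> rat} * nat) i : R := ratr (q.1 i) + q.2.+1%:R^-1.
pose P := [set q | rV_cbox (a q) (b q) `<=` D].
have DE : D = \bigcup_(q in P) rV_box (a q) (b q) by exact: open_rat_boxes.
pose N q := if q \in P then rV_box (a q) (b q) `&` [set x | g x <> 0] else set0.
rewrite {1}DE setI_bigcupl.
apply: (@negligibleS _ _ _ _ (\bigcup_n (if unpickle n is Some q then N q else set0))).
  move=> x [q Pq xq]; exists (pickle q) => //; rewrite pickleK /N mem_set//.
apply: negligible_bigcup => n; case: unpickle => [q|]; last exact: negligible_set0.
rewrite /N; case: ifPn => [|_]; last exact: negligible_set0.
rewrite inE => Pq; have := @box_orthogonal_ae0 (a q) (b q) Pq.
apply: negligibleS => x [qx gx] H; exact/gx/H.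
Qed.

End orthogonal_to_tests.

End bump_functions.

(** The discriminant criterion, behind every Cauchy-Schwarz inequality below. *)
Lemma sqr_le_prod_of_quadratic {R : realFieldType} (a b c : R) : 0 <= a -> 0 <= c ->
  (forall t, 0 <= a + 2 * t * b + t ^+ 2 * c) -> b ^+ 2 <= a * c.
Proof.
move=> a0 c0 H; have [c00|cn0] := eqVneq c 0.
  have [->|b0] := eqVneq b 0; first by rewrite expr0n/= mulr_ge0.
  (* For c = 0 and b nonzero, this argument gives the quadratic the value -1. *)
  have := H (- (a + 1) / (2 * b)); rewrite c00 mulr0 addr0.
  rewrite (_ : 2 * _ * b = - (a + 1)); last by field.
  lra.
have cp : 0 < c by rewrite lt_neqAle eq_sym cn0.
have := H (- b / c).
rewrite (_ : a + _ + _ = (a * c - b ^+ 2) / c); last by field.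
by rewrite pmulr_lge0 ?invr_gt0// subr_ge0.
Qed.

(** * Weak gradients *)

Section square_integrable.
Context {R : realType} (d : nat).
Local Notation V := 'rV[R]_d.
Local Notation leb := (lebesgue_rV R d).
Implicit Types (D E : set V) (f g h : V -> R).

Lemma L2_mul_integrable D f g : measurable D -> L2 D f -> L2 D g ->
  leb.-integrable D (fun x => (f x * g x)%:E).
Proof.
move=> mD [mf f2] [mg g2]; apply: (le_integrable mD _ _ (integrableD mD f2 g2)).
  by apply/measurable_EFinP; exact: measurable_funM.
move=> x _ /=; rewrite lee_fin [leRHS]ger0_norm ?addr_ge0 ?sqr_ge0//.
have := sqr_ge0 (f x + g x); have := sqr_ge0 (f x - g x).
by rewrite ler_norml; nra.
Qed.

Lemma L2D D f g : measurable D -> L2 D f -> L2 D g -> L2 D (f \+ g).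
Proof.
move=> mD [mf f2] [mg g2]; have mfg : measurable_fun D (f \+ g) by exact: measurable_funD.
split => //; apply: (le_integrable mD _ _ (integrableZl mD 2 (integrableD mD f2 g2))).
  by apply/measurable_EFinP; exact: measurable_funX.
move=> x _ /=; rewrite lee_fin [leLHS]ger0_norm ?sqr_ge0// [leRHS]ger0_norm ?mulr_ge0 ?addr_ge0 ?sqr_ge0//.
by have := sqr_ge0 (f x - g x); nra.
Qed.

Lemma L2_bounded_mul D f h C : measurable D -> L2 D f -> measurable_fun D h ->
  (forall x, D x -> `|h x| <= C) -> L2 D (fun x => h x * f x).
Proof.
move=> mD [mf f2] mh hC; have mhf : measurable_fun D (fun x => h x * f x) by exact: measurable_funM.
split => //; apply: (le_integrable mD _ _ (integrableZl mD (C ^+ 2) f2)).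
  by apply/measurable_EFinP; exact: measurable_funX.
move=> x Dx /=; have e1 : 0 <= C ^+ 2 * f x ^+ 2 by apply: mulr_ge0; exact: sqr_ge0.
rewrite lee_fin (ger0_norm e1) ger0_norm; last exact: sqr_ge0.
rewrite exprMn; apply: ler_wpM2r; first exact: sqr_ge0.
by have := hC x Dx; rewrite ler_norml => /andP[h1 h2]; nra.
Qed.

Lemma L2Z D f c : measurable D -> L2 D f -> L2 D (fun x => c * f x).
Proof. by move=> mD f2; apply: (@L2_bounded_mul _ _ (cst c) `|c|). Qed.

Lemma L2N D f : measurable D -> L2 D f -> L2 D (\- f).
Proof. by move=> mD /(L2Z (-1) mD); congr L2; apply/funext => x; rewrite mulN1r. Qed.

Lemma L2B D f g : measurable D -> L2 D f -> L2 D g -> L2 D (f \- g).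
Proof. by move=> mD Lf Lg; apply: (L2D mD Lf); exact: L2N. Qed.

Lemma L2_0 D : L2 D (fun=> 0).
Proof.
split; first exact: measurable_cst.
by rewrite expr0n/=; exact: integrable0.
Qed.

Lemma L2_sum D I (r : seq I) (F : I -> V -> R) : measurable D -> (forall i, L2 D (F i)) ->
  L2 D (fun x => \sum_(i <- r) F i x).
Proof.
move=> mD LF; elim: r => [|i r IH].
  by under eq_fun do rewrite big_nil; exact: L2_0.
by under eq_fun do rewrite big_cons; exact: L2D.
Qed.

Lemma L2S D E f : measurable D -> measurable E -> E `<=` D -> L2 D f -> L2 E f.
Proof.
move=> mD mE ED [mf f2]; split; first exact: measurable_funS mf.
exact: integrableS f2.
Qed.

Lemma L2_mkcond D f : measurable D -> L2 D f -> L2 setT (f \_ D).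
Proof.
move=> mD [mf f2]; split; first by apply/(measurable_restrictT f mD).
have /(integrable_mkcond _ mD) := f2; congr (_.-integrable _ _).
by apply/funext => x; rewrite !patchE; case: ifP => //; rewrite expr0n.
Qed.

Lemma eq_L2 D f g : measurable D -> (forall x, D x -> f x = g x) -> L2 D f -> L2 D g.
Proof.
move=> mD fg [mf f2]; split.
  by apply: eq_measurable_fun mf => x; rewrite inE => Dx; exact: fg.
by apply: eq_integrable f2 => // x; rewrite inE => Dx; rewrite fg.
Qed.

Lemma ipC D f g : ip D f g = ip D g f.
Proof. by apply: eq_Rintegral => x _; rewrite mulrC. Qed.

Lemma ipDl D f g h : measurable D -> L2 D f -> L2 D g -> L2 D h ->
  ip D (f \+ g) h = ip D f h + ip D g h.
Proof.
move=> mD Lf Lg Lh; rewrite /ip -RintegralD//; try exact: L2_mul_integrable.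
by apply: eq_Rintegral => x _; rewrite mulrDl.
Qed.

Lemma ipZl D f h c : measurable D -> L2 D f -> L2 D h ->
  ip D (fun x => c * f x) h = c * ip D f h.
Proof.
move=> mD Lf Lh; rewrite /ip -RintegralZl//; try exact: L2_mul_integrable.
by apply: eq_Rintegral => x _; rewrite mulrA.
Qed.

Lemma ipDr D f g h : measurable D -> L2 D f -> L2 D g -> L2 D h ->
  ip D h (f \+ g) = ip D h f + ip D h g.
Proof. by move=> *; rewrite ipC ipDl// ipC [X in _ + X]ipC. Qed.

Lemma ipZr D f h c : measurable D -> L2 D f -> L2 D h ->
  ip D h (fun x => c * f x) = c * ip D h f.
Proof. by move=> *; rewrite ipC ipZl// ipC. Qed.

Lemma ipBl D f g h : measurable D -> L2 D f -> L2 D g -> L2 D h ->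
  ip D (f \- g) h = ip D f h - ip D g h.
Proof.
move=> mD Lf Lg Lh; rewrite (_ : f \- g = f \+ (fun x => -1 * g x)).
  by rewrite ipDl// ?ipZl// ?mulN1r//; exact: L2Z.
by apply/funext => x /=; rewrite mulN1r.
Qed.

Lemma ip_ge0 D f : 0 <= ip D f f.
Proof. by apply: Rintegral_ge0 => x _; rewrite -expr2 sqr_ge0. Qed.

Lemma eq_ip_ae D f f' g : measurable D -> measurable_fun D f -> measurable_fun D f' ->
  measurable_fun D g -> {ae leb, forall x, D x -> f x = f' x} -> ip D f g = ip D f' g.
Proof.
move=> mD mf mf' mg H; rewrite /ip /Rintegral; congr fine.
apply: ae_eq_integral => //; [apply/measurable_EFinP; exact: measurable_funM..|].
by apply: filterS H => x H Dx; rewrite H.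
Qed.

Lemma ip_cauchy_schwarz D f g : measurable D -> L2 D f -> L2 D g ->
  `|ip D f g| <= l2norm D f * l2norm D g.
Proof.
move=> mD Lf Lg; rewrite /l2norm -sqrtrM ?ip_ge0// -sqrtr_sqr ler_wsqrtr//.
apply: sqr_le_prod_of_quadratic; rewrite ?ip_ge0// => t.
have Lt : L2 D (fun x => t * g x) by exact: L2Z.
have := ip_ge0 D (f \+ (fun x => t * g x)).
rewrite ipDl//; last exact: L2D.
rewrite !ipDr// !ipZl// !ipZr// (ipC D g f); nra.
Qed.

Lemma L2_box_supported D M f : measurable D -> continuous f -> box_supported M f -> L2 D f.
Proof.
move=> mD cf fM; split; first by apply: measurable_funTS; exact: continuous_rV_measurable.
apply: (@integrableS _ _ _ _ setT) => //.
rewrite (_ : (fun x => _) = EFin \o (f \* f)); last by apply/funext => x /=; rewrite expr2.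
apply: (@box_supported_integrable _ _ M).
  by move=> x; exact: (continuousM (cf x) (cf x)).
by move=> x i xi /=; rewrite (fM _ _ xi) mul0r.
Qed.

Lemma L2_integrable D f : measurable D -> (leb D < +oo)%E -> L2 D f ->
  leb.-integrable D (EFin \o f).
Proof.
move=> mD finD Lf; have L1 : L2 D (fun=> 1).
  split; first exact: measurable_cst.
  rewrite expr1n; apply/integrableP; split; first exact: measurable_cst.
  by under eq_integral do rewrite /= normr1; rewrite integral_cst// mul1e.
have := L2_mul_integrable mD Lf L1; congr (_.-integrable _ _).
by apply/funext => x; rewrite mulr1.
Qed.

End square_integrable.

Section weak_gradient.
Context {R : realType} (d : nat).
Local Notation V := 'rV[R]_d.
Local Notation leb := (lebesgue_rV R d).
Implicit Types (D E : set V) (u v w : V -> R) (g h : V -> V).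

Definition vL2 D g := forall i : 'I_d, L2 D (fun x => g x ord0 i).

(** Of boundedness only the finite measure is retained: it makes square integrable functions
    integrable, as the fundamental lemma requires. *)
Definition bounded_open D := open D /\ (leb D < +oo)%E.

Lemma bounded_open_measurable D : bounded_open D -> measurable D.
Proof. by move=> [oD _]; exact: measurable_rV_open. Qed.

Lemma test_function_box_supported D psi : test_function D psi ->
  exists M, box_supported M psi.
Proof.
move=> [_ /compact_bounded[M [_ HM]] _]; exists (`|M| + 1) => x i xi.
apply: contrapT => /eqP px.
have : supp psi x by apply: subset_closure.
move=> /(HM (`|M| + 1)); rewrite (le_lt_trans (ler_norm M)) ?ltrDl// => /(_ isT) /=.
by rewrite leNgt (lt_le_trans xi)// coord_le_norm.
Qed.

Lemma test_function_eq0 D psi x : test_function D psi -> ~ D x -> psi x = 0.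
Proof.
move=> [_ _ sD] nDx; apply: contrapT => /eqP px; apply/nDx/sD.
exact: subset_closure.
Qed.

Lemma test_function_pderiv_eq0 D psi i x : test_function D psi -> ~ D x -> pderiv i psi x = 0.
Proof.
move=> [_ _ sD] nDx.
have ox : nbhs x (~` supp psi).
  apply: open_nbhs_nbhs; split; last by move=> /sD.
  by apply: closed_openC; exact: closed_closure.
rewrite /pderiv (@near_eq_derive _ _ _ _ (cst 0)) ?derive_cst//.
apply: filterS ox => y ny /=; apply: contrapT => /eqP py.
by apply: ny; exact: subset_closure.
Qed.

Lemma test_function_pderiv D psi i : test_function D psi -> test_function D (pderiv i psi).
Proof.
move=> tp; have [Cp cp sD] := tp; have s : supp (pderiv i psi) `<=` supp psi.
  rewrite {1}/supp closureE; apply: smallest_sub; first exact: closed_closure.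
  move=> x /= px; apply: contrapT => nx; move/eqP: px; apply.
  by apply: (@test_function_pderiv_eq0 (supp psi)) nx; split.
split; last exact: subset_trans sD.
- by move=> k; have [_ _ /(_ i)] := Cp k.+1.
- by apply: subclosed_compact s => //; exact: closed_closure.
Qed.

Lemma test_function_mul D psi (f : V -> R) : test_function D psi -> (forall k, C_k k f) ->
  test_function D (f \* psi).
Proof.
move=> [Cp cp sD] Cf; have s : supp (f \* psi) `<=` supp psi.
  apply: closure_subset => x /=; rewrite mulf_eq0 negb_or => /andP[_]; exact.
split; last exact: subset_trans sD.
- by move=> k; exact: C_kM.
- by apply: subclosed_compact s => //; exact: closed_closure.
Qed.

Lemma test_function_continuous D psi : test_function D psi -> continuous psi.
Proof. by move=> [/(_ 0%N)]. Qed.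

Lemma test_function_L2 D E psi : measurable E -> test_function D psi -> L2 E psi.
Proof.
move=> mE tp; have [M pM] := test_function_box_supported tp.
exact: L2_box_supported mE (test_function_continuous tp) pM.
Qed.

(** The product [f \* psi] is C1 on the whole space and supported in a box, so its derivative
    integrates to zero whatever the shape of [D]; off [D] the integrand vanishes with [psi]. *)
Lemma integral_test_parts D psi (f : V -> R) i : measurable D ->
  test_function D psi -> C_k 1 f -> L2 D f -> L2 D (pderiv i f) ->
  ip D f (pderiv i psi) = - ip D (pderiv i f) psi.
Proof.
move=> mD tp [cf df cdf] Lf Ldf.
have tdp := test_function_pderiv i tp; have [Cp cp sD] := tp.
have [M pM] := test_function_box_supported tp.
have [cps dp _] : C_k 1 psi by [].
have LdP := test_function_L2 mD tdp; have LP := test_function_L2 mD tp.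
apply/eqP; rewrite -addr_eq0; apply/eqP.
rewrite /ip -RintegralD//; try exact: L2_mul_integrable.
have cfp : continuous (f \* psi) by move=> x; exact: (continuousM (cf x) (cps x)).
have dE : pderiv i (f \* psi) = (fun x => f x * pderiv i psi x + pderiv i f x * psi x).
  by apply/funext => x; rewrite pderivM.
have := @integral_pderiv_eq0 _ _ M (f \* psi) i.
rewrite dE => /(_ cfp) H.
rewrite Rintegral_mkcond /Rintegral.
rewrite (_ : (fun x => _) = (fun x => (f x * pderiv i psi x + pderiv i f x * psi x)%:E)); last first.
  apply/funext => x; rewrite patchE; case: ifPn => // /negP xD; congr EFin.
  have nDx : ~ D x by move=> Dx; apply: xD; rewrite inE.
  by rewrite (test_function_eq0 tp nDx) (test_function_eq0 tdp nDx) !mulr0 addr0.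
rewrite H//.
- by move=> x; exact: derivableM.
- move=> x; apply: (@continuousD _ _ _ (f \* pderiv i psi) (pderiv i f \* psi)).
    exact: (continuousM (cf x) (test_function_continuous tdp (x := x))).
  exact: (continuousM (cdf i x) (cps x)).
- by move=> x j xj /=; rewrite (pM _ _ xj) mulr0.
Qed.

Lemma is_weak_grad_test D psi : measurable D -> test_function D psi ->
  is_weak_grad D psi (fun x => \row_i pderiv i psi x).
Proof.
move=> mD tp i; have Lp := test_function_L2 mD tp.
have Ldp := test_function_L2 mD (test_function_pderiv i tp).
have e : (fun x => (\row_j pderiv j psi x) ord0 i) = pderiv i psi.
  by apply/funext => x; rewrite mxE.
rewrite e; split => // q tq; apply: integral_test_parts => //.
by case: tp => /(_ 1%N).
Qed.

Lemma is_weak_grad_lin D u v g h (a : R) : measurable D -> L2 D u -> L2 D v ->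
  is_weak_grad D u g -> is_weak_grad D v h ->
  is_weak_grad D (u \+ (fun x => a * v x)) (fun x => g x + a *: h x).
Proof.
move=> mD Lu Lv Gu Gv i; have [Lg Hg] := Gu i; have [Lh Hh] := Gv i.
have e : (fun x => (g x + a *: h x) ord0 i) =
    (fun x => g x ord0 i) \+ (fun x => a * h x ord0 i).
  by apply/funext => x; rewrite !mxE.
rewrite e; have Lah := L2Z a mD Lh; have Lav := L2Z a mD Lv.
split=> [|q tq]; first exact: L2D.
have Lq := test_function_L2 mD tq.
have Ldq := test_function_L2 mD (test_function_pderiv i tq).
by rewrite !ipDl// !ipZl// Hg// Hh// mulrN opprD.
Qed.

Lemma is_weak_grad_unique D u g h : bounded_open D ->
  is_weak_grad D u g -> is_weak_grad D u h -> {ae leb, forall x, D x -> g x = h x}.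
Proof.
move=> bD Gg Gh; have mD := bounded_open_measurable bD; have [oD finD] := bD.
have H i : {ae leb, forall x, D x -> g x ord0 i - h x ord0 i = 0}.
  have [Lg Hg] := Gg i; have [Lh Hh] := Gh i.
  apply: (@test_orthogonal_ae0 _ _ _ oD (fun x => g x ord0 i - h x ord0 i)).
    by apply: L2_integrable => //; exact: (L2B mD Lg Lh).
  move=> q tq; have Lq := test_function_L2 mD tq.
  have := ipBl mD Lg Lh Lq; rewrite {1}/ip => ->.
  by apply/eqP; rewrite subr_eq0 -eqr_opp -Hg// Hh.
have {}H : {ae leb, forall x (i : 'I_d), D x -> g x ord0 i - h x ord0 i = 0}.
  by apply: filter_forall => i; exact: H.
apply: filterS H => x H Dx; apply/rowP => i; apply/eqP.
by rewrite -subr_eq0 H.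
Qed.

Lemma wgradP D u : H1 D u -> is_weak_grad D u (wgrad D u).
Proof. by move=> [_ ex]; exact: xgetPex. Qed.

Lemma wgrad_ae D u g : bounded_open D -> is_weak_grad D u g ->
  {ae leb, forall x, D x -> wgrad D u x = g x}.
Proof.
move=> bD Gg; apply: (is_weak_grad_unique bD _ Gg).
by apply: (@xgetPex _ (fun=> 0)); exists g.
Qed.

Lemma H1_lin D u v (a : R) : measurable D -> H1 D u -> H1 D v -> H1 D (u \+ (fun x => a * v x)).
Proof.
move=> mD [Lu [g Gg]] [Lv [h Gh]]; split; first by apply: L2D => //; exact: L2Z.
by exists (fun x => g x + a *: h x); exact: is_weak_grad_lin.
Qed.

Lemma wgrad_lin D u v (a : R) : bounded_open D -> H1 D u -> H1 D v ->
  {ae leb, forall x, D x -> wgrad D (u \+ (fun x => a * v x)) x = wgrad D u x + a *: wgrad D v x}.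
Proof.
move=> bD Hu Hv; have mD := bounded_open_measurable bD.
apply: wgrad_ae => //; apply: is_weak_grad_lin => //; [exact: Hu.1|exact: Hv.1|exact: wgradP..].
Qed.

Lemma H1_wgrad_L2 D u : H1 D u -> vL2 D (wgrad D u).
Proof. by move=> /wgradP G i; have [] := G i. Qed.

Lemma H1_test D psi : measurable D -> test_function D psi -> H1 D psi.
Proof.
move=> mD tp; split; first exact: test_function_L2 tp.
by eexists; exact: is_weak_grad_test.
Qed.

Lemma dotv_integrable D g h : measurable D -> vL2 D g -> vL2 D h ->
  leb.-integrable D (fun x => (dotv (g x) (h x))%:E).
Proof.
move=> mD Lg Lh; rewrite /dotv.
under eq_fun do rewrite -sumEFin.
apply: integrable_sum => // i _; exact: (L2_mul_integrable mD (Lg i) (Lh i)).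
Qed.

Lemma Rintegral_dotv D g h : measurable D -> vL2 D g -> vL2 D h ->
  \int[leb]_(x in D) dotv (g x) (h x) = \sum_i ip D (fun x => g x ord0 i) (fun x => h x ord0 i).
Proof.
move=> mD Lg Lh; rewrite /dotv.
elim: (index_enum _) => [|i r IH].
  by rewrite big_nil; under eq_Rintegral do rewrite big_nil; rewrite Rintegral_cst// mul0r.
rewrite big_cons -IH; under eq_Rintegral do rewrite big_cons.
rewrite RintegralD//; first exact: L2_mul_integrable.
rewrite (_ : EFin \o _ = (fun x => \sum_(j <- r) (g x ord0 j * h x ord0 j)%:E)%E); last first.
  by apply/funext => x; rewrite /= sumEFin.
apply: integrable_sum => // j _; exact: (L2_mul_integrable mD (Lg j) (Lh j)).
Qed.

Lemma H1_coord_le D u i : H1 D u -> measurable D -> l2norm D (fun x => wgrad D u x ord0 i) <= h1norm D u.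
Proof.
move=> Hu mD; rewrite /l2norm /h1norm ler_wsqrtr//.
have LG := H1_wgrad_L2 Hu; rewrite Rintegral_dotv// (bigD1 i)//= addrCA lerDl.
by rewrite addr_ge0 ?ip_ge0// sumr_ge0// => j _; exact: ip_ge0.
Qed.

Lemma H1_l2_le D u : H1 D u -> measurable D -> l2norm D u <= h1norm D u.
Proof.
move=> Hu mD; rewrite /l2norm /h1norm ler_wsqrtr//.
have LG := H1_wgrad_L2 Hu; rewrite Rintegral_dotv// lerDl.
by rewrite sumr_ge0// => j _; exact: ip_ge0.
Qed.

End weak_gradient.

(** * Elliptic forms and the Friedrichs inequality *)

Section elliptic_forms.
Context {R : realType} (d : nat).
Local Notation V := 'rV[R]_d.
Local Notation leb := (lebesgue_rV R d).
Context (D : set V) (bD : bounded_open D) (A : V -> 'M[R]_d) (amax : R).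
Hypothesis HA : elliptic D A amax.
Implicit Types (E : set V) (u v w : V -> R) (g h : V -> V).

Let mD : measurable D := bounded_open_measurable bD.

Lemma dotvAE (x : V) (xi eta : V) : dotv (xi *m (A x)^T) eta =
  \sum_i \sum_j xi ord0 j * A x i j * eta ord0 i.
Proof.
apply: eq_bigr => i _; rewrite mxE mulr_suml; apply: eq_bigr => j _.
by rewrite mxE.
Qed.

Lemma dotvAC (x xi eta : V) : D x -> dotv (xi *m (A x)^T) eta = dotv (eta *m (A x)^T) xi.
Proof.
move=> Dx; have [sA _] := HA.2 _ Dx; rewrite !dotvAE exchange_big.
apply: eq_bigr => i _; apply: eq_bigr => j _.
by rewrite -{1}sA mxE; ring.
Qed.

Lemma dotvADl (x xi eta z : V) (a : R) :
  dotv ((xi + a *: eta) *m (A x)^T) z = dotv (xi *m (A x)^T) z + a * dotv (eta *m (A x)^T) z.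
Proof.
rewrite /dotv mulr_sumr -big_split; apply: eq_bigr => i _ /=.
by rewrite mulmxDl -scalemxAl !mxE; ring.
Qed.

Lemma dotvADr (x xi eta z : V) (a : R) :
  dotv (z *m (A x)^T) (xi + a *: eta) = dotv (z *m (A x)^T) xi + a * dotv (z *m (A x)^T) eta.
Proof.
rewrite /dotv mulr_sumr -big_split; apply: eq_bigr => i _ /=.
by rewrite !mxE; ring.
Qed.

Lemma dotv_ge0 (xi : V) : 0 <= dotv xi xi.
Proof. by apply: sumr_ge0 => i _; rewrite -expr2 sqr_ge0. Qed.

(** Nonnegativity of the form at e_i + e_j and at e_i - e_j bounds an entry by the mean of two
    diagonal ones, and those are at most [amax]. Bounded entries keep A grad u square integrable. *)
Lemma elliptic_entry_le (x : V) i j : D x -> `|A x i j| <= amax.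
Proof.
move=> Dx; have [sA eA] := HA.2 _ Dx.
have ae k l : dotv (delta_mx ord0 k *m (A x)^T) (delta_mx ord0 l) = A x l k.
  rewrite dotvAE (bigD1 l)//= (bigD1 k)//= !mxE !eqxx/= !mulr1 mul1r.
  rewrite big1 => [|k' /negbTE kk']; last by rewrite mxE kk' !mul0r.
  rewrite addr0 big1 ?addr0// => l' /negbTE ll'; apply: big1 => k' _.
  by rewrite [X in _ * X]mxE ll' mulr0.
have dd k : dotv (delta_mx ord0 k : V) (delta_mx ord0 k) = 1.
  rewrite /dotv (bigD1 k)//= !mxE !eqxx mulr1 big1 ?addr0// => l /negbTE kl.
  by rewrite mxE kl mul0r.
have diag k : A x k k <= amax.
  by have /andP[_] := eA (delta_mx ord0 k); rewrite ae dd mulr1.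
have pos (xi : V) : 0 <= dotv (xi *m (A x)^T) xi.
  by have /andP[h _] := eA xi; exact: le_trans (dotv_ge0 _) h.
have Aji : A x j i = A x i j by rewrite -{1}sA mxE.
have := pos (delta_mx ord0 i + 1 *: delta_mx ord0 j).
have := pos (delta_mx ord0 i + (-1) *: delta_mx ord0 j).
rewrite !dotvADl !dotvADr !ae Aji => h1 h2.
by rewrite ler_norml; have := diag i; have := diag j => h3 h4; apply/andP; split; lra.
Qed.

Lemma vL2_elliptic E g : measurable E -> E `<=` D -> vL2 E g ->
  vL2 E (fun x => g x *m (A x)^T).
Proof.
move=> mE ED Lg i; under eq_fun do rewrite mxE; apply: L2_sum => // j.
under eq_fun do rewrite mxE mulrC.
apply: (@L2_bounded_mul _ _ _ _ _ amax) => //.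
  by apply: measurable_funS (HA.1 i j).
by move=> x /ED Dx; exact: elliptic_entry_le.
Qed.

(** The gradient is the one on [D] whatever [E] is, so that no weak derivatives on [E] are involved;
    [form_a_restrict] links these forms to [form_a]. *)
Definition form_on E u v : R :=
  \int[leb]_(x in E) dotv (wgrad D u x *m (A x)^T) (wgrad D v x).

Lemma vL2_wgrad E u : measurable E -> E `<=` D -> H1 D u -> vL2 E (wgrad D u).
Proof. by move=> mE ED Hu i; apply: (L2S mD mE ED); exact: H1_wgrad_L2. Qed.

Lemma form_on_integrable E u v : measurable E -> E `<=` D -> H1 D u -> H1 D v ->
  leb.-integrable E (fun x => (dotv (wgrad D u x *m (A x)^T) (wgrad D v x))%:E).
Proof.
move=> mE ED Hu Hv; apply: dotv_integrable => //; last exact: vL2_wgrad.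
by apply: vL2_elliptic => //; exact: vL2_wgrad.
Qed.

Lemma form_onC E u v : E `<=` D -> form_on E u v = form_on E v u.
Proof.
by move=> ED; apply: eq_Rintegral => x; rewrite inE => /ED Dx; rewrite dotvAC.
Qed.

Lemma form_on_lin E u v w (a : R) : measurable E -> E `<=` D -> H1 D u -> H1 D v -> H1 D w ->
  form_on E (u \+ (fun x => a * v x)) w = form_on E u w + a * form_on E v w.
Proof.
move=> mE ED Hu Hv Hw; have Huv := H1_lin a mD Hu Hv.
rewrite /form_on -RintegralZl//; last exact: form_on_integrable.
rewrite -RintegralD//; first last.
- rewrite (_ : EFin \o _ = fun x => (a%:E * (dotv (wgrad D v x *m (A x)^T) (wgrad D w x))%:E)%E).
    by apply: integrableZl => //; exact: form_on_integrable.
  by apply/funext => x /=; rewrite EFinM.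
- exact: form_on_integrable.
rewrite /Rintegral; congr fine; apply: ae_eq_integral => //.
- exact: measurable_int (form_on_integrable mE ED Huv Hw).
- apply/measurable_EFinP; apply: measurable_funD.
    by apply/measurable_EFinP; exact: measurable_int (form_on_integrable mE ED Hu Hw).
  apply: measurable_funM; first exact: measurable_cst.
  by apply/measurable_EFinP; exact: measurable_int (form_on_integrable mE ED Hv Hw).
- have := wgrad_lin a bD Hu Hv; apply: filterS => x H Ex.
  by rewrite H; [rewrite dotvADl|exact: ED].
Qed.

Lemma form_on_ge_ip E u : measurable E -> E `<=` D -> H1 D u ->
  \sum_i ip E (fun x => wgrad D u x ord0 i) (fun x => wgrad D u x ord0 i) <= form_on E u u.
Proof.
move=> mE ED Hu; have Lu := vL2_wgrad mE ED Hu.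
rewrite -Rintegral_dotv//; apply: le_Rintegral => //;
  [exact: dotv_integrable|exact: form_on_integrable|].
by move=> x /ED Dx; have [_ /(_ (wgrad D u x))/andP[]] := HA.2 _ Dx.
Qed.

Lemma form_on_ge0 E u : E `<=` D -> 0 <= form_on E u u.
Proof.
move=> ED; apply: Rintegral_ge0 => x /ED Dx.
have [_ /(_ (wgrad D u x))/andP[h _]] := HA.2 _ Dx.
exact: le_trans (dotv_ge0 _) h.
Qed.

End elliptic_forms.

(** The left side is the integral of [f] against the function counting the sets. That function is
    bounded only almost everywhere because the cells do not control it on the mesh skeleton. *)
Lemma overlap_integral {R : realType} d0 (T : measurableType d0) (mu : {measure set T -> \bar R})
    (D : set T) (I : finType) (E : I -> set T) (L : R) (f : T -> R) :
  measurable D -> (forall i, measurable (E i)) -> (forall i, E i `<=` D) -> 0 <= L ->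
  mu.-integrable D (EFin \o f) -> (forall x, D x -> 0 <= f x) ->
  {ae mu, forall x, D x -> \sum_i \1_(E i) x <= L} ->
  \sum_i \int[mu]_(x in E i) f x <= L * \int[mu]_(x in D) f x.
Proof.
move=> mD mE ED L0 If f0 HL.
have IE i : mu.-integrable D (fun x => (\1_(E i) x * f x)%:E).
  have : mu.-integrable (D `&` E i) (EFin \o f).
    by apply: integrableS If => //; exact: measurableI.
  move/(integrable_mkcond _ (measurableI _ _ mD (mE i))).
  move/(integrableS measurableT mD (@subsetT _ _)); apply: eq_integrable => // x; rewrite inE => Dx.
  by rewrite patchE in_setI mem_set//= indicE; case: (x \in E i); rewrite /= ?mul1r ?mul0r.
have -> : \sum_i \int[mu]_(x in E i) f x = \int[mu]_(x in D) (\sum_i \1_(E i) x * f x).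
  have eE i : \int[mu]_(x in E i) f x = \int[mu]_(x in D) (\1_(E i) x * f x).
    rewrite -[in LHS](setIidr (ED i)) Rintegral_mkcondr; apply: eq_Rintegral => x _.
    by rewrite patchE indicE; case: (x \in E i); rewrite ?mul1r ?mul0r.
  under eq_bigr do rewrite eE.
  elim: (index_enum I) => [|i r IH].
    by rewrite big_nil; under eq_Rintegral do rewrite big_nil; rewrite Rintegral_cst// mul0r.
  rewrite big_cons IH; under [RHS]eq_Rintegral do rewrite big_cons.
  rewrite RintegralD//; first exact: IE.
  rewrite (_ : EFin \o _ = (fun x => \sum_(j <- r) (\1_(E j) x * f x)%:E)%E); last first.
    by apply/funext => x /=; rewrite -sumEFin.
  by apply: integrable_sum.
have IS : mu.-integrable D (fun x => (\sum_i \1_(E i) x * f x)%:E).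
  under eq_fun do rewrite -sumEFin.
  by apply: integrable_sum.
have IL : mu.-integrable D (fun x => (L * f x)%:E).
  by under eq_fun do rewrite EFinM; exact: integrableZl.
rewrite -RintegralZl// /Rintegral fine_le//; try exact: integrable_fin_num.
have f0' x i : D x -> 0 <= \1_(E i) x * f x by move=> Dx; rewrite mulr_ge0 ?f0// indicE.
apply: ae_ge0_le_integral => //.
- by move=> x Dx; rewrite lee_fin sumr_ge0// => i _; exact: f0'.
- exact: measurable_int IS.
- by move=> x Dx; rewrite lee_fin mulr_ge0// f0.
- exact: measurable_int IL.
- apply: filterS HL => x H Dx; rewrite lee_fin -mulr_suml.
  by apply: ler_wpM2r; [exact: f0|exact: H].
Qed.

(** The square of b + 2at, combined with 4a^2 <= H^2. In the Friedrichs inequality a is the centred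
    coordinate, b the function and t its derivative. *)
Lemma young_weighted {R : realFieldType} (a b t H : R) : `|a| <= H / 2 ->
  -4 * (a * b) * t <= b * b + H ^+ 2 * t * t.
Proof.
rewrite ler_norml => /andP[h1 h2].
have h3 : 4 * a ^+ 2 <= H ^+ 2 by nra.
have h4 : 4 * a ^+ 2 * t ^+ 2 <= H ^+ 2 * t ^+ 2 by rewrite ler_wpM2r// sqr_ge0.
by have := sqr_ge0 (b + 2 * a * t); nra.
Qed.

(** * Functions with zero trace: integration by parts and the Friedrichs inequality *)

Section zero_trace.
Context {R : realType} (d : nat).
Local Notation V := 'rV[R]_d.
Local Notation leb := (lebesgue_rV R d).
Context (D : set V) (bD : bounded_open D).
Implicit Types (u v w : V -> R).

Let mD : measurable D := bounded_open_measurable bD.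

Lemma H10_approx w (e : R) : H10 D w -> 0 < e -> exists psi, [/\ test_function D psi,
  H1 D (w \- psi), l2norm D (w \- psi) <= e,
  forall i, l2norm D (fun x => wgrad D (w \- psi) x ord0 i) <= e &
  {ae leb, forall x, D x -> forall i, wgrad D (w \- psi) x ord0 i = wgrad D w x ord0 i - pderiv i psi x}].
Proof.
move=> [Hw /(_ e)] + e0 => /(_ e0)[psi tp he]; exists psi.
have Hp := H1_test mD tp.
have E : w \- psi = w \+ (fun x => -1 * psi x) by apply/funext => x; rewrite /= mulN1r.
have Hr : H1 D (w \- psi) by rewrite E; exact: H1_lin.
split => //.
- exact: le_trans (H1_l2_le Hr mD) (ltW he).
- by move=> i; exact: le_trans (H1_coord_le i Hr mD) (ltW he).
- have a1 := wgrad_lin (-1) bD Hw Hp.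
  have a2 := wgrad_ae bD (is_weak_grad_test mD tp).
  rewrite E; apply: filterS2 a1 a2 => x a1 a2 Dx i.
  by rewrite a1// a2// !mxE mulN1r.
Qed.

Lemma le_eps_eq0 (x K : R) : 0 <= K -> (forall e, 0 < e -> `|x| <= e * K) -> x = 0.
Proof.
move=> K0 H; apply/eqP; rewrite -normr_le0 leNgt; apply/negP => x0.
have := H (`|x| / (2 * (K + 1))); rewrite divr_gt0// ?mulr_gt0// ?ltr_wpDl// => /(_ isT).
rewrite mulrAC ler_pdivlMr ?mulr_gt0 ?ltr_wpDl//.
nra.
Qed.

(** Nothing is asked of [f] at the boundary; the zero trace of [w] takes care of it. With a test
    function in place of [w] this is [integral_test_parts], and the error terms are bounded by
    Cauchy-Schwarz. *)
Lemma H10_parts w (f : V -> R) i : H10 D w -> C_k 1 f -> L2 D f -> L2 D (pderiv i f) ->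
  ip D w (pderiv i f) = - ip D (fun x => wgrad D w x ord0 i) f.
Proof.
move=> Hw Cf Lf Ldf; apply/eqP; rewrite -addr_eq0; apply/eqP.
apply: (@le_eps_eq0 _ (l2norm D (pderiv i f) + l2norm D f)).
  by rewrite addr_ge0 ?sqrtr_ge0.
move=> e e0; have [psi [tp Hr r1 r2 ae]] := H10_approx Hw e0.
have Lw : L2 D w := Hw.1.1; have Lp := test_function_L2 mD tp.
have Ldp := test_function_L2 mD (test_function_pderiv i tp).
have Lg := H1_wgrad_L2 Hw.1 i; have Lgr := H1_wgrad_L2 Hr i; have Lr := Hr.1.
have E1 : ip D w (pderiv i f) = ip D (w \- psi) (pderiv i f) + ip D psi (pderiv i f).
  by rewrite ipBl// subrK.
have E2 : ip D (fun x => wgrad D w x ord0 i) f =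
    ip D (fun x => wgrad D (w \- psi) x ord0 i) f + ip D (pderiv i psi) f.
  rewrite -ipDl//; apply: eq_ip_ae => //; [exact: Lg.1|exact: (L2D mD Lgr Ldp).1|exact: Lf.1|].
  by apply: filterS ae => x H Dx; rewrite /= H// subrK.
have E3 := integral_test_parts mD tp Cf Lf Ldf.
rewrite E1 E2 (ipC D (pderiv i psi)) E3 (ipC D psi) addrACA subrr addr0 mulrDr.
rewrite (le_trans (ler_normD _ _))// lerD// (le_trans (ip_cauchy_schwarz _ _ _))//;
  by rewrite ler_wpM2r ?sqrtr_ge0.
Qed.

Context (i : 'I_d) (c C : R).
Hypothesis DC : forall x, D x -> `|x ord0 i - c| <= C.

Let xi (x : V) := x ord0 i - c.

Lemma C_k_xi k : C_k k xi.
Proof.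
have := @C_k_coord _ d k id 1 (- c) i (smooth1_id).
by congr C_k; apply/funext => x; rewrite mul1r.
Qed.

Lemma pderiv_xi x : pderiv i xi x = 1.
Proof.
have line (h : R) : xi (h *: delta_mx ord0 i + x) = (fun t : R => t + xi x) (h *: (1 : R) + 0).
  by rewrite /xi shiftE eqxx addr0 /GRing.scale /=; ring.
rewrite /pderiv; have [_ ->] := @derive_line _ _ _ _ (fun t : R => t + xi x) _ _ _ _ line.
by rewrite derive_val addr0.
Qed.

Lemma L2_xi f : L2 D f -> L2 D (fun x => xi x * f x).
Proof.
move=> Lf; apply: (L2_bounded_mul mD Lf _ DC).
apply: measurable_funTS; apply: continuous_rV_measurable; exact: C_k_continuous (C_k_xi 0).
Qed.

(** Formally, the derivative of xi w^2 integrates to zero. Only one of the two factors w is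
    approximated: the weak gradient of [w] is tested against [xi \* psi], so that no product of two
    Sobolev functions is ever differentiated. *)
Lemma H10_moment w : H10 D w ->
  ip D w w = -2 * ip D (fun x => xi x * w x) (fun x => wgrad D w x ord0 i).
Proof.
(* Here a = |w|^2 and b is the integral of xi w d_i w. The terms q, s, u contain [psi] and cancel by
   the weak gradient identity; p, r, t contain the approximation error and are small. *)
have arith (a b p q r s t u : R) : s + q = - u -> b = r + s -> a = p + q -> b = t + u ->
  a + 2 * b = p + t + r by move=> *; lra.
move=> Hw; apply/eqP; rewrite -subr_eq0 mulNr opprK; apply/eqP.
set g := fun x => wgrad D w x ord0 i.
have Lw : L2 D w := Hw.1.1; have Lg : L2 D g := H1_wgrad_L2 Hw.1 i.
have Lxw := L2_xi Lw; have Lxg := L2_xi Lg.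
apply: (@le_eps_eq0 _ (l2norm D w + l2norm D (fun x => xi x * g x) + l2norm D (fun x => xi x * w x))).
  by rewrite !addr_ge0 ?sqrtr_ge0.
move=> e e0; have [psi [tp Hr r1 r2 ae]] := H10_approx Hw e0.
have Lp := test_function_L2 mD tp.
have Ldp := test_function_L2 mD (test_function_pderiv i tp).
have Lgr := H1_wgrad_L2 Hr i; have Lr := Hr.1.
set gr := (fun x => wgrad D (w \- psi) x ord0 i) in Lgr r2.
have txp := test_function_mul tp (C_k_xi).
have dE : pderiv i (xi \* psi) = (fun x => xi x * pderiv i psi x) \+ psi.
  apply/funext => x; have [_ dx _] := C_k_xi 1; have [Cp _ _] := tp; have [_ dp _] := Cp 1%N.
  by rewrite pderivM// pderiv_xi mul1r.
have [_ /(_ _ txp)] := wgradP Hw.1 i.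
rewrite dE ipDr//; last exact: L2_xi.
have swap (f h : V -> R) : ip D f (fun x => xi x * h x) = ip D (fun x => xi x * f x) h.
  by apply: eq_Rintegral => x _; rewrite mulrCA mulrA.
rewrite swap -/g (swap g psi) => E0.
have E1 : ip D (fun x => xi x * w x) g = ip D (fun x => xi x * w x) gr + ip D (fun x => xi x * w x) (pderiv i psi).
  rewrite -ipDr// ipC [RHS]ipC; apply: eq_ip_ae => //;
    [exact: Lg.1|exact: (L2D mD Lgr Ldp).1|exact: Lxw.1|].
  by apply: filterS ae => x H Dx; rewrite /= /gr H// subrK.
have E2 : ip D w w = ip D w (w \- psi) + ip D w psi.
  by rewrite -ipDr//; congr ip; apply/funext => x /=; rewrite subrK.
have E3 : ip D (fun x => xi x * w x) g = ip D (fun x => xi x * g x) (w \- psi) + ip D (fun x => xi x * g x) psi.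
  rewrite -swap ipC -ipDr//; congr ip; apply/funext => x /=; by rewrite subrK.
rewrite (arith _ _ _ _ _ _ _ _ E0 E1 E2 E3) !mulrDr.
have cs f h K : L2 D f -> L2 D h -> l2norm D h <= e -> K = l2norm D f -> `|ip D f h| <= e * K.
  move=> Lf Lh he ->; rewrite (le_trans (ip_cauchy_schwarz mD Lf Lh))// [leLHS]mulrC.
  by apply: ler_wpM2r => //; exact: sqrtr_ge0.
rewrite (le_trans (ler_normD _ _))// lerD//; last by apply: cs => //; exact: r2.
by rewrite (le_trans (ler_normD _ _))// lerD//; apply: cs.
Qed.

(** Twice the moment identity and Young's inequality give 2|w|^2 <= |w|^2 + H^2 |d_i w|^2. The width
    is constrained only where [w] is nonzero, so [H] measures a subdomain and not the domain. *)
Lemma H10_friedrichs w (H : R) : H10 D w -> (forall x, D x -> w x != 0 -> `|x ord0 i - c| <= H / 2) ->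
  ip D w w <= H ^+ 2 * ip D (fun x => wgrad D w x ord0 i) (fun x => wgrad D w x ord0 i).
Proof.
move=> Hw Hs; have := H10_moment Hw.
set g := fun x => wgrad D w x ord0 i.
have Lw : L2 D w := Hw.1.1; have Lg : L2 D g := H1_wgrad_L2 Hw.1 i.
have Lxw := L2_xi Lw.
have LHg : L2 D (fun x => H ^+ 2 * g x) by exact: L2Z.
have L4 : L2 D (fun x => -4 * (xi x * w x)) by exact: L2Z.
have le4 : ip D (fun x => -4 * (xi x * w x)) g <= ip D w w + H ^+ 2 * ip D g g.
  rewrite -ipZl// /ip -RintegralD//; try exact: L2_mul_integrable.
  apply: le_Rintegral => //; first exact: L2_mul_integrable.
    exact: (integrableD mD (L2_mul_integrable mD Lw Lw) (L2_mul_integrable mD LHg Lg)).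
  move=> x Dx; have [->|wx] := eqVneq (w x) 0.
    by rewrite !mulr0 !mul0r add0r -mulrA -!expr2 mulr_ge0 ?sqr_ge0.
  by apply: young_weighted; exact: Hs.
have arith (a b e : R) : a = -2 * b -> -4 * b <= a + e -> a <= e by move=> *; lra.
by move=> E; apply: (arith _ _ _ E); rewrite -(ipZl (-4) mD Lxw Lg).
Qed.

End zero_trace.

(** * Abstract two-level Schwarz theory *)

Lemma ler_of_sqr {R : realDomainType} (a b : R) : 0 <= b -> a ^+ 2 <= b ^+ 2 -> a <= b.
Proof.
move=> b0; have [a0|/ltW a0 _] := leP 0 a; last exact: le_trans a0 b0.
by rewrite ler_pXn2r// nnegrE.
Qed.

Lemma ler_sqr_of {R : realDomainType} (a b : R) : 0 <= a -> a <= b -> a ^+ 2 <= b ^+ 2.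
Proof. by move=> a0 ab; rewrite ler_pXn2r// nnegrE (le_trans a0). Qed.

(** Common to the coarse and local projections, with s the k^2-term and 1/256 the square of the
    bound 1/16 on sigma. The relations yield the factor 128/127, rounded up to 65/64. *)
Lemma stability_of_energy {R : realFieldType} (a b c s : R) : 0 <= a -> 0 <= b ->
  a ^+ 2 = c + 2 * s -> c <= a * b -> s <= 1 / 256 * a ^+ 2 -> a <= 65 / 64 * b.
Proof.
move=> a0 b0 E h1 h2; have [->|ne] := eqVneq a 0; first by rewrite mulr_ge0.
have pa : 0 < a by rewrite lt_neqAle eq_sym ne.
have ab := mulr_ge0 a0 b0.
rewrite -(ler_pM2l pa) -expr2 mulrCA; move: E h1 h2 ab.
move: (a ^+ 2) (a * b) => x y; lra.
Qed.

Section bilinear_matrix.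
Context {R : rcfType} (n : nat).
Implicit Types (M : 'M[R]_n) (x y z : 'cV[R]_n).

Definition bf M x y : R := (y^T *m M *m x) ord0 ord0.

Lemma bfDl M x y z : bf M (x + y) z = bf M x z + bf M y z.
Proof. by rewrite /bf mulmxDr mxE. Qed.

Lemma bfDr M x y z : bf M z (x + y) = bf M z x + bf M z y.
Proof. by rewrite /bf linearD /= !mulmxDl mxE. Qed.

Lemma bfZl M a x z : bf M (a *: x) z = a * bf M x z.
Proof. by rewrite /bf -scalemxAr mxE. Qed.

Lemma bfZr M a x z : bf M z (a *: x) = a * bf M z x.
Proof. by rewrite /bf linearZ /= -!scalemxAl mxE. Qed.

Lemma bfNl M x z : bf M (- x) z = - bf M x z.
Proof. by rewrite -scaleN1r bfZl mulN1r. Qed.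

Lemma bfNr M x z : bf M z (- x) = - bf M z x.
Proof. by rewrite -scaleN1r bfZr mulN1r. Qed.

Lemma bf0l M z : bf M 0 z = 0.
Proof. by rewrite -(scale0r 0) bfZl mul0r. Qed.

Lemma bf0r M z : bf M z 0 = 0.
Proof. by rewrite -(scale0r 0) bfZr mul0r. Qed.

Lemma bf_suml M I (r : seq I) (P : pred I) (F : I -> 'cV[R]_n) z :
  bf M (\sum_(i <- r | P i) F i) z = \sum_(i <- r | P i) bf M (F i) z.
Proof. by elim/big_rec2: _ => [|i a b _ <-]; [exact: bf0l|exact: bfDl]. Qed.

Lemma bf_sumr M I (r : seq I) (P : pred I) (F : I -> 'cV[R]_n) z :
  bf M z (\sum_(i <- r | P i) F i) = \sum_(i <- r | P i) bf M z (F i).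
Proof. by elim/big_rec2: _ => [|i a b _ <-]; [exact: bf0r|exact: bfDr]. Qed.

Lemma bfDM M M' x y : bf (M + M') x y = bf M x y + bf M' x y.
Proof. by rewrite /bf mulmxDr mulmxDl mxE. Qed.

Lemma bfZM a M x y : bf (a *: M) x y = a * bf M x y.
Proof. by rewrite /bf -scalemxAr -scalemxAl mxE. Qed.

Lemma bfNM M x y : bf (- M) x y = - bf M x y.
Proof. by rewrite -scaleN1r bfZM mulN1r. Qed.

Lemma bfC M x y : M^T = M -> bf M x y = bf M y x.
Proof.
move=> sM; have -> : bf M y x = (x^T *m M *m y)^T ord0 ord0 by rewrite mxE.
by rewrite !trmx_mul trmxK sM mulmxA.
Qed.

Definition psd M := M^T = M /\ forall x, 0 <= bf M x x.

Definition nrm M x : R := Num.sqrt (bf M x x).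

Lemma nrm_ge0 M x : 0 <= nrm M x.
Proof. exact: sqrtr_ge0. Qed.

Lemma sqr_nrm M x : psd M -> nrm M x ^+ 2 = bf M x x.
Proof. by move=> [_ pM]; rewrite sqr_sqrtr. Qed.

Lemma bf_quadratic M x y t : M^T = M ->
  bf M (x + t *: y) (x + t *: y) = bf M x x + 2 * t * bf M x y + t ^+ 2 * bf M y y.
Proof. by move=> sM; rewrite !bfDl !bfDr !bfZl !bfZr (bfC y x sM); ring. Qed.

Lemma le_nrm_prod (b p q : R) : 0 <= p -> 0 <= q -> b ^+ 2 <= p * q ->
  `|b| <= Num.sqrt p * Num.sqrt q.
Proof. by move=> p0 q0 H; rewrite -sqrtrM// -sqrtr_sqr ler_wsqrtr. Qed.

Lemma bf_cauchy_schwarz M x y : psd M -> `|bf M x y| <= nrm M x * nrm M y.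
Proof.
move=> [sM pM]; apply: le_nrm_prod => //; apply: sqr_le_prod_of_quadratic => // t.
by rewrite -bf_quadratic.
Qed.

(* Both [M] and [M'] being nonnegative, the indefinite form [M - M'] obeys the
   Cauchy-Schwarz inequality for [M + M']. *)
Lemma bf_sub_cauchy_schwarz M M' x y : psd M -> psd M' ->
  `|bf (M - M') x y| <= nrm (M + M') x * nrm (M + M') y.
Proof.
move=> [sM pM] [sM' pM']; have pMM z : 0 <= bf (M + M') z z by rewrite bfDM addr_ge0.
apply: le_nrm_prod => //; apply: sqr_le_prod_of_quadratic => // t.
have := pM (x + t *: y); have := pM' (x + (- t) *: y); rewrite !bf_quadratic// !bfDM bfNM.
by rewrite sqrrN; lra.
Qed.

Lemma psdD M M' : psd M -> psd M' -> psd (M + M').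
Proof.
move=> [sM pM] [sM' pM']; split => [|x]; first by rewrite linearD /= sM sM'.
by rewrite bfDM addr_ge0.
Qed.

Lemma psdZ M a : 0 <= a -> psd M -> psd (a *: M).
Proof.
move=> a0 [sM pM]; split => [|x]; first by rewrite linearZ /= sM.
by rewrite bfZM mulr_ge0.
Qed.

Lemma ler_nrmD M x y : psd M -> nrm M (x + y) <= nrm M x + nrm M y.
Proof.
move=> pM; rewrite -(@ler_pXn2r _ 2)// ?nnegrE ?addr_ge0 ?nrm_ge0//.
rewrite sqrrD !sqr_nrm// bfDl !bfDr (bfC y x pM.1).
have /ler_normlW := bf_cauchy_schwarz x y pM; lra.
Qed.

Lemma nrmN M x : nrm M (- x) = nrm M x.
Proof. by rewrite /nrm bfNl bfNr opprK. Qed.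

Lemma bf_young M x y t : psd M -> 0 < t ->
  bf M x y <= 2^-1 * (t * bf M x x + t^-1 * bf M y y).
Proof.
move=> [sM pM] t0; have := pM (t *: x + (-1) *: y).
rewrite bf_quadratic// !bfZl !bfZr => h.
have := mulr_ge0 (ltW (_ : 0 < t^-1)) h; rewrite invr_gt0 => /(_ t0).
have -> : t^-1 * (t * (t * bf M x x) + 2 * -1 * (t * bf M x y) + (-1) ^+ 2 * bf M y y) =
  t * bf M x x - 2 * bf M x y + t^-1 * bf M y y by field; rewrite gt_eqF.
lra.
Qed.

Lemma unitmx_inj M : (forall x, M *m x = 0 -> x = 0) -> M \in unitmx.
Proof.
move=> iM; rewrite -unitmx_tr -row_free_unit -kermx_eq0; apply/eqP/row_matrixP => i.
rewrite row0; apply: trmx_inj; rewrite trmx0; apply: iM.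
by apply: trmx_inj; rewrite trmx_mul trmxK trmx0 -row_mul mulmx_ker row0.
Qed.

End bilinear_matrix.

(** * Galerkin projections and the contraction of GMRES *)

Section galerkin.
Context {R : rcfType} (n r : nat) (B : 'M[R]_n) (E : 'M[R]_(n, r)).

Definition in_range (x : 'cV[R]_n) := exists y, x = E *m y.

Lemma galerkin_unit : (forall y : 'cV_r, E *m y = 0 -> y = 0) ->
  (forall x, in_range x -> (forall z, in_range z -> bf B x z = 0) -> x = 0) ->
  E^T *m B *m E \in unitmx.
Proof.
move=> iE H; apply: unitmx_inj => y My; apply/iE/H; first by exists y.
move=> _ [z ->]; rewrite /bf trmx_mul.
have -> : z^T *m E^T *m B *m (E *m y) = z^T *m (E^T *m B *m E *m y) by rewrite !mulmxA.
by rewrite My mulmx0 mxE.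
Qed.

(** The projection onto the range of [E] along its complement for the form of [B], written as one
    summand of the preconditioner times [B]. *)
Definition galerkin : 'M[R]_n := E *m invmx (E^T *m B *m E) *m E^T *m B.

Lemma galerkin_range x : in_range (galerkin *m x).
Proof. by eexists; rewrite /galerkin -!mulmxA. Qed.

Lemma galerkinE x z : E^T *m B *m E \in unitmx -> in_range z ->
  bf B (galerkin *m x) z = bf B x z.
Proof.
move=> uE [y ->]; rewrite /bf /galerkin trmx_mul; congr (fun_of_matrix _ _ _).
rewrite (_ : _ *m _ = y^T *m ((E^T *m B *m E) *m invmx (E^T *m B *m E)) *m E^T *m B *m x).
  by rewrite mulmxV// mulmx1.
by rewrite !mulmxA.
Qed.

End galerkin.

Section gmres_bound.
Context {R : realType} (n : nat).

Lemma krylov_lin (M : 'M[R]_n) r m x y a : krylov M r m x -> krylov M r m y ->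
  krylov M r m (x + a *: y).
Proof.
move=> [c ->] [c' ->]; exists (fun i => c i + a * c' i).
by rewrite scaler_sumr -big_split /=; apply: eq_bigr => i _; rewrite scalerA -scalerDl.
Qed.

Lemma krylovW (M : 'M[R]_n) r m x : krylov M r m x -> krylov M r m.+1 x.
Proof.
move=> [c ->]; exists (fun i : 'I_m.+1 => oapp c 0 (insub (val i))).
rewrite big_ord_recr /= insubF ?ltnn//= scale0r addr0.
by apply: eq_bigr => i _; rewrite valK.
Qed.

Lemma krylov_step (M : 'M[R]_n) r m x : krylov M r m x -> krylov M r m.+1 (M *m x).
Proof.
move=> [c ->]; exists (fun i : 'I_m.+1 => oapp c 0 (unlift ord0 i)).
rewrite big_ord_recl unlift_none /= scale0r add0r mulmx_sumr.
by apply: eq_bigr => i _; rewrite liftK /= -scalemxAr exprS mulmxA.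
Qed.

Lemma krylov_start (M : 'M[R]_n) r m : krylov M r m.+1 r.
Proof.
exists (fun i : 'I_m.+1 => (i == ord0)%:R); rewrite big_ord_recl eqxx scale1r expr0 mul1mx.
by rewrite big1 ?addr0// => i _; rewrite scale0r.
Qed.

(* The update along the current residual is an admissible competitor, so each
   step contracts at least as much as one minimal-residual step. *)
Lemma gmres_residual (D M : 'M[R]_n) g u (c1 c2 : R) : psd D -> 0 <= c1 -> c1 <= c2 -> 0 < c2 ->
  (forall x, c1 * bf D x x <= bf D x (M *m x)) ->
  (forall x, bf D (M *m x) (M *m x) <= c2 ^+ 2 * bf D x x) ->
  gmres D M g u -> forall j,
  energy_norm D (g - M *m u j) ^+ 2 <=
    (1 - c1 ^+ 2 / c2 ^+ 2) ^+ j * energy_norm D (g - M *m u 0%N) ^+ 2.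
Proof.
move=> pD c10 c12 c20 Hl Hu G.
have q0 : 0 <= 1 - c1 ^+ 2 / c2 ^+ 2.
  by rewrite subr_ge0 ler_pdivrMr ?exprn_gt0// mul1r ler_pXn2r// nnegrE// ltW.
elim=> [|j IH]; first by rewrite expr0 mul1r.
rewrite [(1 - _) ^+ j.+1]exprS -mulrA; apply: le_trans _ (ler_wpM2l q0 IH).
(* This step length minimises 1 - 2 al c1 + al^2 c2^2. *)
set rj := g - M *m u j; pose al := c1 / c2 ^+ 2.
have [_ /(_ (u j + al *: rj))] := G j.+1; rewrite /=.
have [Kj _] := G j; rewrite /= in Kj.
have -> : u j + al *: rj - u 0%N = (u j - u 0%N) + al *: rj by rewrite addrAC.
have Krj : krylov M (g - M *m u 0%N) j.+1 rj.
  have -> : rj = (g - M *m u 0%N) + (-1) *: (M *m (u j - u 0%N)).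
    by rewrite /rj scaleN1r mulmxBr opprB addrA subrK.
  by apply: krylov_lin; [exact: krylov_start|exact: krylov_step].
move=> /(_ (krylov_lin al (krylovW Kj) Krj)).
have -> : g - M *m (u j + al *: rj) = rj + (- al) *: (M *m rj).
  by rewrite mulmxDr -scalemxAr scaleNr opprD addrA.
move=> Hle; have := ler_pM (sqrtr_ge0 _) (sqrtr_ge0 _) Hle Hle; rewrite -!expr2 => {}Hle.
apply: le_trans Hle _; rewrite /energy_norm !sqr_sqrtr; try exact: pD.2.
rewrite -![(_ ord0 ord0)]/(bf D _ _) bf_quadratic; last exact: pD.1.
have h1 := Hl rj; have h2 := Hu rj.
have al0 : 0 <= al by rewrite divr_ge0// exprn_ge0// ltW.
have h1' := ler_wpM2l al0 h1.
have h2' := ler_wpM2l (exprn_ge0 2 al0) h2.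
have e1 : al * c1 = c1 ^+ 2 / c2 ^+ 2 by rewrite /al; field; rewrite gt_eqF.
have e2 : al ^+ 2 * c2 ^+ 2 = c1 ^+ 2 / c2 ^+ 2 by rewrite /al; field; rewrite gt_eqF.
rewrite mulrA e1 in h1'; rewrite mulrA e2 in h2'.
rewrite sqrrN; move: h1' h2'.
set a := _ / _; set b := bf D rj rj; set c := bf D rj _; set e := bf D (M *m rj) _ => h1' h2'.
lra.
Qed.

End gmres_bound.

(** * Bounds for the two-level operator in terms of abstract matrices *)

Section two_level_schwarz.
Context {R : realType} (n N r0 : nat) (r : 'I_N -> nat).
Context (A S : 'M[R]_n) (Al Sl : 'I_N -> 'M[R]_n).
Context (E0 : 'M[R]_(n, r0)) (E : forall i, 'M[R]_(n, r i)).
Context (k L Th C eta : R).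
Hypotheses (pA : psd A) (pS : psd S) (pAl : forall i, psd (Al i)) (pSl : forall i, psd (Sl i)).
Hypotheses (k0 : 0 < k) (L1 : 1 <= L) (Th0 : 0 <= Th) (C0 : 0 <= C) (eta0 : 0 <= eta).
Hypothesis posS : forall x, bf S x x = 0 -> x = 0.
Hypothesis ovA : forall x, \sum_i bf (Al i) x x <= L * bf A x x.
Hypothesis ovS : forall x, \sum_i bf (Sl i) x x <= L * bf S x x.
Hypothesis locA : forall i x y, in_range (E i) x -> bf A x y = bf (Al i) x y.
Hypothesis locS : forall i x y, in_range (E i) x -> bf S x y = bf (Sl i) x y.
Hypothesis friedrichs : forall i x, in_range (E i) x ->
  k ^+ 2 * bf S x x <= eta ^+ 2 * bf A x x.
Hypothesis injE0 : forall y : 'cV_r0, E0 *m y = 0 -> y = 0.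
Hypothesis injE : forall i (y : 'cV_(r i)), E i *m y = 0 -> y = 0.

Let D : 'M[R]_n := A + k ^+ 2 *: S.
Let B : 'M[R]_n := A - k ^+ 2 *: S.
Let Dl i : 'M[R]_n := Al i + k ^+ 2 *: Sl i.

(** What the spectral coarse space has to deliver. The local parts are controlled in the full energy
    by the local stiffness alone, without a mass term on the right. *)
Hypothesis split : forall x, exists z : 'I_N -> 'cV[R]_n,
  [/\ forall i, in_range (E i) (z i), in_range E0 (x - \sum_i z i) &
    forall i, bf D (z i) (z i) <= Th * bf (Al i) x x].
Hypothesis dual : forall e, exists w, (forall v, bf B w v = bf S e v) /\
  nrm D w <= C * nrm S e.

Let K := 2 + 3 * L ^+ 2 * Th.
Let sig := L * Num.sqrt Th * C * k.
Hypotheses (s1 : 8 * K * sig < 1) (t1 : 12 * L * K * eta < 1).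

Let pkS : psd (k ^+ 2 *: S). Proof. by apply: psdZ => //; exact: sqr_ge0. Qed.
Let pkSl i : psd (k ^+ 2 *: Sl i). Proof. by apply: psdZ => //; exact: sqr_ge0. Qed.
Let pD : psd D. Proof. exact: psdD. Qed.
Let pDl i : psd (Dl i). Proof. exact: psdD. Qed.
Let sB : B^T = B. Proof. by rewrite /B linearB /= pA.1 pkS.1. Qed.

Let DE x y : bf D x y = bf A x y + k ^+ 2 * bf S x y.
Proof. by rewrite /D bfDM bfZM. Qed.

Let DlE i x y : bf (Dl i) x y = bf (Al i) x y + k ^+ 2 * bf (Sl i) x y.
Proof. by rewrite /Dl bfDM bfZM. Qed.

Let BE x y : bf B x y = bf A x y - k ^+ 2 * bf S x y.
Proof. by rewrite /B bfDM bfNM bfZM. Qed.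

Let BDE x y : bf B x y = bf D x y - 2 * k ^+ 2 * bf S x y.
Proof. by rewrite BE DE; ring. Qed.

Let kS_le x : k ^+ 2 * bf S x x <= bf D x x.
Proof. by rewrite DE lerDr; exact: pA.2. Qed.

Let posD x : bf D x x = 0 -> x = 0.
Proof.
move=> Dx; apply: posS; apply/eqP; rewrite eq_le pS.2 andbT.
have := kS_le x; rewrite Dx pmulr_rle0// exprn_gt0//.
Qed.

Let K2 : 2 <= K.
Proof. by rewrite lerDl mulr_ge0// mulr_ge0// sqr_ge0. Qed.

Let sqT := Num.sqrt Th.
Let sqT0 : 0 <= sqT. Proof. exact: sqrtr_ge0. Qed.
Let sqT2 : sqT ^+ 2 = Th. Proof. exact: sqr_sqrtr. Qed.

(** The local perturbation terms carry L Th^(1/2), whereas the smallness of [eta] is measured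
    against [K]. *)
Let LT_le : 4 * (L * sqT) <= K.
Proof. by rewrite /K -sqT2; have := sqr_ge0 (L * sqT - 2 / 3); nra. Qed.

Let kge0 : 0 <= k. Proof. exact: ltW. Qed.
Let Lge0 : 0 <= L. Proof. exact: le_trans L1. Qed.
Let Kgt0 : 0 < K. Proof. exact: lt_le_trans K2. Qed.

Let sig0 : 0 <= sig.
Proof. by rewrite /sig; do 3 apply: mulr_ge0 => //. Qed.

Let Ksig0 : 0 <= K * sig. Proof. exact: mulr_ge0 (ltW Kgt0) _. Qed.
Let LKeta0 : 0 <= L * K * eta.
Proof. by apply: mulr_ge0 => //; apply: mulr_ge0 => //; exact: ltW. Qed.

Let sig_le : sig <= 1 / 16.
Proof. by have := ler_wpM2r sig0 K2; move: s1; rewrite -mulrA; lra. Qed.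

Let eta_le : eta <= 1 / 24.
Proof.
have h : 2 * eta <= K * eta by exact: ler_wpM2r.
have h2 : K * eta <= L * (K * eta) by rewrite ler_peMl// mulr_ge0// (le_trans _ K2).
move: t1; rewrite -!mulrA; lra.
Qed.

Lemma local_form_eq i x y : in_range (E i) x -> bf D x y = bf (Dl i) x y.
Proof. by move=> Wx; rewrite DE DlE (locA _ Wx) (locS _ Wx). Qed.

Let BlE i x y : in_range (E i) x -> bf B x y = bf (Al i - k ^+ 2 *: Sl i) x y.
Proof. by move=> Wx; rewrite BE (locA _ Wx) (locS _ Wx) bfDM bfNM bfZM. Qed.

Let fried i x : in_range (E i) x -> k ^+ 2 * bf S x x <= eta ^+ 2 * bf D x x.
Proof.
move=> Wx; apply: le_trans (friedrichs Wx) _; apply: ler_wpM2l; first exact: sqr_ge0.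
by rewrite DE lerDl mulr_ge0 ?sqr_ge0//; exact: pS.2.
Qed.

Lemma overlap_D x : \sum_i bf (Dl i) x x <= L * bf D x x.
Proof.
under eq_bigr do rewrite DlE; rewrite big_split/= -mulr_sumr DE mulrDr lerD//.
by rewrite mulrCA; apply: ler_wpM2l; [exact: sqr_ge0|exact: ovS].
Qed.

(** The sum y is tested against itself: D(z_i, y) sees only subdomain i, and Young with weight L
    produces L^-1 times the local energies of y, whose sum is at most D(y, y) and is absorbed. *)
Lemma overlap_sum (z : 'I_N -> 'cV[R]_n) : (forall i, in_range (E i) (z i)) ->
  bf D (\sum_i z i) (\sum_i z i) <= L * \sum_i bf D (z i) (z i).
Proof.
move=> Wz; set y := \sum_i z i; have L0 : 0 < L by exact: lt_le_trans L1.
have Hi i : 2 * bf D (z i) y <= L * bf D (z i) (z i) + L^-1 * bf (Dl i) y y.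
  rewrite !(local_form_eq _ (Wz i)); have := bf_young (z i) y (pDl i) L0; lra.
have : \sum_i 2 * bf D (z i) y <= \sum_i (L * bf D (z i) (z i) + L^-1 * bf (Dl i) y y).
  by apply: ler_sum => i _; exact: Hi.
rewrite -mulr_sumr -bf_suml -/y big_split/= -!mulr_sumr.
have := ler_wpM2l (ltW (_ : 0 < L^-1)) (overlap_D y); rewrite invr_gt0 mulKf ?gt_eqF// => /(_ L0).
set a := bf D y y; set b := _ * \sum_i bf (Dl i) _ _; set c := _ * \sum_i _; lra.
Qed.

Lemma split_bounds x z : (forall i, in_range (E i) (z i)) ->
  (forall i, bf D (z i) (z i) <= Th * bf (Al i) x x) ->
  \sum_i bf D (z i) (z i) <= L * Th * bf D x x /\
  bf D (\sum_i z i) (\sum_i z i) <= L ^+ 2 * Th * bf D x x.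
Proof.
move=> Wz Hz; have L0 : 0 <= L by exact: le_trans L1.
have h : \sum_i bf D (z i) (z i) <= L * Th * bf D x x.
  apply: (@le_trans _ _ (\sum_i Th * bf (Al i) x x)); first by apply: ler_sum.
  rewrite -mulr_sumr [L * Th]mulrC -mulrA; apply: ler_wpM2l => //.
  apply: le_trans (ovA x) _; apply: ler_wpM2l => //.
  by rewrite DE lerDl mulr_ge0 ?sqr_ge0//; exact: pS.2.
split=> //; apply: le_trans (overlap_sum Wz) _.
by rewrite expr2 -!mulrA; apply: ler_wpM2l => //; rewrite mulrA.
Qed.

(* Duality (Schatz) argument: the error of a Galerkin projection on the coarse
   space is small in the weak norm. *)
Lemma coarse_duality e : (forall v, in_range E0 v -> bf B e v = 0) ->
  k * nrm S e <= sig * nrm D e.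
Proof.
move=> He; have [w [Hw Nw]] := dual e.
have [z [Wz Vz Hz]] := split w; have [_ h2] := split_bounds Wz Hz.
(* By symmetry of [B] and orthogonality of [e], the coarse component of the dual solution [w] drops
   out. *)
have e2 : nrm S e ^+ 2 = bf B e (\sum_i z i).
  rewrite sqr_nrm// -Hw (bfC _ _ sB) -[w](subrK (\sum_i z i)) bfDr (He _ Vz).
  by rewrite add0r.
have hz : nrm D (\sum_i z i) <= L * sqT * nrm D w.
  apply: ler_of_sqr; first by rewrite !mulr_ge0 ?nrm_ge0// (le_trans ler01).
  by rewrite !exprMn !sqr_nrm// sqT2.
have L0 : 0 <= L by exact: le_trans L1.
have hb : nrm S e ^+ 2 <= nrm D e * (L * sqT * (C * nrm S e)).
  rewrite e2; apply: le_trans (ler_norm _) _.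
  apply: le_trans (bf_sub_cauchy_schwarz _ _ pA pkS) _.
  apply: ler_wpM2l; first exact: nrm_ge0.
  by apply: le_trans hz _; apply: ler_wpM2l; first exact: mulr_ge0.
have [->|ne] := eqVneq (nrm S e) 0; first by rewrite mulr0 mulr_ge0// nrm_ge0.
have pe : 0 < nrm S e by rewrite lt_neqAle eq_sym ne nrm_ge0.
rewrite -(ler_pM2r pe) -mulrA -expr2.
have := ler_wpM2l (ltW k0) hb; rewrite /sig -/sqT.
by congr (_ <= _); ring.
Qed.

(** A coarse vector x in the kernel is orthogonal to the coarse space, itself included: D(x, x) is
    then twice its k^2-term, which duality bounds by a small multiple of D(x, x). In [local_unit]
    the Friedrichs inequality takes the place of duality. *)
Lemma coarse_unit : E0^T *m B *m E0 \in unitmx.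
Proof.
apply: galerkin_unit => // x Vx Hx; apply: posD.
have := coarse_duality Hx; have := Hx x Vx; rewrite BDE => e0 hd.
have hk : k ^+ 2 * bf S x x <= sig ^+ 2 * bf D x x.
  by rewrite -!sqr_nrm// -!exprMn; apply: ler_sqr_of => //; apply: mulr_ge0 => //; exact: nrm_ge0.
have d0 := pD.2 x; have : sig ^+ 2 * bf D x x <= 1 / 256 * bf D x x.
  by apply: ler_wpM2r => //; move: sig0 sig_le eta0 eta_le; nra.
by move=> h; apply/eqP; rewrite eq_le d0 andbT; lra.
Qed.

Lemma local_unit i : (E i)^T *m B *m E i \in unitmx.
Proof.
apply: galerkin_unit => [|x Wx Hx]; [exact: injE|apply: posD].
have := Hx x Wx; rewrite BDE => e0; have hk := fried Wx.
have d0 := pD.2 x; have : eta ^+ 2 * bf D x x <= 1 / 576 * bf D x x.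
  by apply: ler_wpM2r => //; move: sig0 sig_le eta0 eta_le; nra.
by move=> h; apply/eqP; rewrite eq_le d0 andbT; lra.
Qed.

Let T0 := galerkin B E0.
Let T i := galerkin B (E i).

Let T0E x z : in_range E0 z -> bf B (T0 *m x) z = bf B x z.
Proof. by apply: galerkinE; exact: coarse_unit. Qed.

Let TE i x z : in_range (E i) z -> bf B (T i *m x) z = bf B x z.
Proof. by apply: galerkinE; exact: local_unit. Qed.

Let WT i x : in_range (E i) (T i *m x). Proof. exact: galerkin_range. Qed.
Let VT x : in_range E0 (T0 *m x). Proof. exact: galerkin_range. Qed.

Let e0 (x : 'cV[R]_n) := x - T0 *m x.

(** The error is orthogonal to T_0 x, so its energy is B(x, e0 x) plus twice its k^2-term, and
    duality makes the latter small. *)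
Lemma coarse_error x : nrm D (e0 x) <= 65 / 64 * nrm D x /\
  k * nrm S (e0 x) <= 65 / 64 * sig * nrm D x.
Proof.
have He v : in_range E0 v -> bf B (e0 x) v = 0.
  by move=> Vv; rewrite bfDl bfNl T0E// subrr.
have hd := coarse_duality He.
have eq1 : bf D (e0 x) (e0 x) = bf B x (e0 x) + 2 * (k * nrm S (e0 x)) ^+ 2.
  have : bf B (e0 x) (e0 x) = bf B x (e0 x).
    by rewrite {1}/e0 bfDl bfNl (bfC (T0 *m x) _ sB) (He _ (VT x)) subr0.
  by rewrite BDE exprMn sqr_nrm// => <-; ring.
have h1 : bf B x (e0 x) <= nrm D x * nrm D (e0 x).
  by apply: le_trans (ler_norm _) _; exact: bf_sub_cauchy_schwarz.
have ne0 := nrm_ge0 D (e0 x).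
have h2 : (k * nrm S (e0 x)) ^+ 2 <= 1 / 256 * nrm D (e0 x) ^+ 2.
  apply: (@le_trans _ _ ((sig * nrm D (e0 x)) ^+ 2)).
    by apply: ler_sqr_of => //; apply: mulr_ge0 => //; exact: nrm_ge0.
  by rewrite exprMn; apply: ler_wpM2r; [exact: sqr_ge0|move: sig0 sig_le; nra].
have hN : nrm D (e0 x) <= 65 / 64 * nrm D x.
  apply: (stability_of_energy (c := bf B x (e0 x)) _ _ _ _ h2); rewrite ?nrm_ge0//.
    by rewrite sqr_nrm//; exact: eq1.
  by rewrite mulrC.
split => //; apply: le_trans hd _.
rewrite (_ : 65 / 64 * sig * nrm D x = sig * (65 / 64 * nrm D x)); last by ring.
exact: ler_wpM2l.
Qed.

(** The bound is by the energy of [x] on the subdomain, so that summation over i costs only the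
    overlap. It holds because B(T_i x, x) sees nothing of [x] outside the subdomain. *)
Lemma local_stability i x : nrm D (T i *m x) <= 65 / 64 * nrm (Dl i) x.
Proof.
set v := T i *m x; have Wv : in_range (E i) v by exact: WT.
have eq1 : bf D v v = bf B v x + 2 * (k ^+ 2 * bf S v v).
  have := TE x Wv; rewrite -/v BDE (bfC x v sB) => <-; ring.
have h1 : bf B v x <= nrm D v * nrm (Dl i) x.
  rewrite (BlE _ Wv); apply: le_trans (ler_norm _) _.
  apply: le_trans (bf_sub_cauchy_schwarz _ _ (pAl i) (pkSl i)) _.
  by rewrite -/(Dl i) {1}/nrm -local_form_eq.
have h2 := fried Wv.
apply: (stability_of_energy (s := k ^+ 2 * bf S v v) _ _ _ h1); rewrite ?sqr_nrm ?nrm_ge0//.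
apply: le_trans h2 _; apply: ler_wpM2r; first exact: pD.2.
by move: eta0 eta_le; nra.
Qed.

Let sl i x := k * nrm (Sl i) x.

Let sl_le i x : sl i x <= nrm (Dl i) x.
Proof.
apply: ler_of_sqr; first exact: nrm_ge0.
by rewrite exprMn !sqr_nrm// DlE lerDr; exact: (pAl i).2.
Qed.

Let sl_loc i x : in_range (E i) x -> sl i x <= eta * nrm D x.
Proof.
move=> Wx; apply: ler_of_sqr; first by rewrite mulr_ge0 ?nrm_ge0.
by rewrite /sl !exprMn !sqr_nrm// -(locS _ Wx); exact: (fried Wx).
Qed.

(** The factor 17/16 leaves room for 1 + (1/24)(65/64), from eta <= 1/24. *)
Let sl_err i x : sl i (x - T i *m x) <= 17 / 16 * nrm (Dl i) x.
Proof.
apply: (@le_trans _ _ (sl i x + sl i (T i *m x))).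
  by rewrite /sl -mulrDr ler_pM2l// -[nrm _ (T i *m x)]nrmN; exact: ler_nrmD.
have h1 := sl_le i x; have h2 := sl_loc (WT i x); have h3 := local_stability i x.
have h4 : eta * nrm D (T i *m x) <= 1 / 24 * (65 / 64 * nrm (Dl i) x).
  by apply: ler_pM => //; exact: nrm_ge0.
have := nrm_ge0 (Dl i) x; lra.
Qed.

(* [x] is tested against its stable splitting. *)
Lemma splitting_upper x : bf D x x * (1 - 25 / 8 * (K * sig) - 17 / 16 * (L * K * eta)) <=
  K * (bf D (T0 *m x) (T0 *m x) + \sum_i bf D (T i *m x) (T i *m x)).
Proof.
have [z [Wz Vz Hz]] := split x; have [hz1 hz2] := split_bounds Wz Hz.
set z0 := x - \sum_i z i in Vz.
have L0 : 0 <= L by exact: le_trans L1.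
have U0 := pD.2 x; have K0 : 0 < K by exact: lt_le_trans K2.
have hz0 : bf D z0 z0 <= 2 * bf D x x + 2 * (L ^+ 2 * Th * bf D x x).
  have := pD.2 (x + 1 *: \sum_i z i); have e : z0 = x + (-1) *: \sum_i z i by rewrite scaleN1r.
  rewrite e !bf_quadratic ?pD.1//; lra.
have hzs : bf D z0 z0 + \sum_i bf D (z i) (z i) <= K * bf D x x.
  have h : L * Th * bf D x x <= L ^+ 2 * Th * bf D x x.
    by do 2 apply: ler_wpM2r => //; rewrite expr2 ler_peMl.
  rewrite /K; lra.
have xE : bf D x x = bf D x z0 + \sum_i bf D x (z i).
  by rewrite -bf_sumr -bfDr /z0 subrK.
(* With weight [K], the terms in the splitting add up to at most D(x, x)/2 by [hzs] and are absorbed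
   on the left. *)
have young (a b : 'cV_n) : bf D a b <= 2^-1 * (K * bf D a a + K^-1 * bf D b b).
  exact: bf_young.
have b0 : bf D x z0 <= 2^-1 * (K * bf D (T0 *m x) (T0 *m x) + K^-1 * bf D z0 z0) +
    25 / 16 * (K * sig) * bf D x x.
  have -> : bf D x z0 = bf D (T0 *m x) z0 + 2 * (k ^+ 2 * bf S (e0 x) z0).
    have := T0E x Vz; rewrite !BDE bfDl bfNl => h; lra.
  apply: lerD; first exact: young.
  have [_ he] := coarse_error x.
  (* The square root of K is at most 3K/4, because K >= 2 > 16/9. *)
  have hkz : k * nrm S z0 <= 3 / 4 * K * nrm D x.
    apply: ler_of_sqr; first by rewrite !mulr_ge0 ?nrm_ge0// ltW.
    rewrite !exprMn !sqr_nrm//; apply: le_trans (kS_le z0) _.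
    have : 0 <= \sum_i bf D (z i) (z i) by apply: sumr_ge0 => i _; exact: pD.2.
    have h9 (t : R) : 2 <= t -> t <= 9 / 16 * t ^+ 2 by move=> ?; nra.
    have := ler_wpM2r U0 (h9 _ K2).
    rewrite (_ : 3 ^+ 2 * 4^-1 ^+ 2 = 9 / 16); last by field.
    lra.
  have hcs : k ^+ 2 * bf S (e0 x) z0 <= (k * nrm S (e0 x)) * (k * nrm S z0).
    have := ler_wpM2l (sqr_ge0 k) (le_trans (ler_norm _) (bf_cauchy_schwarz (e0 x) z0 pS)).
    by congr (_ <= _); ring.
  have := ler_pM (mulr_ge0 (ltW k0) (nrm_ge0 S _)) (mulr_ge0 (ltW k0) (nrm_ge0 S _)) he hkz.
  rewrite (_ : 65 / 64 * sig * nrm D x * (3 / 4 * K * nrm D x) = 195 / 256 * (K * sig * nrm D x ^+ 2)); last by field.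
  rewrite sqr_nrm//; have : 0 <= K * sig * bf D x x by rewrite !mulr_ge0// ltW.
  rewrite -[25 / 16 * _ * _]mulrA; lra.
have bi i : bf D x (z i) <= 2^-1 * (K * bf D (T i *m x) (T i *m x) + K^-1 * bf D (z i) (z i)) +
    17 / 8 * (eta * sqT) * bf (Dl i) x x.
  have -> : bf D x (z i) = bf D (T i *m x) (z i) + 2 * (k ^+ 2 * bf (Sl i) (x - T i *m x) (z i)).
    rewrite (bfC _ _ (pSl i).1) -locS// (bfC _ _ pS.1).
    have := TE x (Wz i); rewrite !BDE bfDl bfNl => h; lra.
  apply: lerD; first exact: young.
  have hzi : nrm D (z i) <= sqT * nrm (Dl i) x.
    apply: ler_of_sqr; first by rewrite mulr_ge0 ?nrm_ge0.
    rewrite !exprMn !sqr_nrm// sqT2; apply: le_trans (Hz i) _; apply: ler_wpM2l => //.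
    by rewrite DlE lerDl mulr_ge0 ?sqr_ge0//; exact: (pSl i).2.
  have hsz : sl i (z i) <= eta * (sqT * nrm (Dl i) x).
    by apply: le_trans (sl_loc (Wz i)) _; exact: ler_wpM2l.
  have hcs : k ^+ 2 * bf (Sl i) (x - T i *m x) (z i) <= sl i (x - T i *m x) * sl i (z i).
    have := ler_wpM2l (sqr_ge0 k) (le_trans (ler_norm _) (bf_cauchy_schwarz (x - T i *m x) (z i) (pSl i))).
    by rewrite /sl; congr (_ <= _); ring.
  have := ler_pM (mulr_ge0 (ltW k0) (nrm_ge0 _ _)) (mulr_ge0 (ltW k0) (nrm_ge0 _ _)) (sl_err i x) hsz.
  rewrite -[k * nrm _ _]/(sl i (x - T i *m x)) -[k * nrm _ (z i)]/(sl i (z i)) -sqr_nrm//.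
  set a := nrm (Dl i) x; rewrite (_ : 17 / 16 * a * (eta * (sqT * a)) = 17 / 16 * (eta * sqT * a ^+ 2)); last by ring.
  rewrite -[17 / 8 * _ * _]mulrA; lra.
have bs : \sum_i bf D x (z i) <= 2^-1 * (K * \sum_i bf D (T i *m x) (T i *m x) +
    K^-1 * \sum_i bf D (z i) (z i)) + 17 / 32 * (L * K * eta) * bf D x x.
  apply: (@le_trans _ _ (\sum_i (2^-1 * (K * bf D (T i *m x) (T i *m x) + K^-1 * bf D (z i) (z i)) +
    17 / 8 * (eta * sqT) * bf (Dl i) x x))); first by apply: ler_sum.
  rewrite big_split/= -!mulr_sumr big_split/= -!mulr_sumr lerD2l.
  have h1 := overlap_D x; have es : 0 <= 17 / 8 * (eta * sqT) by rewrite !mulr_ge0.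
  apply: le_trans (ler_wpM2l es h1) _.
  rewrite mulrA; apply: ler_wpM2r => //.
  have h2 := ler_wpM2l eta0 LT_le; have : K * eta <= L * (K * eta) by rewrite ler_peMl// mulr_ge0// ltW.
  rewrite -!mulrA [sqT * L]mulrC; lra.
have hKi : K^-1 * (bf D z0 z0 + \sum_i bf D (z i) (z i)) <= bf D x x.
  by rewrite ler_pdivrMl.
move: hKi b0 bs; rewrite !mulrDr xE.
move: xE; set U := bf D x x.
move: (bf D x z0) (\sum_i bf D x (z i)) => a b xE.
move: (K^-1 * _) (K^-1 * _) (K * bf D _ _) (K * \sum_i _) => p q s t.
rewrite -!xE => ? ? ?; lra.
Qed.

(** If T were orthogonal for D, then D(Tx, Tx) would equal D(Tx, x). For a projection orthogonal for
    B the two differ by 2 k^2 S(Tx, x - Tx), small by duality for T_0 and by Friedrichs for the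
    T_i. *)
Lemma schwarz_lower_local x :
  bf D (T0 *m x) (T0 *m x) + \sum_i bf D (T i *m x) (T i *m x) <=
  bf D (T0 *m x) x + \sum_i bf D (T i *m x) x + 9 / 4 * (sig + L * eta) * bf D x x.
Proof.
have U0 := pD.2 x.
have c0 : bf D (T0 *m x) (T0 *m x) <= bf D (T0 *m x) x + 9 / 4 * sig * bf D x x.
  have eq1 : bf D (T0 *m x) x = bf D (T0 *m x) (T0 *m x) + 2 * (k ^+ 2 * bf S (T0 *m x) (e0 x)).
    have := T0E x (VT x); rewrite (bfC x _ sB) !BDE /e0 bfDr bfNr => h; lra.
  have [hN he] := coarse_error x.
  (* The constant is 1 + (65/64)(1/16), from T_0 x = x - e0 x and sigma <= 1/16. *)
  have hk : k * nrm S (T0 *m x) <= 1089 / 1024 * nrm D x.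
    have : nrm S (T0 *m x) <= nrm S x + nrm S (e0 x).
      have -> : T0 *m x = x + - e0 x by rewrite /e0 opprB addrC subrK.
      by rewrite -[nrm S (e0 x)]nrmN; exact: ler_nrmD.
    move/(ler_wpM2l (ltW k0)); rewrite mulrDr => h.
    have : k * nrm S x <= nrm D x.
      by apply: ler_of_sqr; [exact: nrm_ge0|rewrite exprMn !sqr_nrm].
    have : 65 / 64 * sig * nrm D x <= 65 / 64 * (1 / 16) * nrm D x.
      by apply: ler_wpM2r; [exact: nrm_ge0|move: sig_le; lra].
    lra.
  have hcs : - (k ^+ 2 * bf S (T0 *m x) (e0 x)) <= (k * nrm S (T0 *m x)) * (k * nrm S (e0 x)).
    have h := lerNnormlW (bf_cauchy_schwarz (T0 *m x) (e0 x) pS).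
    have := ler_wpM2l (sqr_ge0 k) h; rewrite [X in _ -> _ <= X](_ : _ = k ^+ 2 * (nrm S (T0 *m x) * nrm S (e0 x))); last by ring.
    lra.
  have := ler_pM (mulr_ge0 (ltW k0) (nrm_ge0 S _)) (mulr_ge0 (ltW k0) (nrm_ge0 S _)) hk he.
  rewrite (_ : _ * nrm D x * _ = 1089 / 1024 * (65 / 64) * (sig * nrm D x ^+ 2)); last by ring.
  rewrite sqr_nrm//; have : 0 <= sig * bf D x x by rewrite mulr_ge0.
  rewrite -[9 / 4 * _ * _]mulrA; lra.
have ci i : bf D (T i *m x) (T i *m x) <= bf D (T i *m x) x + 9 / 4 * eta * bf (Dl i) x x.
  have eq1 : bf D (T i *m x) x = bf D (T i *m x) (T i *m x) + 2 * (k ^+ 2 * bf (Sl i) (T i *m x) (x - T i *m x)).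
    rewrite -(locS _ (WT i x)).
    have := TE x (WT i x); rewrite (bfC x _ sB) !BDE bfDr bfNr => h; lra.
  have hk : sl i (T i *m x) <= eta * (65 / 64 * nrm (Dl i) x).
    by apply: le_trans (sl_loc (WT i x)) _; apply: ler_wpM2l => //; exact: local_stability.
  have hcs : - (k ^+ 2 * bf (Sl i) (T i *m x) (x - T i *m x)) <= sl i (T i *m x) * sl i (x - T i *m x).
    have h := lerNnormlW (bf_cauchy_schwarz (T i *m x) (x - T i *m x) (pSl i)).
    have := ler_wpM2l (sqr_ge0 k) h; rewrite [X in _ -> _ <= X](_ : _ = k ^+ 2 * (nrm (Sl i) (T i *m x) * nrm (Sl i) (x - T i *m x))); last by rewrite /sl; ring.
    lra.
  have := ler_pM (mulr_ge0 (ltW k0) (nrm_ge0 _ _)) (mulr_ge0 (ltW k0) (nrm_ge0 _ _)) hk (sl_err i x).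
  rewrite -[k * nrm _ (T i *m x)]/(sl i (T i *m x)) -[k * nrm _ (x - _)]/(sl i (x - T i *m x)).
  rewrite (_ : eta * _ * _ = 65 / 64 * (17 / 16) * (eta * nrm (Dl i) x ^+ 2)); last by ring.
  rewrite sqr_nrm//; have : 0 <= eta * bf (Dl i) x x by rewrite mulr_ge0//; exact: (pDl i).2.
  rewrite -[9 / 4 * _ * _]mulrA; lra.
have cs : \sum_i bf D (T i *m x) (T i *m x) <= \sum_i bf D (T i *m x) x + 9 / 4 * (L * eta) * bf D x x.
  apply: (@le_trans _ _ (\sum_i (bf D (T i *m x) x + 9 / 4 * eta * bf (Dl i) x x)));
    first by apply: ler_sum.
  rewrite big_split/= -mulr_sumr lerD2l [L * eta]mulrC mulrA -[X in _ <= X]mulrA.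
  by apply: ler_wpM2l; [rewrite mulr_ge0|exact: overlap_D].
lra.
Qed.

Let P := T0 + \sum_i T i.

Lemma schwarz_lower x : (1 - Num.max (8 * K * sig) (12 * L * K * eta)) / K * bf D x x <= bf D x (P *m x).
Proof.
have K0 : 0 < K by exact: lt_le_trans K2.
rewrite (bfC _ _ pD.1) mulmxDl mulmx_suml bfDl bf_suml.
have h1 := splitting_upper x; have h2 := schwarz_lower_local x.
have h3 := ler_wpM2l (ltW K0) h2; have U0 := pD.2 x.
rewrite mulrAC ler_pdivrMr// [X in _ <= X]mulrC.
(* 25/8 + 9/4 = 43/8 and 17/16 + 9/4 = 53/16. Relative to the two entries of the maximum these are
   the weights 43/64 and 53/192, whose sum is below 1. *)
apply: le_trans (_ : bf D x x * (1 - 43 / 8 * (K * sig) - 53 / 16 * (L * K * eta)) <= _).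
  rewrite [X in X <= _]mulrC; apply: ler_wpM2l => //.
  have m1 : 8 * K * sig <= Num.max (8 * K * sig) (12 * L * K * eta) by rewrite le_max lexx.
  have m2 : 12 * L * K * eta <= Num.max (8 * K * sig) (12 * L * K * eta) by rewrite le_max lexx orbT.
  have p1 := Ksig0; have p2 := LKeta0.
  move: m1 m2 p1 p2; rewrite -!mulrA; move: (Num.max _ _) => M; lra.
move: h1 h3; set U := bf D x x.
move: (bf D (T0 *m x) (T0 *m x) + _) (bf D (T0 *m x) x + _) => p q.
move: (K) (sig) (L) (eta) U p q => a b c e u p q; lra.
Qed.

(** 18 = 2 * 3^2, as T_0 has norm at most 3, and 8 L^2 = 2 * L * 2^2 * L: each T_i has local norm at
    most 2, and the overlap is paid once for the sum of the T_i x and once for the local energies of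
    x. *)
Lemma schwarz_upper x : bf D (P *m x) (P *m x) <= (18 + 8 * L ^+ 2) * bf D x x.
Proof.
rewrite mulmxDl mulmx_suml; have U0 := pD.2 x.
set a := T0 *m x; set b := \sum_i T i *m x.
have ha : bf D a a <= 9 * bf D x x.
  have [hN _] := coarse_error x.
  have h : nrm D a <= 3 * nrm D x.
    have -> : a = x + - e0 x by rewrite /e0 opprB addrC subrK.
    apply: le_trans (ler_nrmD _ _ pD) _; rewrite nrmN; have := nrm_ge0 D x; lra.
  rewrite -!sqr_nrm// (_ : 9 = 3 ^+ 2); last by ring.
  by rewrite -exprMn ler_pXn2r// nnegrE ?mulr_ge0 ?nrm_ge0.
have hb : bf D b b <= 4 * L ^+ 2 * bf D x x.
  apply: le_trans (overlap_sum (fun i => WT i x)) _.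
  have L0 : 0 <= L by exact: le_trans L1.
  have : \sum_i bf D (T i *m x) (T i *m x) <= \sum_i 4 * bf (Dl i) x x.
    apply: ler_sum => i _; rewrite -!sqr_nrm// (_ : 4 = 2 ^+ 2); last by ring.
    rewrite -exprMn ler_pXn2r// ?nnegrE ?mulr_ge0 ?nrm_ge0//.
    have := local_stability i x; have := nrm_ge0 (Dl i) x; lra.
  rewrite -mulr_sumr => h; apply: le_trans (ler_wpM2l L0 h) _.
  have := ler_wpM2l L0 (overlap_D x); set s := \sum_i _; set U := bf D x x.
  move: (L) s U => l a' b'; lra.
have := pD.2 (a + (-1) *: b); have e : a + b = a + 1 *: b by rewrite scale1r.
rewrite e !bf_quadratic ?pD.1//; lra.
Qed.

Theorem two_level_gmres g u : gmres D P g u -> forall j,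
  energy_norm D (g - P *m u j) ^+ 2 <=
   (1 - ((1 - Num.max (8 * K * sig) (12 * L * K * eta)) / K) ^+ 2 / (18 + 8 * L ^+ 2) ^+ 2) ^+ j
   * energy_norm D (g - P *m u 0%N) ^+ 2.
Proof.
have K0 : 0 < K by exact: lt_le_trans K2.
have c20 : 1 <= 18 + 8 * L ^+ 2 by have := sqr_ge0 L; lra.
have m0 : 0 <= Num.max (8 * K * sig) (12 * L * K * eta) by rewrite le_max -mulrA mulr_ge0.
have m1 : Num.max (8 * K * sig) (12 * L * K * eta) < 1 by rewrite gt_max s1.
apply: gmres_residual => //.
- by apply: divr_ge0; [move: m1; lra|exact: ltW].
- apply: le_trans c20; rewrite ler_pdivrMr// mul1r; move: m0 K2; lra.
- exact: lt_le_trans c20.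
- exact: schwarz_lower.
- move=> x; apply: le_trans (schwarz_upper x) _; apply: ler_wpM2r; first exact: pD.2.
  by rewrite expr2 ler_peMl// (le_trans _ c20).
Qed.

End two_level_schwarz.

(** * Simplices and meshes *)

Section finite_element_geometry.
Context {R : realType} (d : nat).
Local Notation V := 'rV[R]_d.
Local Notation leb := (lebesgue_rV R d).

Lemma negligible_bigcup_count (I : countType) (P : set I) (F : I -> set V) :
  (forall i, P i -> leb.-negligible (F i)) -> leb.-negligible (\bigcup_(i in P) F i).
Proof.
move=> HF; apply: (@negligibleS _ _ _ _
  (\bigcup_n (if unpickle n is Some q then if `[< P q >] then F q else set0 else set0))).
  by move=> x [i Pi Fx]; exists (pickle i) => //; rewrite pickleK asboolT.
apply: negligible_bigcup => n; case: unpickle => [i|]; last exact: negligible_set0.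
by case: asboolP => Pi; [exact: HF|exact: negligible_set0].
Qed.

(** There are d points and d + 1 unknowns: the rows (v_j, -1) annihilate a common nonzero vector (c,
    al). *)
Lemma points_in_hyperplane (v : 'I_d -> V) : (0 < d)%N ->
  exists (c : 'I_d -> R) (al : R) (i0 : 'I_d), c i0 != 0 /\
    forall j, \sum_i c i * v j ord0 i = al.
Proof.
move=> d0; pose M : 'M[R]_(d, d + 1) := \matrix_j row_mx (v j) (- 1%:M).
have [i Hi] : exists i, row i (kermx M^T) != 0.
  apply: contrapT => H; have : kermx M^T = 0.
    apply/row_matrixP => i; rewrite row0; apply/eqP; apply: contrapT => /negP Hi.
    by apply: H; exists i.
  move/eqP; rewrite kermx_eq0 /row_free mxrank_tr => /eqP rM.
  by have := rank_leq_row M; rewrite rM addn1 ltnn.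
set w := row i _ in Hi; have Mw : w *m M^T = 0.
  by rewrite /w -row_mul mulmx_ker row0.
pose c k := w ord0 (lshift 1 k); pose al := w ord0 (rshift d ord0).
have E j : \sum_k c k * v j ord0 k = al.
  have ML k : M^T (lshift 1 k) j = v j ord0 k by rewrite mxE mxE row_mxEl.
  have MR : M^T (rshift d ord0) j = -1 by rewrite mxE mxE row_mxEr !mxE eqxx.
  have := congr1 (fun B : 'rV_d => B ord0 j) Mw; rewrite mxE [RHS]mxE big_split_ord /= big_ord1.
  under eq_bigr do rewrite ML.
  by rewrite MR -/al mulrN1 => /eqP; rewrite subr_eq0 => /eqP.
(* If all of [c] vanished, the equation at any one point would give [al] = 0 as well. *)
have [k ck] : exists k, c k != 0.
  apply: contrapT => H; have c0 k : c k = 0.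
    by apply/eqP; apply: contrapT => /negP ck; apply: H; exists k.
  have al0 : al = 0 by rewrite -(E (Ordinal d0)) big1// => k _; rewrite c0 mul0r.
  case/negP: Hi; apply/eqP/rowP => k; rewrite [RHS]mxE -[k]splitK.
  by case: (fintype.split k) => l /=; [exact: c0|rewrite (ord1 l); exact: al0].
by exists c, al, k.
Qed.

Lemma negligible_affine_hull (v : 'I_d -> V) : (0 < d)%N ->
  leb.-negligible [set x | exists w : 'I_d -> R, \sum_i w i = 1 /\ x = \sum_i w i *: v i].
Proof.
move=> d0; have [c [al [i0 [ci0 E]]]] := points_in_hyperplane v d0.
exists [set x : V | \sum_i c i * x ord0 i = al]; split.
- rewrite -[X in measurable X]setTI.
  rewrite (_ : [set x | _] = (fun x : V => \sum_i c i * x ord0 i) @^-1` [set al])//.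
  apply: measurable_sum => // i; apply: measurable_funM => //.
  exact: measurable_rV_coord.
- exact: lebesgue_rV_hyperplane ci0.
- move=> x [w [w1 ->]] /=; under eq_bigr do rewrite summxE mulr_sumr.
  rewrite exchange_big /= -[RHS]mul1r -w1 mulr_suml; apply: eq_bigr => j _.
  by rewrite -(E j) mulr_sumr; apply: eq_bigr => i _; rewrite mxE mulrCA.
Qed.

Lemma negligible_simplex (v : 'I_d -> V) : (0 < d)%N -> leb.-negligible (simplex v).
Proof.
move=> d0; apply: negligibleS (negligible_affine_hull v d0).
by move=> x [w [_ w1 _ ->]]; exists w.
Qed.

Lemma negligible_facet (v : 'I_d.+1 -> V) i : (0 < d)%N ->
  leb.-negligible (face v (predC1 i)).
Proof.
move=> d0; apply: negligibleS (negligible_affine_hull (v \o lift i) d0).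
move=> x [w [_ w1 wi ->]]; have wi0 : w i = 0 by apply: wi; rewrite /= eqxx.
by exists (w \o lift i); rewrite /= -w1 !(bigD1_ord i)//= wi0 scale0r !add0r.
Qed.

Section barycentric.
Context (v : 'I_d.+1 -> V) (av : affinely_independent v).

(** Homogeneous coordinates, with the 1 in the last place: [hom x] times the inverse of [P] is the
    row of barycentric coordinates of x. *)
Let hom (x : V) : 'rV[R]_d.+1 :=
  \row_j (if unlift ord_max j is Some k then x ord0 k else 1).
Let P : 'M[R]_d.+1 := \matrix_i hom (v i).

Let homE (w : 'rV[R]_d.+1) (x : V) : w *m P = hom x <->
  \sum_i w ord0 i = 1 /\ \sum_i w ord0 i *: v i = x.
Proof.
split=> [E|[w1 <-]].
  split.
    have := congr1 (fun B : 'rV_d.+1 => B ord0 ord_max) E.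
    rewrite !mxE unlift_none => <-; apply: eq_bigr => i _.
    by rewrite !mxE unlift_none mulr1.
  apply/rowP => k; have := congr1 (fun B : 'rV_d.+1 => B ord0 (lift ord_max k)) E.
  rewrite !mxE liftK => <-; rewrite summxE; apply: eq_bigr => i _.
  by rewrite !mxE liftK.
apply/rowP => j; rewrite !mxE; case: unliftP => [k ->|->].
  by rewrite summxE; apply: eq_bigr => i _; rewrite !mxE liftK.
by rewrite -w1; apply: eq_bigr => i _; rewrite !mxE unlift_none mulr1.
Qed.

Let uP : P \in unitmx.
Proof.
rewrite -unitmx_tr; apply: unitmx_inj => x Px.
have E : x^T *m P = 0 by apply: trmx_inj; rewrite trmx_mul trmxK trmx0.
have EP j : \sum_i x i ord0 * P i j = 0.
  transitivity ((x^T *m P) ord0 j); last by rewrite E mxE.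
  by rewrite [RHS]mxE; apply: eq_bigr => i _; rewrite [in RHS]mxE.
apply/colP => i; rewrite [RHS]mxE; apply: (av (w := fun i => x i ord0)).
  by rewrite -[RHS](EP ord_max); apply: eq_bigr => j _; rewrite !mxE unlift_none mulr1.
apply/rowP => k; rewrite [RHS]mxE -(EP (lift ord_max k)) summxE; apply: eq_bigr => j _.
by rewrite !mxE liftK.
Qed.

(** Barycentric coordinates are affine, hence continuous, so their positivity persists near the
    point. *)
Lemma simplex_interior (w : 'I_d.+1 -> R) : (forall i, 0 < w i) -> \sum_i w i = 1 ->
  ((simplex v)°)%classic (\sum_i w i *: v i).
Proof.
move=> w0 w1; set x := \sum_i _; pose b (y : V) := hom y *m invmx P.
have bx : b x = \row_i w i.
  have /homE E : \sum_i (\row_i w i) ord0 i = 1 /\ \sum_i (\row_i w i) ord0 i *: v i = x.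
    by split; rewrite -?w1; apply: eq_bigr => i _; rewrite mxE.
  by rewrite /b -E mulmxK// uP.
have cb i : continuous (fun y => b y ord0 i).
  have -> : (fun y => b y ord0 i) =
      (fun y => \sum_(j < d) invmx P (lift ord_max j) i * y ord0 j + invmx P ord_max i).
    apply/funext => y; rewrite mxE (bigD1_ord ord_max)//= addrC mxE unlift_none mul1r.
    by congr (_ + _); apply: eq_bigr => j _; rewrite mxE liftK mulrC.
  have cs r : continuous (fun y : V => \sum_(j <- r) invmx P (lift ord_max j) i * y ord0 j).
    elim: r => [|j r IH].
      under eq_fun do rewrite big_nil; exact: cst_continuous.
    under eq_fun do rewrite big_cons.
    move=> y; apply: (@continuousD _ _ _ (fun y : V => invmx P (lift ord_max j) i * y ord0 j));
      last exact: IH.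
    apply: (@continuousM _ _ (cst _)); first exact: cst_continuous.
    exact: coord_continuous.
  move=> y; apply: (@continuousD _ _ _ (fun y : V => \sum_(j < d) invmx P (lift ord_max j) i * y ord0 j)).
    exact: cs.
  exact: cst_continuous.
have : \forall y \near x, forall i, 0 < b y ord0 i.
  apply: (@filter_forall _ _ (fun i y => 0 < b y ord0 i) (nbhs x)) => i.
  by apply: (cvgr_gt (b x ord0 i)); [exact: cb|rewrite bx mxE].
apply: filterS => y by0; have /homE[y1 yE] : b y *m P = hom y by rewrite /b mulmxKV.
by exists (fun i => b y ord0 i); split => // i; exact: ltW.
Qed.

Lemma simplex_interior_or_facet x : simplex v x ->
  ((simplex v)°)%classic x \/ exists i, face v (predC1 i) x.
Proof.
move=> [w [w0 w1 _ ->]].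
have [[i wi]|H] := pselect (exists i, w i = 0).
  by right; exists i, w; split => // j /=; rewrite negbK => /eqP ->.
left; apply: simplex_interior => // i; rewrite lt_neqAle w0 andbT eq_sym.
by apply/eqP => wi; apply: H; exists i.
Qed.

Lemma simplex_sub_closure_interior : simplex v `<=` closure ((simplex v)°)%classic.
Proof.
move=> x [w [w0 w1 _ xE]] U /nbhs_rVP[e e0 He].
(* Moving [x] by the fraction [s] towards the barycentre [b] makes all barycentric coordinates
   positive; [s] is small enough to stay within distance [e]. *)
pose c : R := d.+1%:R^-1; have c0 : 0 < c by rewrite invr_gt0.
pose b : V := \sum_i c *: v i; pose M := `|x - b|.
have M0 : 0 <= M by exact: normr_ge0.
pose s := Num.min 1 (e / (M + 1)); have s0 : 0 < s.
  by rewrite lt_min ltr01 divr_gt0// ltr_wpDl.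
have s1 : s <= 1 by rewrite ge_min lexx.
exists (\sum_i ((1 - s) * w i + s * c) *: v i); split.
  apply: simplex_interior => [i|].
    by rewrite ltr_wpDl ?mulr_gt0// mulr_ge0// subr_ge0.
  rewrite big_split /= -!mulr_sumr w1 sumr_const card_ord.
  have -> : c *+ d.+1 = 1 by rewrite -[LHS]mulr_natr mulVf ?pnatr_eq0.
  by rewrite !mulr1 subrK.
apply: He => i.
have -> : \sum_j ((1 - s) * w j + s * c) *: v j = x - s *: (x - b).
  under eq_bigr do rewrite scalerDl -!scalerA.
  rewrite big_split /= -scaler_sumr -xE -(scaler_sumr _ _ _ (fun i => c *: v i)) -/b.
  by rewrite scalerBl scale1r scalerBr opprB -addrA [- _ + _]addrC.
rewrite !mxE opprB addrCA subrr addr0 normrM (gtr0_norm s0).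
have h1 : `|x ord0 i - b ord0 i| <= M by have := coord_le_norm (x - b) i; rewrite !mxE.
have h2 : s <= e / (M + 1) by rewrite ge_min lexx orbT.
apply: (@le_lt_trans _ _ (e / (M + 1) * M)).
  by apply: ler_pM => //; exact: ltW.
by rewrite mulrAC ltr_pdivrMr ?ltr_wpDl// ltr_pM2l// ltrDl.
Qed.

End barycentric.

Lemma meval_line (q : mpoly.mpoly d R) (y z : 'I_d -> R) :
  exists P : {poly R}, forall s, P.[s] = mpoly.meval (fun i => y i + s * z i) q.
Proof.
have gen (I : Type) (r : seq I) (c : I -> R) (e : I -> 'I_d -> nat) :
    exists P : {poly R}, forall s,
      P.[s] = \sum_(m <- r) c m * \prod_i (y i + s * z i) ^+ e m i.
  exists (\sum_(m <- r) (c m)%:P * \prod_i ((y i)%:P + (z i)%:P * 'X) ^+ e m i) => s.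
  rewrite horner_sum; apply: eq_bigr => m _; rewrite hornerM hornerC; congr (_ * _).
  rewrite horner_prod; apply: eq_bigr => i _.
  by rewrite horner_exp !hornerE mulrC.
have [P HP] := gen _ (mpoly.msupp q) (fun m => mpoly.mcoeff m q) (fun m i => mpoly.fun_of_multinom m i).
by exists P => s; rewrite HP mpoly.mevalE.
Qed.

Lemma poly_zero_near (P : {poly R}) (e : R) : 0 < e ->
  (forall s, `|s| < e -> P.[s] = 0) -> P = 0.
Proof.
move=> e0 H; apply: contrapT => /eqP P0.
(* The points e/2, e/3, ... lie below [e]; [size P] distinct roots are one more than the degree
   allows. *)
pose rs := [seq e / (i.+2)%:R | i <- iota 0 (size P)].
have ur : uniq rs.
  rewrite map_inj_uniq ?iota_uniq// => i j /(mulfI (lt0r_neq0 e0)) /invr_inj /eqP.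
  by rewrite eqr_nat => /eqP [].
have ar : all (root P) rs.
  apply/allP => _ /mapP[i _ ->]; apply/rootP/H.
  rewrite ger0_norm ?divr_ge0 ?ltW// ltr_pdivrMr// ltr_pMr// ltr1n//.
by have := max_poly_roots P0 ar ur; rewrite size_map size_iota ltnn.
Qed.

End finite_element_geometry.

(** * Restriction of weak gradients to subdomains *)

Section null_sets.
Import HBNNSimple.
Context d0 (T : measurableType d0) (R : realType) (mu : {measure set T -> \bar R}).

(* No measurability of [f] is assumed: the integral of the library is then a
   lower integral, for which null sets still do not matter. *)
Lemma ge0_integral_negligible_setD (D E : set T) (f : T -> \bar R) : E `<=` D ->
  mu.-negligible (D `\` E) -> (forall x, 0 <= f x)%E ->
  (\int[mu]_(x in D) f x = \int[mu]_(x in E) f x)%E.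
Proof.
move=> ED [N [mN N0 DN]] f0; rewrite !ge0_integralE//=.
have mN' : measurable (~` N) by exact: measurableC.
apply/eqP; rewrite eq_le; apply/andP; split.
  apply: ge_ereal_sup => _ [h hf <-].
  (* The simple function is set to zero on the null set [N], which puts it below [f] restricted to
     [E] without changing its integral. *)
  apply: (@le_trans _ _ (sintegral mu (proj_nnsfun h mN'))); last first.
    apply: ereal_sup_ubound; exists (proj_nnsfun h mN') => // x.
    rewrite /= mindicE.
    have [Nx|Nx] := boolP (x \in ~` N); last first.
      by rewrite mulr0 patchE; case: ifP.
    rewrite mulr1; apply: le_trans (hf x) _; rewrite !patchE.
    case: ifPn => [Dx|_]; last by case: ifP.
    case: ifPn => // Ex; move: Nx; rewrite inE => Nx; case: Nx; apply: DN.
    by split; [rewrite inE in Dx|move/negP: Ex => Ex ?; apply: Ex; rewrite inE].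
  rewrite -!integralT_nnsfun le_eqVlt; apply/orP; left; apply/eqP.
  apply: ae_eq_integral => //; [by apply/measurable_EFinP..|].
  exists N; split => // x /= /not_implyP[_] H; apply: contrapT => Nx; apply: H.
  by rewrite mindicE mem_set// mulr1.
apply: le_ereal_sup => _ [h hf <-]; exists h => // x; apply: le_trans (hf x) _.
rewrite !patchE; case: ifPn => Ex; last by case: ifP.
by rewrite ifT// inE; apply: ED; rewrite inE in Ex.
Qed.

Lemma integral_negligible_setD (D E : set T) (f : T -> \bar R) : E `<=` D ->
  mu.-negligible (D `\` E) -> (\int[mu]_(x in D) f x = \int[mu]_(x in E) f x)%E.
Proof.
move=> ED DE; rewrite integralE [RHS]integralE.
by congr (_ - _)%E; apply: ge0_integral_negligible_setD.
Qed.

Lemma Rintegral_negligible_setD (D E : set T) (f : T -> R) : E `<=` D ->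
  mu.-negligible (D `\` E) -> \int[mu]_(x in D) f x = \int[mu]_(x in E) f x.
Proof. by move=> ED DE; rewrite /Rintegral (integral_negligible_setD _ ED). Qed.

End null_sets.

Section restriction.
Context {R : realType} (d : nat).
Local Notation V := 'rV[R]_d.
Local Notation leb := (lebesgue_rV R d).
Context (D : set V) (bD : bounded_open D).
Implicit Types (w v : V -> R) (O : set V).

Let mD : measurable D := bounded_open_measurable bD.

Lemma ip_eq_support O E w v w' v' :
  (forall x, (w x * v x) *+ (x \in O) = (w' x * v' x) *+ (x \in E)) ->
  ip O w v = ip E w' v'.
Proof.
move=> H; rewrite /ip Rintegral_mkcond [RHS]Rintegral_mkcond; apply: eq_Rintegral => x _.
by rewrite !patchE; move: (H x); do 2 case: ifP.
Qed.

(* As [w] has zero trace on [D], it can be tested on [D] against the test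
   functions of [O], which need not be supported in [D]. *)
Lemma restrict_weak_grad O w : bounded_open O -> H10 D w -> (forall x, ~ D x -> w x = 0) ->
  is_weak_grad O (w \_ O) (wgrad D w \_ D).
Proof.
move=> bO Hw w0 i; have mO := bounded_open_measurable bO.
have -> : (fun x => (wgrad D w \_ D) x ord0 i) = (fun x => wgrad D w x ord0 i) \_ D.
  by apply/funext => x; rewrite !patchE; case: ifP => // _; rewrite mxE.
split; first by apply: (L2S measurableT mO) => //; apply: L2_mkcond => //; exact: H1_wgrad_L2 Hw.1 i.
move=> psi tp.
have p0 x : ~ O x -> psi x = 0 by exact: test_function_eq0.
have p1 x : ~ O x -> pderiv i psi x = 0 by exact: test_function_pderiv_eq0.
transitivity (ip D w (pderiv i psi)).
  apply: ip_eq_support => x; rewrite patchE.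
  have [xO|/negP xO] := boolP (x \in O); have [xD|/negP xD] := boolP (x \in D) => //.
  - by rewrite w0 ?mul0r//; rewrite inE in xD.
  - by rewrite p1 ?mulr0//; rewrite inE in xO.
rewrite (@H10_parts _ _ _ bD _ psi)//; first last.
- by apply: test_function_L2 => //; exact: test_function_pderiv tp.
- exact: test_function_L2 tp.
- by case: tp => H _ _; exact: H.
congr (- _); apply: ip_eq_support => x; rewrite patchE.
have [xO|/negP xO] := boolP (x \in O); have [xD|/negP xD] := boolP (x \in D) => //.
- exact: esym (mul0r (psi x)).
- by rewrite p0 ?mulr0//; rewrite inE in xO.
Qed.

Lemma is_weak_grad0 O : is_weak_grad O (fun=> 0) (fun=> 0 : V).
Proof.
move=> i; split; first by under eq_fun do rewrite mxE; exact: L2_0.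
move=> psi _; rewrite /ip; under eq_Rintegral do rewrite mul0r.
under [X in - X]eq_Rintegral do rewrite mxE mul0r.
by rewrite /Rintegral integral0 oppr0.
Qed.

Lemma wgrad_eq0_open O w : bounded_open O -> O `<=` D -> H10 D w ->
  (forall x, ~ D x -> w x = 0) -> (forall x, O x -> w x = 0) ->
  {ae leb, forall x, O x -> wgrad D w x = 0}.
Proof.
move=> bO OD Hw wD wO; have := restrict_weak_grad bO Hw wD.
have -> : w \_ O = fun=> 0.
  by apply/funext => x; rewrite patchE; case: ifP => //; rewrite inE => /wO.
move=> /(is_weak_grad_unique bO) /(_ (is_weak_grad0 O)); apply: filterS => x H Ox.
by rewrite -(H Ox) patchE ifT// inE; exact: OD.
Qed.

Context (A : V -> 'M[R]_d) (amax : R).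
Hypothesis HA : elliptic D A amax.

(** The local eigenproblem uses weak gradients on the subdomain, the Schwarz theory those on the
    whole domain; by uniqueness they agree almost everywhere. *)
Lemma form_a_restrict O w v : bounded_open O -> leb.-negligible (O `\` D) ->
  H10 D w -> (forall x, ~ D x -> w x = 0) -> H10 D v -> (forall x, ~ D x -> v x = 0) ->
  form_a A O (w \_ O) (v \_ O) = form_on D A (O `&` D) w v.
Proof.
move=> bO nO Hw w0 Hv v0; have mO := bounded_open_measurable bO.
have mE : measurable (O `&` D) by exact: measurableI.
have sub : O `&` D `<=` O by move=> x [].
(* The matrix [A] is known to be measurable on [D] only, so the part of [O] outside [D] is discarded
   before any measurability is claimed. *)
rewrite /form_a /form_on (Rintegral_negligible_setD _ sub); last first.
  by apply: negligibleS nO => x [Ox H]; split => // Dx; apply: H.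
have Gw := restrict_weak_grad bO Hw w0; have Gv := restrict_weak_grad bO Hv v0.
have H1O u g : L2 D u -> is_weak_grad O (u \_ O) g -> (forall x, ~ D x -> u x = 0) ->
    H1 O (u \_ O).
  move=> Lu Gu u0; split; last by exists g.
  apply: (@eq_L2 _ _ _ (u \_ D)) => // [x Ox|].
    rewrite !patchE (mem_set Ox); case: ifPn => // /negP Dx; rewrite (u0 x)//.
    by move=> ?; apply: Dx; rewrite inE.
  by apply: (L2S measurableT mO) => //; exact: L2_mkcond.
have Lg u : H1 O u -> vL2 (O `&` D) (wgrad O u).
  by move=> Hu i; apply: (L2S mO mE) => //; exact: H1_wgrad_L2.
have iO : leb.-integrable (O `&` D)
    (fun x => (dotv (wgrad O (w \_ O) x *m (A x)^T) (wgrad O (v \_ O) x))%:E).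
  apply: dotv_integrable => //; last by apply: Lg; exact: H1O Hv.1.1 Gv v0.
  apply: (vL2_elliptic bD HA) => //.
  by apply: Lg; exact: H1O Hw.1.1 Gw w0.
rewrite /Rintegral; congr fine; apply: ae_eq_integral => //.
- exact: measurable_int iO.
- apply: (measurable_int leb); apply: (form_on_integrable bD HA) => //; [exact: Hw.1|exact: Hv.1].
have := wgrad_ae bO Gw; apply: filterS2 (wgrad_ae bO Gv) => x Ev Ew [Ox Dx].
by rewrite Ev// Ew// !patchE mem_set.
Qed.

Lemma ip_restrict O w v : (forall x, ~ D x -> w x = 0) ->
  ip O (w \_ O) (v \_ O) = ip (O `&` D) w v.
Proof.
move=> w0; apply: ip_eq_support => x; rewrite !patchE in_setI.
have [xO|xO] := boolP (x \in O) => //=; have [xD|/negP xD] := boolP (x \in D) => //.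
by rewrite w0 ?mul0r// => Dx; apply: xD; rewrite inE.
Qed.

Lemma ip_local O w v : (forall x, ~ D x -> w x = 0) -> (forall x, ~ O x -> w x = 0) ->
  ip D w v = ip (O `&` D) w v.
Proof.
move=> wD wO; apply: ip_eq_support => x; rewrite in_setI.
have [xO|/negP xO] := boolP (x \in O) => //=.
by rewrite wO ?mul0r ?mul0rn// => Ox; apply: xO; rewrite inE.
Qed.

(* [w] vanishes on the open set [D \ closure O], hence so does its gradient. *)
Lemma form_on_local O w v : open O -> leb.-negligible (closure O `\` O) ->
  H10 D w -> (forall x, ~ D x -> w x = 0) -> (forall x, ~ O x -> w x = 0) -> H1 D v ->
  form_on D A D w v = form_on D A (O `&` D) w v.
Proof.
move=> oO nO Hw wD wO Hv; have mO : measurable O by exact: measurable_rV_open.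
pose U := D `&` ~` closure O.
have bU : bounded_open U.
  split; first by apply: openI; [exact: bD.1|apply: closed_openC; exact: closed_closure].
  apply: (le_lt_trans _ bD.2); apply: le_measure; rewrite ?inE//; last by move=> x [].
  apply: measurable_rV_open; apply: openI; [exact: bD.1|apply: closed_openC; exact: closed_closure].
have U0 : {ae leb, forall x, U x -> wgrad D w x = 0}.
  apply: (wgrad_eq0_open bU _ Hw wD) => [x []//|x [_ cO]]; apply: wO => Ox; apply: cO.
  exact: subset_closure.
rewrite /form_on (setIC O).
have iD := form_on_integrable bD HA mD (@subset_refl _ D) Hw.1 Hv.
rewrite /Rintegral integral_mkcondr; congr fine; apply: ae_eq_integral => //.
- exact: measurable_int iD.
- apply/measurable_restrict => //; apply: measurable_funS (measurable_int _ iD) => //.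
have {}nO : {ae leb, forall x, closure O x -> O x}.
  by apply: negligibleS nO => x /= /not_implyP.
apply: filterS2 U0 nO => x Ux Ox Dx; rewrite patchE; case: ifPn => // /negP xO.
rewrite Ux; last by split => // /Ox Ox'; apply: xO; rewrite inE.
rewrite mul0mx /dotv big1// => i _; by rewrite mxE mul0r.
Qed.

End restriction.

(** * Finite element functions on the mesh and the addition of layers *)

Section mesh_subdomains.
Context {R : realType} (d : nat) (d0 : (0 < d)%N).
Local Notation V := 'rV[R]_d.
Local Notation leb := (lebesgue_rV R d).
Context (Om : set V) (HOm : polytopal_domain Om).
Context (F : fe_space R d) (HT : triangulation Om (fe_mesh F)) (HC : conforming_fe Om F).
Local Notation n := (fe_dim F).
Local Notation phi := (@fe_basis _ _ F).
Local Notation int t := ((cell t)°)%classic.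
Implicit Types (t : 'I_(ncell (fe_mesh F))) (v : V -> R) (j : 'I_n).

Lemma polytopal_bounded_open : bounded_open Om.
Proof.
have [_ oO _ bO _] := HOm; split => //.
by apply: lebesgue_rV_bounded => //; exact: measurable_rV_open.
Qed.

Lemma negligible_polytopal_bd : leb.-negligible (closure Om `\` Om).
Proof.
have [_ oO _ _ [k [w [_ E]]]] := HOm.
apply: (@negligibleS _ _ _ _ (bd Om)); first by rewrite /bd; move/interior_id: oO => ->.
by rewrite E; apply: negligible_bigcup_count => i _; exact: negligible_simplex.
Qed.

Definition mesh_skeleton : set V :=
  \bigcup_(t in [set: 'I_(ncell (fe_mesh F))]) \bigcup_(i in [set: 'I_d.+1])
    face (vertex t) (predC1 i).

Lemma negligible_mesh_skeleton : leb.-negligible mesh_skeleton.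
Proof.
by do 2 (apply: negligible_bigcup_count => ? _); exact: negligible_facet.
Qed.

Lemma closure_skeleton_or_cell x : closure Om x -> mesh_skeleton x \/ exists t, int t x.
Proof.
have [av _ ->] := HT => -[t _ tx].
have [ix|[i fx]] := simplex_interior_or_facet (av t) tx; first by right; exists t.
by left; exists t => //; exists i.
Qed.

(** A nonempty open set has positive measure, so it cannot be contained in the skeleton. *)
Lemma open_meets_cell (U : set V) : open U -> U `<=` closure Om -> U !=set0 ->
  exists t x, U x /\ int t x.
Proof.
move=> oU UO U0; apply: contrapT => H.
have [N [mN N0 UN]] : leb.-negligible U.
  apply: negligibleS negligible_mesh_skeleton => x Ux.
  have [//|[t tx]] := closure_skeleton_or_cell (UO _ Ux).
  by exfalso; apply: H; exists t, x.
have := lebesgue_rV_open_gt0 oU U0; rewrite ltNge => /negP; apply.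
by rewrite -N0; apply: le_measure; rewrite ?inE//; exact: measurable_rV_open.
Qed.

Lemma cell_closure_int t : cell t `<=` closure (int t).
Proof. by have [av _ _] := HT; exact: simplex_sub_closure_interior. Qed.

Lemma fe_continuous v : fe_fun F v -> continuous v.
Proof. by have [_ H _ _] := HC => /H[]. Qed.

Lemma fe_H10 v : fe_fun F v -> H10 Om v.
Proof. by have [_ H _ _] := HC => /H[]. Qed.

Lemma fe_eq0 v x : fe_fun F v -> ~ Om x -> v x = 0.
Proof. by have [_ H _ _] := HC => /H[_ _ h _]; exact: h. Qed.

Lemma fe_basis_fun j : fe_fun F (phi j).
Proof.
exists (fun i => (i == j)%:R); apply/funext => x.
by rewrite /lincomb (bigD1 j)//= eqxx mul1r big1 ?addr0// => i /negbTE ->; rewrite mul0r.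
Qed.

Lemma continuous_eq0_closure (U : set V) v : continuous v -> (forall x, U x -> v x = 0) ->
  forall x, closure U x -> v x = 0.
Proof.
move=> cv U0; have cl : closed [set x | v x = 0].
  rewrite (_ : [set x | _] = v @^-1` [set 0])//.
  by apply: closed_comp => [x _|]; [exact: cv|exact: closed_eq].
by move=> x /(closure_subset (U0 : U `<=` [set x | v x = 0])); rewrite -(closure_id _).1.
Qed.

(* A polynomial in one variable, obtained by restriction to the line through
   [x] and [y], vanishes near 0. *)
Lemma fe_zero_cell v t x : fe_fun F v -> int t x -> (\forall y \near x, v y = 0) ->
  forall y, cell t y -> v y = 0.
Proof.
move=> Fv tx vx y ty; have [_ H _ _] := HC; have [_ _ _ /(_ t)[q qE]] := H v Fv.
have [P HP] := meval_line q (fun i => x ord0 i) (fun i => y ord0 i - x ord0 i).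
have /nbhs_rVP[e e0 He] : nbhs x [set z | cell t z /\ v z = 0].
  by apply: filterI => //; exact: (interior_subset _).
suff P0 : P = 0.
  have := HP 1; rewrite P0 horner0 qE// => ->; congr (mpoly.meval _ q).
  by apply/funext => i; rewrite mul1r addrC subrK.
pose M := 1 + \sum_i `|y ord0 i - x ord0 i|.
have M0 : 0 < M by rewrite ltr_wpDr// sumr_ge0.
apply: (@poly_zero_near _ _ (e / M)); first exact: divr_gt0.
move=> s se; rewrite HP; pose z : V := x + s *: (y - x).
have [tz vz] : cell t z /\ v z = 0.
  apply: He => i; rewrite !mxE opprD addrA subrr add0r normrN normrM.
  apply: (@le_lt_trans _ _ (`|s| * M)); last by rewrite -ltr_pdivlMr.
  apply: ler_wpM2l => //; rewrite /M (bigD1 i)//= addrCA lerDl.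
  by rewrite addr_ge0// sumr_ge0.
rewrite -vz qE//; congr (mpoly.meval _ q).
by apply/funext => i; rewrite !mxE.
Qed.

(** An interior point of the cell outside the support would have a neighbourhood where [v] vanishes;
    then [v] would vanish on the whole cell, although [x] is in the support. *)
Lemma supp_cell v t x : fe_fun F v -> int t x -> supp v x -> cell t `<=` supp v.
Proof.
move=> Fv tx vx.
suff H : int t `<=` supp v.
  move=> y /cell_closure_int /(closure_subset H).
  by rewrite -(closure_id (supp v)).1//; exact: closed_closure.
move=> z tz; apply: contrapT => vz.
have z0 : \forall y \near z, v y = 0.
  have : nbhs z (~` supp v).
    by apply: open_nbhs_nbhs; split => //; apply: closed_openC; exact: closed_closure.
  apply: filterS => y vy; apply/eqP; apply: contrapT => /negP vy0; apply: vy.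
  exact: subset_closure.
have v0 := fe_zero_cell Fv tz z0.
have [y [/= vy ty]] := vx (cell t) tx.
by move: vy; rewrite v0// eqxx.
Qed.

Lemma supp_sub_closure v : fe_fun F v -> supp v `<=` closure Om.
Proof.
move=> Fv; apply: closure_subset => x /= vx; apply: contrapT => Ox.
by move: vx; rewrite (fe_eq0 Fv Ox) eqxx.
Qed.

Lemma open_neq0 v : fe_fun F v -> open [set x | v x != 0].
Proof.
move=> Fv; rewrite (_ : [set x | _] = v @^-1` [set t : R | t != 0])//.
by apply: open_comp => [x _|]; [exact: fe_continuous|exact: open_neq].
Qed.

Section layer.
Context (D : set V).
Let O := add_layer F D.
Let C := \bigcup_(j in [set j | supp (phi j) `&` D !=set0]) supp (phi j).

Let closedC : closed C.
Proof.
by apply: closed_bigcup => [|j _]; [exact: finite_finset|]; exact: closed_closure.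
Qed.

Lemma layer_open : open O.
Proof. exact: open_interior. Qed.

Lemma layer_sub_closure : O `<=` closure Om.
Proof.
move=> x /interior_subset[j _]; apply: supp_sub_closure; exact: fe_basis_fun.
Qed.

Lemma layer_cell t x : int t x -> O x -> int t `<=` O.
Proof.
move=> tx /interior_subset[j Dj jx]; apply: interiorS => y ty; exists j => //.
exact: (supp_cell (fe_basis_fun j) tx jx).
Qed.

(** A limit point of [O] inside a cell forces that cell to meet [O], and then the interior of the
    cell lies in [O]. *)
Lemma layer_bd : closure O `\` O `<=` mesh_skeleton.
Proof.
move=> x [Ox nOx].
have : closure Om x.
  have := closure_subset layer_sub_closure Ox.
  by rewrite -(closure_id (closure Om)).1//; exact: closed_closure.
move=> /closure_skeleton_or_cell[//|[t tx]]; exfalso; apply: nOx.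
have [y [Oy ty]] : O `&` int t !=set0.
  by apply: Ox; apply: open_nbhs_nbhs; split => //; exact: open_interior.
exact: (layer_cell ty Oy).
Qed.

(** The set where [phi j] is nonzero is open and contained in the closed set [C], hence in its
    interior [O]. *)
Lemma layer_dof j x : supp (phi j) `<=` closure O -> ~ O x -> phi j x = 0.
Proof.
move=> jO Ox; apply/eqP; apply: contrapT => /negP jx; apply: Ox.
have sC : [set x | phi j x != 0] `<=` C.
  move=> y /= jy; have : closure O y by apply: jO; exact: subset_closure.
  move=> /(closure_subset (@interior_subset _ C)); by rewrite -(iffLR (closure_id C) closedC).
have := open_neq0 (fe_basis_fun j).
by rewrite openE => /(_ x jx); exact: filterS.
Qed.

Lemma layer_next j : supp (phi j) `&` D !=set0 -> [set x | phi j x != 0] `<=` O.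
Proof.
move=> jD x jx; have := open_neq0 (fe_basis_fun j).
rewrite openE => /(_ x jx); apply: filterS => y jy; exists j => //.
exact: subset_closure.
Qed.

End layer.

Definition fe_comb (x : 'cV[R]_n) : V -> R := lincomb (fun j => x j ord0) phi.
Local Notation u := fe_comb.

Lemma fe_combE x y : u x y = \sum_j x j ord0 * phi j y.
Proof. by []. Qed.

Lemma fe_comb_fun x : fe_fun F (u x).
Proof. by exists (fun j => x j ord0). Qed.

Lemma fe_fun_comb v : fe_fun F v -> exists x, v = u x.
Proof.
move=> [c ->]; exists (\col_j c j); apply/funext => y.
by apply: eq_bigr => j _; rewrite mxE.
Qed.

Lemma fe_comb_lin x y a : u (x + a *: y) = u x \+ (fun z => a * u y z).
Proof.
apply/funext => z; rewrite /= !fe_combE mulr_sumr -big_split /=.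
by apply: eq_bigr => j _; rewrite !mxE mulrDl mulrA.
Qed.

Lemma fe_comb0 : u 0 = fun=> 0.
Proof. by apply/funext => z; rewrite fe_combE big1// => j _; rewrite mxE mul0r. Qed.

Lemma fe_comb_sum I (r : seq I) (X : I -> 'cV[R]_n) y :
  u (\sum_(i <- r) X i) y = \sum_(i <- r) u (X i) y.
Proof.
elim: r => [|i r IH]; first by rewrite !big_nil fe_comb0.
by rewrite !big_cons -IH -[\sum_(j <- r) X j]scale1r fe_comb_lin /= mul1r scale1r.
Qed.

Lemma fe_combZ a x y : u (a *: x) y = a * u x y.
Proof. by rewrite -[a *: x]add0r fe_comb_lin fe_comb0 /= add0r. Qed.

Lemma fe_comb_node x j : u x (fe_node j) = x j ord0.
Proof.
have [_ _ H _] := HC; rewrite fe_combE (bigD1 j)//= H eqxx mulr1 big1 ?addr0// => i ij.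
by rewrite H (negbTE ij) mulr0.
Qed.

Lemma fe_comb_inj x y : u x = u y -> x = y.
Proof. by move=> E; apply/colP => j; rewrite -!fe_comb_node E. Qed.

Lemma fe_basis_comb j : phi j = u (delta_mx j ord0).
Proof.
apply/funext => y; rewrite fe_combE (bigD1 j)//= mxE !eqxx mul1r big1 ?addr0// => i ij.
by rewrite mxE (negbTE ij) mul0r.
Qed.

Lemma coords_fe_comb x j : coords phi (u x) j = x j ord0.
Proof.
rewrite /coords; set c := xget _ _; have E : u x = lincomb c phi.
  by apply: (@xgetPex _ _ [set c | u x = lincomb c phi]); exists (fun j => x j ord0).
rewrite -[RHS]fe_comb_node E.
have -> : lincomb c phi = u (\col_j c j).
  by apply/funext => y; apply: eq_bigr => i _; rewrite mxE.
by rewrite fe_comb_node mxE.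
Qed.

(** Some cell with interior in [O] contains a point where [phi j] is nonzero. The node j lies in
    that cell, for otherwise [phi j] would vanish at all nodes of the cell and, by unisolvence, on
    the cell. The value of [u x] at the node is the coefficient. *)
Lemma fe_comb_eq0_node x (O : set V) j : open O -> O `<=` closure Om ->
  (forall t y, int t y -> O y -> int t `<=` O) ->
  supp (phi j) `&` O !=set0 -> (forall y, O y -> u x y = 0) -> x j ord0 = 0.
Proof.
move=> oO OOm Ocell [y [jy Oy]] uO.
have [z [jz Oz]] : [set x | phi j x != 0] `&` O !=set0.
  by apply: jy; exact: open_nbhs_nbhs.
have [t [w [[/= jw Ow] tw]]] : exists t w, ([set x | phi j x != 0] `&` O) w /\ int t w.
  apply: open_meets_cell => [|w [_ Ow]|]; last by exists z.
  - by apply: openI => //; apply: open_neq0; exact: fe_basis_fun.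
  - exact: OOm.
have u0 : forall y, cell t y -> u x y = 0.
  move=> b /cell_closure_int; apply: continuous_eq0_closure.
    exact: fe_continuous (fe_comb_fun x).
  by move=> c tc; apply: uO; exact: (Ocell t w tw Ow).
rewrite -fe_comb_node; apply: u0; apply: contrapT => tj.
have [_ _ Hn Hu] := HC; move: jw; suff -> : phi j w = 0 by rewrite eqxx.
apply: (Hu _ t predT (fe_basis_fun j)); last exact: interior_subset tw.
move=> i ti; rewrite Hn; case: eqP => // ij.
by exfalso; apply: tj; rewrite ij.
Qed.

End mesh_subdomains.

(** * The overlapping decomposition *)

Section overlapping_decomposition.
Context {R : realType} (d : nat) (d0 : (0 < d)%N).
Local Notation V := 'rV[R]_d.
Local Notation leb := (lebesgue_rV R d).
Context (Om : set V) (HOm : polytopal_domain Om).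
Context (F : fe_space R d) (HT : triangulation Om (fe_mesh F)) (HC : conforming_fe Om F).
Context (N : nat) (Omp : 'I_N -> set V) (layers : 'I_N -> nat).
Context (Hpart : partition_resolved F Omp Om) (Hlayers : forall i, (0 < layers i)%N).
Local Notation n := (fe_dim F).
Local Notation phi := (@fe_basis _ _ F).
Local Notation u := (@fe_comb R d F).
Local Notation O i := (subdomain F Omp layers i).
Local Notation dofs i := (@dof R d F N Omp layers i).
Local Notation mu j := (@multiplicity R d F N Omp layers j).
Implicit Types (i : 'I_N) (j : 'I_n) (x y : 'cV[R]_n) (z : V).

Let bOm : bounded_open Om := polytopal_bounded_open HOm.

Lemma subdomain_layer i : exists D, O i = add_layer F D.
Proof.
by rewrite /subdomain; case: (layers i) (Hlayers i) => // l _; exists (iter l (add_layer F) (Omp i)).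
Qed.

Lemma subdomain_open i : open (O i).
Proof. by have [D ->] := subdomain_layer i; exact: layer_open. Qed.

Lemma subdomain_sub_closure i : O i `<=` closure Om.
Proof. by have [D ->] := subdomain_layer i; exact: (layer_sub_closure HC). Qed.

Lemma subdomain_cell i t z : ((cell t)°)%classic z -> O i z ->
  ((@cell _ _ (fe_mesh F) t)°)%classic `<=` O i.
Proof. by have [D ->] := subdomain_layer i; exact: (layer_cell HT HC). Qed.

Lemma negligible_subdomain_bd i : leb.-negligible (closure (O i) `\` O i).
Proof.
apply: negligibleS (negligible_mesh_skeleton d0 F).
by have [D ->] := subdomain_layer i; exact: (layer_bd HT HC).
Qed.

(* [O i] need not be contained in [Om], which may have slits: it is the interior
   of a closed set. *)
Lemma negligible_subdomain_setD i : leb.-negligible (O i `\` Om).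
Proof.
apply: negligibleS (negligible_polytopal_bd d0 HOm) => z [Oz Omz]; split => //.
exact: subdomain_sub_closure Oz.
Qed.

Lemma closure_bounded : exists M : R, forall z l, closure Om z -> `|z ord0 l| <= M.
Proof.
have [_ _ _ [M [_ HM]] _] := HOm; exists (M + 1) => z l Oz.
have cl : closed [set y : V | `|y ord0 l| <= M + 1].
  rewrite (_ : [set y | _] = (fun y : V => `|y ord0 l|) @^-1` [set t | t <= M + 1])//.
  apply: closed_comp => [y _|]; last exact: closed_le.
  apply: (@continuous_comp _ _ _ (fun y : V => y ord0 l) (fun t : R => `|t|)).
    exact: coord_continuous.
  exact: norm_continuous.
suff H : Om `<=` [set y : V | `|y ord0 l| <= M + 1].
  by have := closure_subset H Oz; rewrite -(iffLR (closure_id _) cl).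
move=> y Oy; apply: le_trans (coord_le_norm y l) _.
by apply: HM => //; rewrite ltrDl.
Qed.

Lemma subdomain_bounded_open i : bounded_open (O i).
Proof.
split; first exact: subdomain_open.
have mO : measurable (O i) by apply: measurable_rV_open; exact: subdomain_open.
apply: lebesgue_rV_bounded => //; have [M HM] := closure_bounded.
exists `|M|; split; first exact: num_real.
move=> M' MM' z Oz; rewrite /= /Num.norm/= mx_normrE; apply: bigmax_le => [|[a l] _].
  by apply: le_trans (ltW MM').
rewrite (ord1 a) /=; apply: le_trans (HM _ _ (subdomain_sub_closure Oz)) _.
by apply: le_trans (ler_norm _) (ltW MM').
Qed.

Lemma dof_eq0 i j z : dofs i j -> ~ O i z -> phi j z = 0.
Proof.
by move=> /asboolP; have [D ->] := subdomain_layer i; exact: (layer_dof HC).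
Qed.

Lemma basis_neq0 j : exists z, phi j z != 0.
Proof. by have [_ _ H _] := HC; exists (fe_node j); rewrite H eqxx oner_eq0. Qed.

(** The set where [phi j] is nonzero meets some [Omp i], so the first layer absorbs it and later
    layers keep it. This makes every multiplicity positive and the weights a partition of unity. *)
Lemma dof_exists j : exists i, dofs i j /\ [set z | phi j z != 0] `<=` O i.
Proof.
have [_ _ cl _] := Hpart; have [z jz] := basis_neq0 j.
have : closure Om z by apply: (supp_sub_closure HC (fe_basis_fun j)); exact: subset_closure.
rewrite cl => -[i _ iz]; exists i.
suff H : [set z | phi j z != 0] `<=` O i.
  by split => //; apply/asboolP; exact: closure_subset.
have base : supp (phi j) `&` Omp i !=set0.
  have [y [Oy jy]] : Omp i `&` [set z | phi j z != 0] !=set0.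
    apply: iz; apply: open_nbhs_nbhs; split => //.
    by apply: (open_neq0 HC); exact: fe_basis_fun.
  by exists y; split => //; exact: subset_closure.
have step l : supp (phi j) `&` iter l (add_layer F) (Omp i) !=set0 /\
    [set z | phi j z != 0] `<=` iter l.+1 (add_layer F) (Omp i).
  elim: l => [|l [_ IH]]; first by split => //; exact: (layer_next HC).
  have meets : supp (phi j) `&` iter l.+1 (add_layer F) (Omp i) !=set0.
    by exists z; split; [exact: subset_closure|exact: IH].
  by split => //; exact: (layer_next HC).
by rewrite /subdomain; case: (layers i) (Hlayers i) => // l _; exact: (step l).2.
Qed.

Lemma dofbar_dof i j : dofs i j -> dofbar Omp layers i j.
Proof.
move=> ij; apply/asboolP; have [z jz] := basis_neq0 j.
exists z; split; first exact: subset_closure.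
by apply: contrapT => Oz; move: jz; rewrite (dof_eq0 ij Oz) eqxx.
Qed.

(** The operator Xi_i on coefficient vectors, with zeros at the remaining degrees of freedom. *)
Definition weighted_part i x : 'cV[R]_n :=
  \col_j (if dofs i j then (mu j)%:R^-1 * x j ord0 else 0).

Lemma weighted_part_sum x : \sum_i weighted_part i x = x.
Proof.
apply/colP => j; rewrite summxE; under eq_bigr do rewrite mxE.
rewrite -big_mkcond /= sumr_const -[#|_|]/(mu j) -[LHS]mulr_natl mulrA mulfV ?mul1r//.
have [i [ij _]] := dof_exists j; rewrite pnatr_eq0 -lt0n; apply/card_gt0P.
by exists i.
Qed.

Lemma weighted_part_lin i x y a :
  weighted_part i (x + a *: y) = weighted_part i x + a *: weighted_part i y.
Proof.
apply/colP => j; rewrite !mxE; case: ifP => _; last by rewrite mulr0 addr0.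
by rewrite mulrDr mulrCA.
Qed.

Lemma weighted_part_eq0 i x j : ~~ dofs i j -> weighted_part i x j ord0 = 0.
Proof. by move=> /negbTE ij; rewrite mxE ij. Qed.

Lemma local_eq0 i x z : (forall j, ~~ dofs i j -> x j ord0 = 0) -> ~ O i z -> u x z = 0.
Proof.
move=> x0 Oz; rewrite fe_combE big1// => j _; have [ij|ij] := boolP (dofs i j).
  by rewrite (dof_eq0 ij Oz) mulr0.
by rewrite x0// mul0r.
Qed.

Lemma restrict_dofbar i x : u x \_ (O i) =
  fun z => \sum_(j < n | dofbar Omp layers i j) x j ord0 * phi_loc Omp layers i j z.
Proof.
apply/funext => z; rewrite patchE; case: ifPn => [|/negP] Oz; last first.
  rewrite big1// => j _; rewrite /phi_loc patchE ifF ?mulr0//.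
  by apply/negP.
rewrite fe_combE (bigID (dofbar Omp layers i))/= [X in _ + X]big1 ?addr0; last first.
  move=> j /asboolPn H; have -> : phi j z = 0; last by rewrite mulr0.
  apply/eqP; apply: contrapT => /negP jz; apply: H; exists z.
  by split; [exact: subset_closure|rewrite inE in Oz].
by apply: eq_bigr => j _; rewrite /phi_loc patchE Oz.
Qed.

Lemma restrict_eq0 i x : u x \_ (O i) = (fun=> 0) ->
  forall j, dofbar Omp layers i j -> x j ord0 = 0.
Proof.
move=> E j /asboolP ij.
apply: (fe_comb_eq0_node d0 HT HC (@subdomain_open i) _ _ ij) => [|t z tz Oz|z Oz].
- exact: subdomain_sub_closure.
- exact: (@subdomain_cell i t z tz Oz).
- by have := congr1 (fun f => f z) E; rewrite /= patchE mem_set.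
Qed.

(** [dofbar_coef] merely selects some expansion of the restriction; by [restrict_eq0] its
    coefficients are those of [x]. *)
Lemma Xi_restrict i x : Xi F Omp layers i (u x \_ (O i)) = u (weighted_part i x).
Proof.
set v := _ \_ _; pose c := @dofbar_coef R d F N Omp layers i v.
have cE : v = fun z => \sum_(j < n | dofbar Omp layers i j) c j * phi_loc Omp layers i j z.
  apply: (@xgetPex _ _ [set c | v = fun z => \sum_(j < n | dofbar Omp layers i j)
    c j * phi_loc Omp layers i j z]).
  by exists (fun j => x j ord0); exact: restrict_dofbar.
pose y : 'cV[R]_n := \col_j c j.
have y0 : u (x - y) \_ (O i) = fun=> 0.
  apply/funext => z; rewrite restrict_dofbar.
  transitivity (v z - v z); last exact: subrr.
  rewrite {1}/v restrict_dofbar cE -sumrB; apply: eq_bigr => j _.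
  by rewrite !mxE mulrBl.
apply/funext => z; rewrite /Xi fe_combE big_mkcond; apply: eq_bigr => j _.
rewrite mxE; case: ifP => ij; last by rewrite mul0r.
have := restrict_eq0 y0 (dofbar_dof ij); rewrite !mxE -/v => /eqP; rewrite subr_eq0 => /eqP ->.
congr (_ * _); rewrite /phi_loc patchE; case: ifPn => // /negP Oz.
by rewrite (dof_eq0 ij)// => Oz'; apply: Oz; rewrite inE.
Qed.

(** A point off the skeleton is interior to a cell, and a subdomain containing it contains the
    interior of that cell. *)
Lemma overlap_ae : {ae leb, forall z, Om z ->
  \sum_i \1_(O i `&` Om) z <= (overlap F Omp layers)%:R :> R}.
Proof.
apply: negligibleS (negligible_mesh_skeleton d0 F) => z /= /not_implyP[Oz H].
have [//|[t tz]] := closure_skeleton_or_cell HT (subset_closure Oz).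
exfalso; apply: H.
have -> : \sum_i \1_(O i `&` Om) z = #|[pred i | `[< O i z >]]|%:R :> R.
  rewrite -sum1_card natr_sum [RHS]big_mkcond; apply: eq_bigr => i _.
  rewrite indicE in_setI (mem_set Oz) andbT unfold_in /=.
  by have [Oi|Oi] := asboolP (O i z); [rewrite mem_set|rewrite memNset].
rewrite ler_nat /overlap; apply: leq_trans (leq_bigmax t); apply: subset_leq_card.
apply/fintype.subsetP => i Oi.
exact: (asboolT (@subdomain_cell i t z tz (asboolW Oi))).
Qed.

(** The index [j] witnesses that the finite element space is nontrivial; without one the overlap
    could be zero. *)
Lemma overlap_ge1 j : (1 <= overlap F Omp layers)%N.
Proof.
have [i [_ jO]] := dof_exists j.
have [t [z [jz tz]]] : exists t z, [set z | phi j z != 0] z /\ (@cell _ _ (fe_mesh F) t)° z.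
  apply: (open_meets_cell d0 HT); last exact: basis_neq0.
    by apply: (open_neq0 HC); exact: fe_basis_fun.
  by apply: subset_trans jO _; exact: subdomain_sub_closure.
rewrite /overlap; apply: leq_trans (leq_bigmax t); apply/card_gt0P; exists i.
exact: (asboolT (@subdomain_cell i t z tz (jO _ jz))).
Qed.

Lemma coord_ediam (D : set V) (M : R) : (forall z l, D z -> `|z ord0 l| <= M) ->
  forall (y z : V) l, D y -> D z -> y ord0 l - z ord0 l <= ediam D.
Proof.
move=> HM y z l Dy Dz; apply: (@le_trans _ _ (enorm (y - z))).
  rewrite /enorm /dotv (bigD1 l)//= !mxE; apply: le_trans (ler_norm _) _.
  rewrite -sqrtr_sqr ler_wsqrtr// -expr2 lerDl; apply: sumr_ge0 => i _.
  by rewrite -expr2 sqr_ge0.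
apply: sup_upper_bound; last by exists (y, z).
split; first by exists (enorm (y - z)), (y, z).
exists (Num.sqrt (\sum_(i < d) (2 * M) ^+ 2)) => _ [[a b] [/= Da Db] <-].
rewrite /enorm ler_wsqrtr// /dotv; apply: ler_sum => i _.
rewrite -expr2 -real_normK ?num_real//.
apply: lerXn2r; rewrite ?nnegrE//.
  by rewrite mulr_ge0//; apply: le_trans (HM y l Dy).
rewrite !mxE; apply: le_trans (ler_normB _ _) _.
by rewrite mulr_natl mulr2n; apply: lerD; exact: HM.
Qed.

Lemma coord_center (D : set V) (M : R) l : (forall z l, D z -> `|z ord0 l| <= M) ->
  exists c, forall z, D z -> `|z ord0 l - c| <= ediam D / 2.
Proof.
move=> HM; have [[z0 Dz0]|D0] := pselect (D !=set0); last first.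
  by exists 0 => z Dz; exfalso; apply: D0; exists z.
pose X := [set z ord0 l | z in D].
have hX : has_sup X.
  split; first by exists (z0 ord0 l), z0.
  by exists M => _ [z Dz <-]; apply: le_trans (ler_norm _) (HM _ _ Dz).
(* Half a diameter below the upper end of the coordinate range, which may be shorter than the
   diameter. *)
exists (sup X - ediam D / 2) => z Dz; rewrite ler_norml.
have h1 : z ord0 l <= sup X by apply: sup_upper_bound => //; exists z.
have h2 : sup X <= z ord0 l + ediam D.
  apply: ge_sup; first by exists (z0 ord0 l), z0.
  by move=> _ [y Dy <-]; rewrite -lerBlDl; exact: coord_ediam HM _ _ _ Dy Dz.
by apply/andP; split; lra.
Qed.

Lemma subdomain_diam_ge i : ediam (O i) <= subdomain_diam F Omp layers.
Proof. by rewrite /subdomain_diam; exact: (@le_bigmax _ _ _ 0 (fun i => ediam (O i))). Qed.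

Section forms.
Context (A : V -> 'M[R]_d) (amax : R) (HA : elliptic Om A amax).

Let mOm : measurable Om := bounded_open_measurable bOm.
Let mO i : measurable (O i). Proof. by apply: measurable_rV_open; exact: subdomain_open. Qed.
Let mE i : measurable (O i `&` Om). Proof. exact: measurableI. Qed.
Let EOm i : O i `&` Om `<=` Om. Proof. by move=> z []. Qed.

Let uH10 x : H10 Om (u x). Proof. exact: (fe_H10 HC (fe_comb_fun x)). Qed.
Let uH1 x : H1 Om (u x). Proof. by have [] := uH10 x. Qed.
Let uL2 x : L2 Om (u x). Proof. by have [] := uH1 x. Qed.
Let u0 x z : ~ Om z -> u x z = 0. Proof. exact: (fe_eq0 HC (fe_comb_fun x)). Qed.

Lemma form_a_subdomain i x y : form_a A (O i) (u x \_ (O i)) (u y \_ (O i)) =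
  form_on Om A (O i `&` Om) (u x) (u y).
Proof.
by apply: (form_a_restrict bOm HA (subdomain_bounded_open i)) => //;
  [exact: negligible_subdomain_setD|exact: u0..].
Qed.

Lemma friedrichs_subdomain i x : (2 <= d)%N ->
  (forall j, ~~ dofs i j -> x j ord0 = 0) ->
  2 * ip Om (u x) (u x) <= subdomain_diam F Omp layers ^+ 2 * form_on Om A Om (u x) (u x).
Proof.
move=> d2 x0; set H := subdomain_diam _ _ _; have [M HM] := closure_bounded.
have HO z l : O i z -> `|z ord0 l| <= M by move=> /subdomain_sub_closure; exact: HM.
have pl l : ip Om (u x) (u x) <=
    H ^+ 2 * ip Om (fun z => wgrad Om (u x) z ord0 l) (fun z => wgrad Om (u x) z ord0 l).
  have [c Hc] := coord_center l HO.
  (* M + |c| only bounds the multiplier on [Om]; the constant of the inequality comes from the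
     subdomain, outside which [u x] vanishes. *)
  apply: (@H10_friedrichs _ _ _ bOm l c (M + `|c|)) => //.
    move=> z Oz; apply: le_trans (ler_normB _ _) _; rewrite lerD2r.
    by apply: HM; exact: subset_closure.
  move=> z _ uz; apply: (@le_trans _ _ (ediam (O i) / 2)).
    by apply: Hc; apply: contrapT => Oz; move: uz; rewrite (local_eq0 x0 Oz) eqxx.
  by rewrite ler_pM2r ?invr_gt0//; exact: subdomain_diam_ge.
apply: (@le_trans _ _ (\sum_(l < d) ip Om (u x) (u x))).
  rewrite sumr_const card_ord -[leRHS]mulr_natl; apply: ler_wpM2r; first exact: ip_ge0.
  by rewrite ler_nat.
apply: (@le_trans _ _ (H ^+ 2 * \sum_l ip Om (fun z => wgrad Om (u x) z ord0 l)
    (fun z => wgrad Om (u x) z ord0 l))).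
  by rewrite mulr_sumr; apply: ler_sum => l _; exact: pl.
by apply: ler_wpM2l; [exact: sqr_ge0|apply: (form_on_ge_ip bOm HA)].
Qed.

Lemma overlap_form x : \sum_i form_on Om A (O i `&` Om) (u x) (u x) <=
  (overlap F Omp layers)%:R * form_on Om A Om (u x) (u x).
Proof.
apply: overlap_integral => //.
- exact: (form_on_integrable bOm HA).
- move=> z Oz; have [_ /(_ (wgrad Om (u x) z))/andP[h _]] := HA.2 _ Oz.
  exact: le_trans (dotv_ge0 _) h.
- exact: overlap_ae.
Qed.

Lemma overlap_ip x : \sum_i ip (O i `&` Om) (u x) (u x) <=
  (overlap F Omp layers)%:R * ip Om (u x) (u x).
Proof.
apply: overlap_integral => //.
- exact: L2_mul_integrable.
- by move=> z _; rewrite -expr2 sqr_ge0.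
- exact: overlap_ae.
Qed.

Lemma form_subdomain_local i x y : (forall j, ~~ dofs i j -> x j ord0 = 0) ->
  form_on Om A Om (u x) (u y) = form_on Om A (O i `&` Om) (u x) (u y) /\
  ip Om (u x) (u y) = ip (O i `&` Om) (u x) (u y).
Proof.
move=> x0; split.
  apply: (form_on_local bOm HA (@subdomain_open i) (@negligible_subdomain_bd i)) => //.
    exact: u0.
  by move=> z; exact: local_eq0.
by apply: ip_local; [exact: u0|move=> z; exact: local_eq0].
Qed.

Lemma ip_fe_eq0 x : ip Om (u x) (u x) = 0 -> x = 0.
Proof.
move=> H; apply: (fe_comb_inj HC); rewrite fe_comb0; apply/funext => z.
apply/eqP; apply: contrapT => /negP uz.
have oU : open [set z | u x z != 0] by apply: (open_neq0 HC); exact: fe_comb_fun.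
have UOm : [set z | u x z != 0] `<=` Om.
  by move=> y /= uy; apply: contrapT => Oy; move: uy; rewrite u0// eqxx.
have leb0 : (0 < leb [set z | u x z != 0%R])%E.
  by apply: lebesgue_rV_open_gt0 => //; exists z.
have iu : leb.-integrable Om (fun z => (u x z * u x z)%:E) by exact: L2_mul_integrable.
have h : (\int[leb]_(z in Om) (u x z * u x z)%:E = 0)%E.
  by rewrite -[LHS]fineK ?integrable_fin_num//; congr (_%:E).
have ae0 : ae_eq leb Om (fun z => (u x z * u x z)%:E) (cst 0%E).
  apply/ae_eq_integral_abs => //; first exact: measurable_int iu.
  rewrite -h; apply: eq_integral => y _; rewrite gee0_abs// lee_fin -expr2.
  exact: sqr_ge0.
have [Z [mZ Z0 UZ]] : leb.-negligible [set z | u x z != 0].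
  apply: negligibleS ae0 => y /= uy /(_ (UOm _ uy)) [] /eqP.
  by rewrite mulf_eq0 orbb (negbTE uy).
move: leb0; rewrite ltNge => /negP; apply; rewrite -Z0; apply: le_measure; rewrite ?inE//.
exact: measurable_rV_open.
Qed.

End forms.
End overlapping_decomposition.

(** * Spectral truncation and the coarse space *)

Section column_forms.
Context {R : realType} (n : nat).
Implicit Types (x y : 'cV[R]_n) (M D : 'M[R]_n).

Lemma linear_cV (f : 'cV[R]_n -> R) x : (forall x y a, f (x + a *: y) = f x + a * f y) ->
  f x = \sum_j x j ord0 * f (delta_mx j ord0).
Proof.
move=> Hf; have f0 : f 0 = 0.
  have := Hf 0 0 1; rewrite scaler0 addr0 mul1r => /(congr1 (fun t => t - f 0)).
  by rewrite subrr addrK.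
have fsum (r : seq 'I_n) : f (\sum_(j <- r) x j ord0 *: delta_mx j ord0) =
    \sum_(j <- r) x j ord0 * f (delta_mx j ord0).
  by elim: r => [|j r IH]; rewrite ?big_nil// !big_cons addrC Hf IH addrC.
rewrite -fsum; congr f; apply/colP => i; rewrite summxE (bigD1 i)//= !mxE !eqxx mulr1.
by rewrite big1 ?addr0// => j ji; rewrite !mxE eq_sym (negbTE ji) mulr0.
Qed.

Lemma bf_of_bilinear (G : 'cV[R]_n -> 'cV[R]_n -> R) :
  (forall x y z a, G (x + a *: y) z = G x z + a * G y z) ->
  (forall x y, G x y = G y x) ->
  forall x y, bf (\matrix_(i, j) G (delta_mx j ord0) (delta_mx i ord0)) x y = G x y.
Proof.
move=> GD GC x y; set M := \matrix_(i, j) _.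
have bfl z : forall x y a, bf M (x + a *: y) z = bf M x z + a * bf M y z.
  by move=> *; rewrite bfDl bfZl.
have bfr z : forall x y a, bf M z (x + a *: y) = bf M z x + a * bf M z y.
  by move=> *; rewrite bfDr bfZr.
rewrite (linear_cV (f := bf M ^~ y) x (bfl y)) (linear_cV (f := G ^~ y) x (fun x y' a => GD x y' y a)).
apply: eq_bigr => j _; congr (_ * _); rewrite GC.
rewrite (linear_cV y (bfr _)) (linear_cV (f := G ^~ _) y (fun x y a => GD x y _ a)).
apply: eq_bigr => i _; congr (_ * _); rewrite GC.
by rewrite /bf trmx_delta -rowE -colE !mxE.
Qed.

Lemma psd_of_bilinear (G : 'cV[R]_n -> 'cV[R]_n -> R) :
  (forall x y z a, G (x + a *: y) z = G x z + a * G y z) ->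
  (forall x y, G x y = G y x) -> (forall x, 0 <= G x x) ->
  psd (\matrix_(i, j) G (delta_mx j ord0) (delta_mx i ord0)).
Proof.
move=> GD GC G0; split; last by move=> x; rewrite bf_of_bilinear.
by apply/matrixP => i j; rewrite !mxE GC.
Qed.

Section spectral_truncation.
Context (D Al : 'M[R]_n) (W : 'cV[R]_n -> 'cV[R]_n) (pAl : psd Al).
Hypothesis WD : forall x y a, W (x + a *: y) = W x + a *: W y.
Context (nt s m : nat) (X : nat -> 'cV[R]_n) (r c : nat -> R) (Th : R).
Hypothesis orth : forall l l', (l < nt)%N -> (l < s)%N -> (l' < nt)%N -> (l' < s)%N ->
  bf D (W (X l)) (W (X l')) = (l == l')%:R.
Hypothesis eig : forall l y, (l < nt)%N -> (l < s)%N ->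
  bf Al (X l) y = r l * bf D (W (X l)) (W y).
Hypothesis ker : forall l, (l < nt)%N -> (s <= l)%N -> W (X l) = 0.
Hypothesis Th0 : 0 <= Th.
Hypothesis threshold : forall l, (l < nt)%N -> (m <= l < s)%N -> 1 <= Th * r l.

Lemma linear_cV_sum I (q : seq I) (P : pred I) (a : I -> R) (Y : I -> 'cV[R]_n) :
  W (\sum_(l <- q | P l) a l *: Y l) = \sum_(l <- q | P l) a l *: W (Y l).
Proof.
have W0 : W 0 = 0.
  have := WD 0 0 1; rewrite scaler0 addr0 scale1r => /(congr1 (fun t => t - W 0)).
  by rewrite subrr addrK.
elim: q => [|l q IH]; first by rewrite !big_nil.
by rewrite !big_cons; case: ifP => // _; rewrite addrC WD IH addrC.
Qed.

Let r_ge0 l : (l < nt)%N -> (l < s)%N -> 0 <= r l.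
Proof. by move=> h1 h2; have := pAl.2 (X l); rewrite eig// orth// eqxx mulr1. Qed.

Let low := \sum_(l < nt | (l < s)%N) c l *: X l.
Let high := \sum_(l < nt | ~~ (l < s)%N) c l *: X l.

Let bf_orth (P Q : pred nat) (a : nat -> R) :
  \sum_(l < nt | P l && (l < s)%N) a l *
    bf D (W (X l)) (\sum_(l' < nt | Q l' && (l' < s)%N) c l' *: W (X l')) =
  \sum_(l < nt | [&& P l, Q l & (l < s)%N]) a l * c l.
Proof.
rewrite [RHS]big_mkcond [LHS]big_mkcond; apply: eq_bigr => l _.
have [ls|_] := boolP (l < s)%N; last by rewrite !andbF.
rewrite !andbT; case: (P l) => //=; rewrite bf_sumr big_mkcond (bigD1 l)//= ls andbT.
rewrite big1 ?addr0 => [|l' l'l]; last first.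
  case: ifP => // /andP[_ l's]; rewrite bfZr orth//.
  have /negbTE -> : (l != l' :> nat) by rewrite eq_sym; exact: l'l.
  by rewrite mulr0.
by case: (Q l); rewrite ?mulr0// bfZr orth// eqxx mulr1.
Qed.

(** W kills the eigenvectors with infinite eigenvalue, so the eigenvalue equation makes [low] and
    [high] orthogonal for [Al], although the vectors in [high] need not be orthogonal to each other.
    Hence the energy of [low], the sum of r_l c_l^2, is at most that of x, and for l >= m each r_l
    is at least 1/Th. *)
Lemma spectral_truncation (x := \sum_(l < nt) c l *: X l)
    (z := \sum_(l < nt | (m <= l)%N) c l *: W (X l)) :
  bf D z z <= Th * bf Al x x.
Proof.
have zE : z = \sum_(l < nt | (m <= l)%N && (l < s)%N) c l *: W (X l).
  rewrite /z (bigID (fun l : 'I_nt => l < s)%N)/= [X in _ + X]big1 ?addr0// => l /andP[_ ls].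
  by rewrite ker ?scaler0// leqNgt.
have xE : x = low + high by rewrite /x (bigID (fun l : 'I_nt => l < s)%N).
have lowE y : bf Al low y = \sum_(l < nt | (l < s)%N) c l * r l * bf D (W (X l)) (W y).
  by rewrite bf_suml; apply: eq_bigr => l ls; rewrite bfZl eig// mulrA.
have Whigh : W high = 0.
  by rewrite linear_cV_sum big1// => l; rewrite -leqNgt => ls; rewrite ker ?scaler0.
have low_high : bf Al low high = 0.
  by rewrite lowE big1// => l _; rewrite Whigh bf0r mulr0.
have low_low : bf Al low low = \sum_(l < nt | (l < s)%N) r l * c l ^+ 2.
  rewrite lowE linear_cV_sum.
  have /= -> := @bf_orth predT predT (fun l => c l * r l).
  by apply: eq_bigr => l _; rewrite expr2 mulrAC mulrC.
have zz : bf D z z = \sum_(l < nt | (m <= l)%N && (l < s)%N) c l ^+ 2.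
  rewrite {1}zE bf_suml zE; under eq_bigr do rewrite bfZl.
  have /= -> := @bf_orth (leq m) (leq m) c.
  by apply: eq_big => [l|l _]; rewrite ?andbA ?andbb// expr2.
apply: (@le_trans _ _ (Th * bf Al low low)); last first.
  apply: ler_wpM2l => //; rewrite xE bfDl !bfDr (bfC high low pAl.1) low_high addr0 add0r.
  by rewrite lerDl; exact: pAl.2.
rewrite zz low_low mulr_sumr.
apply: (@le_trans _ _ (\sum_(l < nt | (m <= l)%N && (l < s)%N) Th * (r l * c l ^+ 2))).
  apply: ler_sum => l lms; rewrite mulrA -[leLHS]mul1r.
  by apply: ler_wpM2r; [exact: sqr_ge0|exact: threshold].
rewrite [leRHS](bigID (fun l : 'I_nt => m <= l)%N)/=.
under [X in _ <= X + _]eq_bigl do rewrite andbC.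
by rewrite lerDl; apply: sumr_ge0 => l /andP[ls _]; apply: mulr_ge0 => //; apply: mulr_ge0;
  [exact: r_ge0|exact: sqr_ge0].
Qed.

End spectral_truncation.
End column_forms.

(** * Matrices of the discrete problem and the stable splitting *)

Section two_level_assembly.
Context {R : realType} (d : nat) (d0 : (0 < d)%N).
Local Notation V := 'rV[R]_d.
Local Notation leb := (lebesgue_rV R d).
Context (Om : set V) (HOm : polytopal_domain Om).
Context (k : R) (A : V -> 'M[R]_d) (amax : R) (HA : elliptic Om A amax).
Context (F : fe_space R d) (HT : triangulation Om (fe_mesh F)) (HC : conforming_fe Om F).
Context (N : nat) (Omp : 'I_N -> set V) (layers : 'I_N -> nat).
Context (Hpart : partition_resolved F Omp Om) (Hlayers : forall i, (0 < layers i)%N).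
Local Notation n := (fe_dim F).
Local Notation phi := (@fe_basis _ _ F).
Local Notation u := (@fe_comb R d F).
Local Notation O i := (subdomain F Omp layers i).
Local Notation dofs i := (@dof R d F N Omp layers i).
Local Notation W := (weighted_part Omp layers).
Implicit Types (i : 'I_N) (j : 'I_n) (x y : 'cV[R]_n) (z : V).

Let bOm : bounded_open Om := polytopal_bounded_open HOm.
Let mOm : measurable Om := bounded_open_measurable bOm.
Let mE i : measurable (O i `&` Om).
Proof.
apply: measurableI => //; apply: measurable_rV_open.
by have [D ->] := subdomain_layer F Omp Hlayers i; exact: layer_open.
Qed.
Let EOm i : O i `&` Om `<=` Om. Proof. by move=> z []. Qed.
Let uH10 x : H10 Om (u x). Proof. exact: (fe_H10 HC (fe_comb_fun x)). Qed.
Let uH1 x : H1 Om (u x). Proof. by have [] := uH10 x. Qed.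
Let uL2 x : L2 Om (u x). Proof. by have [] := uH1 x. Qed.
Let u0 x z : ~ Om z -> u x z = 0. Proof. exact: (fe_eq0 HC (fe_comb_fun x)). Qed.

Definition stiffness_on E : 'M[R]_n :=
  \matrix_(i, j) form_on Om A E (u (delta_mx j ord0)) (u (delta_mx i ord0)).

Definition mass_on E : 'M[R]_n :=
  \matrix_(i, j) ip E (u (delta_mx j ord0)) (u (delta_mx i ord0)).

Let form_lin E : measurable E -> E `<=` Om -> forall x y w (a : R),
  form_on Om A E (u (x + a *: y)) (u w) =
  form_on Om A E (u x) (u w) + a * form_on Om A E (u y) (u w).
Proof. by move=> mE' EO x y w a; rewrite fe_comb_lin (form_on_lin bOm HA). Qed.

Let ip_lin E : measurable E -> E `<=` Om -> forall x y w (a : R),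
  ip E (u (x + a *: y)) (u w) = ip E (u x) (u w) + a * ip E (u y) (u w).
Proof.
move=> mE' EO x y w a; have LE y' : L2 E (u y') by exact: L2S mE' EO (uL2 y').
by rewrite fe_comb_lin ipDl// ?ipZl//; exact: L2Z.
Qed.

Lemma bf_stiffness_on E x y : measurable E -> E `<=` Om ->
  bf (stiffness_on E) x y = form_on Om A E (u x) (u y).
Proof.
move=> mE' EO; apply: (bf_of_bilinear (G := fun x y => form_on Om A E (u x) (u y))).
  exact: form_lin.
by move=> *; exact: (form_onC HA).
Qed.

Lemma bf_mass_on E x y : measurable E -> E `<=` Om ->
  bf (mass_on E) x y = ip E (u x) (u y).
Proof.
move=> mE' EO; apply: (bf_of_bilinear (G := fun x y => ip E (u x) (u y))).
  exact: ip_lin.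
by move=> *; exact: ipC.
Qed.

Lemma psd_stiffness_on E : measurable E -> E `<=` Om -> psd (stiffness_on E).
Proof.
move=> mE' EO; apply: (psd_of_bilinear (G := fun x y => form_on Om A E (u x) (u y))).
- exact: form_lin.
- by move=> *; exact: (form_onC HA).
- by move=> *; exact: (form_on_ge0 HA).
Qed.

Lemma psd_mass_on E : measurable E -> E `<=` Om -> psd (mass_on E).
Proof.
move=> mE' EO; apply: (psd_of_bilinear (G := fun x y => ip E (u x) (u y))).
- exact: ip_lin.
- by move=> *; exact: ipC.
- by move=> *; exact: ip_ge0.
Qed.

Lemma stiffness_mxE : stiffness_mx A F Om = stiffness_on Om.
Proof. by apply/matrixP => i j; rewrite [LHS]mxE [RHS]mxE -!fe_basis_comb. Qed.

Lemma mass_mxE : mass_mx F Om = mass_on Om.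
Proof. by apply/matrixP => i j; rewrite [LHS]mxE [RHS]mxE -!fe_basis_comb. Qed.

Lemma B_mxE : B_mx A k F Om = stiffness_on Om - k ^+ 2 *: mass_on Om.
Proof.
rewrite -stiffness_mxE -mass_mxE; apply/matrixP => i j.
rewrite [LHS]mxE [RHS]mxE /form_b; congr (_ + _); first by rewrite [RHS]mxE.
by rewrite [RHS]mxE; congr (- _); rewrite [RHS]mxE; congr (_ * _); rewrite [RHS]mxE.
Qed.

Lemma D_mxE : D_mx A k F Om = stiffness_on Om + k ^+ 2 *: mass_on Om.
Proof. by rewrite /D_mx stiffness_mxE mass_mxE. Qed.

Lemma bf_D_mx x y : bf (D_mx A k F Om) x y =
  form_on Om A Om (u x) (u y) + k ^+ 2 * ip Om (u x) (u y).
Proof. by rewrite D_mxE bfDM bfZM bf_stiffness_on// bf_mass_on. Qed.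

Lemma E_mx_comb r (e : 'I_r -> V -> R) (y : 'cV_r) : (forall q, fe_fun F (e q)) ->
  u (E_mx F e *m y) = lincomb (fun q => y q ord0) e.
Proof.
move=> He; have [X HX] := choice (fun q => fe_fun_comb (He q)).
have -> : E_mx F e *m y = \sum_q y q ord0 *: X q.
  apply/colP => l; rewrite mxE summxE; apply: eq_bigr => q _.
  by rewrite !mxE HX (coords_fe_comb HC) mulrC.
apply/funext => z; rewrite fe_comb_sum; apply: eq_bigr => q _.
by rewrite fe_combZ -HX.
Qed.

Lemma local_basisE i q : local_basis F Omp layers i q = phi (enum_val q).
Proof.
apply/funext => z; rewrite /local_basis /phi_loc patchE; case: ifPn => // /negP Oz.
rewrite (dof_eq0 HC Hlayers (enum_valP q))// => Oz'; apply: Oz; rewrite inE.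
exact: Oz'.
Qed.

Lemma local_E_mx i (y : 'cV_#|dofs i|) l :
  (E_mx F (local_basis F Omp layers i) *m y) l ord0 =
  \sum_q (l == enum_val q)%:R * y q ord0.
Proof.
rewrite mxE; apply: eq_bigr => q _; rewrite mxE local_basisE fe_basis_comb.
by rewrite (coords_fe_comb HC) mxE andbT.
Qed.

Lemma local_range i x : in_range (E_mx F (local_basis F Omp layers i)) x <->
  forall j, ~~ dofs i j -> x j ord0 = 0.
Proof.
split=> [[y ->] j ij|x0].
  rewrite local_E_mx big1// => q _; case: eqP => [E|]; last by rewrite mul0r.
  by move: ij; rewrite E (enum_valP q : dofs i (enum_val q)).
exists (\col_q x (enum_val q) ord0); apply/colP => l; rewrite local_E_mx.
have [il|il] := boolP (dofs i l); last first.
  rewrite x0// big1// => q _; case: eqP => [E|]; last by rewrite mul0r.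
  by move: il; rewrite E (enum_valP q : dofs i (enum_val q)).
have lE : enum_val (enum_rank_in (A := dofs i) il l) = l by rewrite enum_rankK_in.
rewrite (bigD1 (enum_rank_in (A := dofs i) il l))//= !mxE lE eqxx mul1r big1 ?addr0// => q ql.
case: eqP => [E|]; last by rewrite mul0r.
by case/eqP: ql; apply: enum_val_inj; rewrite lE.
Qed.

Lemma local_E_mx_inj i (y : 'cV_#|dofs i|) :
  E_mx F (local_basis F Omp layers i) *m y = 0 -> y = 0.
Proof.
move=> H; apply/colP => q; have := congr1 (fun v : 'cV_n => v (enum_val q) ord0) H.
rewrite local_E_mx !mxE (bigD1 q)//= eqxx mul1r big1 ?addr0// => q' qq'.
by rewrite (inj_eq enum_val_inj) eq_sym (negbTE qq') mul0r.
Qed.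

Lemma Xi_fun i (v : V -> R) : fe_fun F (Xi F Omp layers i v).
Proof.
pose x : 'cV[R]_n := \col_j (if dofs i j then
  (multiplicity Omp layers j)%:R^-1 * dofbar_coef Omp layers i v j else 0).
have -> : Xi F Omp layers i v = u x; last exact: fe_comb_fun.
apply/funext => z; rewrite /Xi fe_combE big_mkcond; apply: eq_bigr => j _.
rewrite mxE; case: ifP => ij; last by rewrite mul0r.
congr (_ * _); rewrite /phi_loc patchE; case: ifPn => // /negP Oz.
by rewrite (dof_eq0 HC Hlayers ij)// => Oz'; apply: Oz; rewrite inE.
Qed.

Lemma ip1k_local i x y : (forall j, ~~ dofs i j -> x j ord0 = 0) ->
  (forall j, ~~ dofs i j -> y j ord0 = 0) ->
  ip1k A k (O i) (u x) (u y) = bf (D_mx A k F Om) x y.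
Proof.
move=> x0 y0; have P (w : 'cV[R]_n) : (forall j, ~~ dofs i j -> w j ord0 = 0) -> u w = u w \_ (O i).
  move=> w0; apply/funext => z; rewrite patchE; case: ifPn => // /negP Oz.
  by rewrite (local_eq0 HC Hlayers w0)// => Oz'; apply: Oz; rewrite inE.
have [H1 H2] := form_subdomain_local d0 HOm HT HC Hlayers HA y x0.
rewrite bf_D_mx H1 H2 /ip1k (P _ x0) (P _ y0) -(P _ x0) -(P _ y0).
rewrite [in LHS](P _ x0) [in LHS](P _ y0).
by rewrite (form_a_subdomain d0 HOm HC Omp Hlayers HA) (ip_restrict _ _ (u0 x)).
Qed.

Section coarse.
Context (p : 'I_N -> nat -> V -> R) (m : 'I_N -> nat).
Context (r0 : nat) (e0 : 'I_r0 -> V -> R).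
Hypothesis He0 : is_basis (coarse_space F Omp layers p m) e0.

Lemma coarse_fun v : coarse_space F Omp layers p m v -> fe_fun F v.
Proof.
move=> [c ->].
have [X HX] := choice (fun il : 'I_N * nat => fe_fun_comb (Xi_fun il.1 (p il.1 il.2))).
have -> : (fun z => \sum_(i < N) \sum_(l < m i) c i l * Xi F Omp layers i (p i l) z) =
    u (\sum_(i < N) \sum_(l < m i) c i l *: X (i, nat_of_ord l)); last exact: fe_comb_fun.
apply/funext => z; rewrite fe_comb_sum; apply: eq_bigr => i _.
rewrite fe_comb_sum; apply: eq_bigr => l _.
by rewrite fe_combZ -HX.
Qed.

Let e0_fun q : fe_fun F (e0 q).
Proof.
apply: coarse_fun; rewrite -He0.2; exists (fun q' => (q' == q)%:R); apply/funext => z.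
by rewrite /lincomb (bigD1 q)//= eqxx mul1r big1 ?addr0// => q' /negbTE ->; rewrite mul0r.
Qed.

Lemma coarse_range x : coarse_space F Omp layers p m (u x) -> in_range (E_mx F e0) x.
Proof.
rewrite -He0.2 => -[c E]; exists (\col_q c q); apply: (fe_comb_inj HC).
rewrite E E_mx_comb//; apply/funext => z; apply: eq_bigr => q _.
by rewrite mxE.
Qed.

Lemma coarse_E_mx_inj (y : 'cV_r0) : E_mx F e0 *m y = 0 -> y = 0.
Proof.
move=> H; apply/colP => q; rewrite [RHS]mxE; move: q; apply: He0.1.
by rewrite -E_mx_comb// H fe_comb0.
Qed.

Context (nt s : 'I_N -> nat) (lam : 'I_N -> nat -> \bar R).
Hypothesis Heig : forall i, eigensystem A k F Omp layers i (nt i) (s i) (p i) (lam i).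
Hypothesis Hm : forall i, (1 <= m i <= s i)%N.
Context (Theta : R) (HTheta : Theta%:E = ((coarse_threshold lam m)^-1)%E).

Let eigvec i l : (l < nt i)%N -> exists x, p i l = u x \_ (O i).
Proof.
move=> lnt; have [_ [_ bspan] _ _ _] := Heig i.
have [w [c ->] ->] : Vtilde F Omp layers i (p i l).
  rewrite -bspan; exists (fun l' => (l' == Ordinal lnt)%:R); apply/funext => z.
  rewrite /lincomb (bigD1 (Ordinal lnt))//= eqxx mul1r big1 ?addr0// => q' /negbTE ->.
  by rewrite mul0r.
exists (\col_j c j); congr (_ \_ _); apply/funext => z; apply: eq_bigr => j _.
by rewrite mxE.
Qed.

Let eigval i l x : (l < nt i)%N -> (l < s i)%N -> p i l = u x \_ (O i) ->
  exists2 r, lam i l = r%:E & forall y,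
    bf (stiffness_on (O i `&` Om)) x y = r * bf (D_mx A k F Om) (W i x) (W i y).
Proof.
move=> lnt ls px; have [_ _ /(_ l lnt) Hp [_ Hinf] _] := Heig i.
case: Hp => [[r lr [_ _ H]]|[_ _ loo]]; last first.
  by have /Hinf := loo; rewrite leqNgt ls.
exists r => // y; rewrite bf_stiffness_on// -(form_a_subdomain d0 HOm HC Omp Hlayers HA).
rewrite -px H; last by exists (u y) => //; exact: fe_comb_fun.
rewrite px !(Xi_restrict d0 HT HC Omp Hlayers) ip1k_local// => j; exact: weighted_part_eq0.
Qed.

Let eigker i l x : (l < nt i)%N -> (s i <= l)%N -> p i l = u x \_ (O i) -> W i x = 0.
Proof.
move=> lnt ls px; have [_ _ /(_ l lnt) Hp [_ Hinf] _] := Heig i.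
have loo : lam i l = +oo%E by apply/Hinf.
case: Hp => [[r lr _]|[_ H _]]; first by move: lr; rewrite loo.
apply: (fe_comb_inj HC); rewrite fe_comb0 -H px.
by rewrite (Xi_restrict d0 HT HC Omp Hlayers).
Qed.

Let eigorth i l l' x x' : (l < s i)%N -> (l' < s i)%N ->
  p i l = u x \_ (O i) -> p i l' = u x' \_ (O i) ->
  bf (D_mx A k F Om) (W i x) (W i x') = (l == l')%:R.
Proof.
move=> ls l's px px'; have [_ _ _ _ /(_ _ _ ls l's)] := Heig i.
rewrite px px' !(Xi_restrict d0 HT HC Omp Hlayers) ip1k_local// => j; exact: weighted_part_eq0.
Qed.

Let eigval_ge0 i l x r : (l < nt i)%N -> (l < s i)%N -> p i l = u x \_ (O i) ->
  lam i l = r%:E -> 0 <= r.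
Proof.
move=> lnt ls px lr; have [r' lr' H] := eigval lnt ls px.
have -> : r = r' by move: lr'; rewrite lr => -[].
have := (psd_stiffness_on (mE i) (@EOm i)).2 x.
by rewrite H (eigorth ls ls px px) eqxx mulr1.
Qed.

Let lam0_ge0 i : (0 <= lam i 0%N)%E.
Proof.
have s0 : (0 < s i)%N by have /andP[m1 ms] := Hm i; exact: leq_trans ms.
have [nt0|nt0] := posnP (nt i); last first.
  have [x px] := eigvec nt0; have [r lr _] := eigval nt0 s0 px.
  by rewrite lr lee_fin; exact: eigval_ge0 nt0 s0 px lr.
(* With [nt i] = 0 the space [Vtilde] is trivial, so every coefficient of [Xi] applied to [p i 0]
   vanishes, against its norm being 1. *)
have [_ [_ bspan] _ _ /(_ 0%N 0%N s0 s0)] := Heig i.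
have [w Hw] := fe_fun_comb (Xi_fun i (p i 0%N)).
have w0 j : w j ord0 = 0; last first.
  have {}w0 : w = 0 by apply/colP => j; rewrite w0 mxE.
  rewrite Hw w0 ip1k_local => [|j _|j _]; rewrite ?mxE// bf0l eqxx => /eqP.
  by rewrite eq_sym oner_eq0.
have [ij|ij] := boolP (dofs i j); last first.
  rewrite -(fe_comb_node HC) -Hw; apply: big1 => l il; rewrite /phi_loc patchE.
  case: ifPn => _; last by rewrite mulr0.
  have [_ _ H _] := HC; rewrite H; case: eqP => [E|_]; last by rewrite mulr0.
  by move: ij; rewrite -E il.
apply: (restrict_eq0 d0 HT HC Hlayers _ (dofbar_dof HC Hlayers ij)).
have : Vtilde F Omp layers i (u w \_ (O i)) by exists (u w) => //; exact: fe_comb_fun.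
rewrite -bspan => -[c ->]; apply/funext => z; rewrite /lincomb big1// => l _.
by have := ltn_ord l; rewrite [X in (_ < X)%N]nt0.
Qed.

Lemma threshold_ge0 : (0 <= coarse_threshold lam m)%E.
Proof.
rewrite /coarse_threshold; apply: le_bigmin => [|i _]; first exact: leey.
have [_ _ _ [H _] _] := Heig i.
by apply: le_trans (lam0_ge0 i) (H _ _ (leq0n _)).
Qed.

Lemma Theta_ge0 : 0 <= Theta.
Proof. by rewrite -lee_fin HTheta inve_ge0; exact: threshold_ge0. Qed.

Let Theta_eigval i l r : (m i <= l)%N -> lam i l = r%:E -> 1 <= Theta * r.
Proof.
move=> ml lr; have [_ _ _ [Hmono _] _] := Heig i.
have : (coarse_threshold lam m <= r%:E)%E.
  rewrite -lr; apply: le_trans (Hmono _ _ ml).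
  exact: (@bigmin_le _ _ _ +oo%E i (fun i => lam i (m i))).
(* An infinite threshold cannot lie below the finite [r], and a zero threshold has no finite inverse
   [Theta]. *)
move: HTheta threshold_ge0; case: (coarse_threshold lam m) => [t||]//.
rewrite inver; case: eqP => // /eqP t0 [->]; rewrite !lee_fin => tge tr.
by rewrite mulrC ler_pdivlMr ?mul1r// lt_neqAle eq_sym t0.
Qed.

(** The restriction of [u x] is expanded in the eigenbasis. The resulting vector [xx] may differ
    from [x], but the local stiffness and [W i] depend on the restriction alone. The first [m i]
    modes go to the coarse space; the others form [z]. *)
Lemma local_split i x : exists (z : 'cV[R]_n) (c : nat -> R),
  [/\ forall j, ~~ dofs i j -> z j ord0 = 0,
    u (W i x - z) = (fun b : V => \sum_(l < m i) c l * Xi F Omp layers i (p i l) b) &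
    bf (D_mx A k F Om) z z <= Theta * bf (stiffness_on (O i `&` Om)) x x].
Proof.
have [_ [_ bspan] _ _ _] := Heig i.
have [a Ea] : fspan (fun l : 'I_(nt i) => p i l) (u x \_ (O i)).
  by rewrite bspan; exists (u x) => //; exact: fe_comb_fun.
have /choice[X HX] : forall l, exists y : 'cV[R]_n, (l < nt i)%N -> p i l = u y \_ (O i).
  move=> l; have [lnt|lnt] := ltnP l (nt i); last by exists 0.
  by have [y py] := eigvec lnt; exists y.
pose c l : R := oapp a 0 (insub l).
have cE (l : 'I_(nt i)) : c l = a l by rewrite /c valK.
have c0 l : ~~ (l < nt i)%N -> c l = 0 by move=> H; rewrite /c insubN.
pose xx := \sum_(l < nt i) c l *: X l.
have Exx : u x \_ (O i) = u xx \_ (O i).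
  rewrite Ea; apply/funext => z; rewrite patchE; case: ifPn => Oz.
    rewrite fe_comb_sum; apply: eq_bigr => l _.
    by rewrite HX// patchE Oz fe_combZ cE.
  by rewrite /lincomb big1// => l _; rewrite HX// patchE (negbTE Oz) mulr0.
have Wx : W i x = W i xx.
  by apply: (fe_comb_inj HC); rewrite -!(Xi_restrict d0 HT HC Omp Hlayers) Exx.
have Ax : bf (stiffness_on (O i `&` Om)) x x = bf (stiffness_on (O i `&` Om)) xx xx.
  rewrite bf_stiffness_on// -(form_a_subdomain d0 HOm HC Omp Hlayers HA) Exx.
  by rewrite (form_a_subdomain d0 HOm HC Omp Hlayers HA) bf_stiffness_on.
have Wsum (P : pred nat) : W i (\sum_(l < nt i | P l) c l *: X l) =
    \sum_(l < nt i | P l) c l *: W i (X l).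
  exact: (linear_cV_sum (@weighted_part_lin _ _ _ _ Omp layers i)).
exists (\sum_(l < nt i | (m i <= l)%N) c l *: W i (X l)), c; split.
- by move=> j ij; rewrite summxE big1// => l _; rewrite mxE weighted_part_eq0// mulr0.
- rewrite Wx (Wsum predT) (bigID (fun l : 'I_(nt i) => m i <= l)%N)/= addrAC subrr add0r.
  apply/funext => y; rewrite big_mkcond fe_comb_sum.
  transitivity (\sum_(l < nt i | (l < m i)%N) c l * Xi F Omp layers i (p i l) y).
    rewrite [RHS]big_mkcond; apply: eq_bigr => l _; rewrite -ltnNge; case: ifP => _.
      by rewrite fe_combZ HX// (Xi_restrict d0 HT HC Omp Hlayers).
    by rewrite fe_comb0.
  (* To avoid comparing [m i] with [nt i], both sums are widened to a common range; the coefficients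
     vanish from [nt i] on. *)
  rewrite (big_ord_widen_cond (nt i + m i) (fun l => l < m i)%N
    (fun l => c l * Xi F Omp layers i (p i l) y)) ?leq_addr//.
  rewrite [RHS](big_ord_widen (nt i + m i) (fun l => c l * Xi F Omp layers i (p i l) y)) ?leq_addl//.
  rewrite [RHS](bigID (fun l : 'I_(nt i + m i) => l < nt i)%N)/= [X in _ = _ + X]big1 ?addr0//.
  by move=> l /andP[_ lnt]; rewrite c0// mul0r.
rewrite Ax; pose r l := fine (lam i l).
apply: (@spectral_truncation _ _ _ (stiffness_on (O i `&` Om)) (W i) _ _ (nt i) (s i) (m i) X r c Theta).
- exact: psd_stiffness_on.
- exact: weighted_part_lin.
- by move=> l l' lnt ls l'nt l's; apply: eigorth => //; exact: HX.
- by move=> l y lnt ls; have [r' lr' ->] := eigval lnt ls (HX l lnt); rewrite /r lr'.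
- by move=> l lnt ls; exact: eigker lnt ls (HX l lnt).
- exact: Theta_ge0.
- move=> l lnt /andP[ml ls]; have [r' lr' _] := eigval lnt ls (HX l lnt).
  by rewrite /r lr'; exact: Theta_eigval ml lr'.
Qed.

(** The local splittings are added up; the partition of unity recombines the vectors [W i x] into
    [x]. *)
Lemma coarse_split x : exists z : 'I_N -> 'cV[R]_n,
  [/\ forall i, in_range (E_mx F (local_basis F Omp layers i)) (z i),
    in_range (E_mx F e0) (x - \sum_i z i) &
    forall i, bf (D_mx A k F Om) (z i) (z i) <=
      Theta * bf (stiffness_on (O i `&` Om)) x x].
Proof.
have [z Hz] := choice (fun i => local_split i x).
have [c {}Hz] := choice Hz.
exists z; split=> [i||i]; last by have [] := Hz i.
  by apply/local_range; have [] := Hz i.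
apply: coarse_range; exists c; apply/funext => y.
rewrite -{1}(weighted_part_sum HC Hpart Hlayers x) -sumrB fe_comb_sum.
by apply: eq_bigr => i _; have [_ -> _] := Hz i.
Qed.

End coarse.
End two_level_assembly.

(** * Stability of the discrete problem and verification of the abstract hypotheses *)

Section discrete_stability.
Context {R : realType} (d : nat) (Om : set 'rV[R]_d) (HOm : polytopal_domain Om).
Context (k : R) (A : 'rV[R]_d -> 'M[R]_d) (amax : R) (HA : elliptic Om A amax).
Context (F : fe_space R d) (HC : conforming_fe Om F).
Implicit Types (u v : 'rV[R]_d -> R).

Let bOm : bounded_open Om := polytopal_bounded_open HOm.
Let mOm : measurable Om := bounded_open_measurable bOm.

Lemma ip1kE u v : ip1k A k Om u v = form_on Om A Om u v + k ^+ 2 * ip Om u v.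
Proof. by []. Qed.

Lemma ip1kC u v : ip1k A k Om u v = ip1k A k Om v u.
Proof. by rewrite !ip1kE (ipC Om u v) (form_onC HA u v (@subset_refl _ Om)). Qed.

Lemma ip1k_lin u v w a : H1 Om u -> H1 Om v -> H1 Om w ->
  ip1k A k Om (u \+ (fun x => a * v x)) w = ip1k A k Om u w + a * ip1k A k Om v w.
Proof.
move=> Hu Hv Hw; have Lu := Hu.1; have Lv := Hv.1; have Lw := Hw.1.
rewrite !ip1kE ipDl ?ipZl//; last exact: L2Z.
rewrite (form_on_lin bOm HA)//.
move: (form_on _ _ _ u w) (form_on _ _ _ v w) (ip _ u w) (ip _ v w) => *; ring.
Qed.

Lemma ip1k_ge0 u : 0 <= ip1k A k Om u u.
Proof.
rewrite ip1kE; apply: addr_ge0; first exact: (form_on_ge0 HA).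
by apply: mulr_ge0; [exact: sqr_ge0|exact: ip_ge0].
Qed.

Lemma norm1k_sub u v : H1 Om u -> H1 Om v ->
  norm1k A k Om (u \- v) <= norm1k A k Om u + norm1k A k Om v.
Proof.
move=> Hu Hv.
have quad t : ip1k A k Om (u \+ (fun x => t * v x)) (u \+ (fun x => t * v x)) =
    ip1k A k Om u u + 2 * t * ip1k A k Om u v + t ^+ 2 * ip1k A k Om v v.
  have Hs := H1_lin t mOm Hu Hv.
  rewrite ip1k_lin// ip1kC ip1k_lin// [ip1k _ _ _ v (_ \+ _)]ip1kC ip1k_lin// [ip1k _ _ _ v u]ip1kC.
  by ring.
have cs : ip1k A k Om u v ^+ 2 <= ip1k A k Om u u * ip1k A k Om v v.
  apply: sqr_le_prod_of_quadratic; [exact: ip1k_ge0..|move=> t].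
  by rewrite -quad; exact: ip1k_ge0.
have E : u \- v = u \+ (fun x => -1 * v x) by apply/funext => x /=; rewrite mulN1r.
have h : `|ip1k A k Om u v| <= norm1k A k Om u * norm1k A k Om v.
  by apply: le_nrm_prod => //; exact: ip1k_ge0.
rewrite -(@ler_pXn2r _ 2)// ?nnegrE ?addr_ge0 ?sqrtr_ge0//.
rewrite sqrrD [X in X ^+ 2]/norm1k sqr_sqrtr ?ip1k_ge0// E quad.
have [qu qv] : norm1k A k Om u ^+ 2 = ip1k A k Om u u /\ norm1k A k Om v ^+ 2 = ip1k A k Om v v.
  by split; rewrite sqr_sqrtr// ip1k_ge0.
rewrite qu qv; move: h; rewrite ler_norml => /andP[h _]; move: h.
move: (ip1k _ _ _ u u) (ip1k _ _ _ u v) (ip1k _ _ _ v v) (norm1k _ _ _ u) (norm1k _ _ _ v).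
move=> a b c x y; rewrite -[_ *+ 2]mulr_natl; lra.
Qed.

(** The source is the finite element function with coefficients [e]. Its discrete solution is the
    continuous one, bounded by C_stab, minus the discretisation error, bounded by 1: whence the
    factor 1 + C_stab. *)
Lemma discrete_dual Cstab : stable A k Om Cstab ->
  (forall f, L2 Om f -> (exists! uh, discrete_solution A k Om F f uh) /\
    forall u uh, weak_solution A k Om f u -> discrete_solution A k Om F f uh ->
      norm1k A k Om (u \- uh) <= l2norm Om f) ->
  forall e : 'cV[R]_(fe_dim F), exists w : 'cV[R]_(fe_dim F),
    (forall v : 'cV[R]_(fe_dim F), bf (B_mx A k F Om) w v = bf (mass_on F Om) e v) /\
    nrm (D_mx A k F Om) w <= (1 + Cstab) * nrm (mass_on F Om) e.
Proof.
move=> [C0 Hstab] Hthr e.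
have uH1 (y : 'cV[R]_(fe_dim F)) : H1 Om (fe_comb y) by have [] := fe_H10 HC (fe_comb_fun y).
have Lf : L2 Om (fe_comb e) by have [] := uH1 e.
have [w [Hw _ Hn]] := Hstab _ Lf; have [[uh [Hd _]] Hb] := Hthr _ Lf.
have {Hb}Hb := Hb _ _ Hw Hd; have [x Ex] := fe_fun_comb Hd.1.
have bm y z : bf (mass_on F Om) y z = ip Om (fe_comb y) (fe_comb z).
  by rewrite (bf_mass_on HOm HC).
exists x; split=> [v|].
  rewrite (B_mxE Om k A F) bfDM bfNM bfZM bm bm (bf_stiffness_on HOm HA HC)//.
  by have := Hd.2 _ (fe_comb_fun v); rewrite Ex.
rewrite /nrm (bf_D_mx HOm _ HA HC) bm -ip1kE.
rewrite -/(norm1k A k Om (fe_comb x)) -/(l2norm Om (fe_comb e)).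
have HwH : H1 Om w by have [[]] := Hw.
have HdH : H1 Om (w \- fe_comb x).
  rewrite (_ : w \- _ = w \+ (fun y => -1 * fe_comb x y)); last first.
    by apply/funext => y /=; rewrite mulN1r.
  exact: H1_lin.
have -> : fe_comb x = w \- (w \- fe_comb x).
  by apply/funext => y /=; rewrite opprB addrC subrK.
apply: le_trans (norm1k_sub HwH HdH) _; rewrite -Ex mulrDl mul1r addrC.
exact: lerD.
Qed.

End discrete_stability.

Theorem theorem3p1 (R : realType) (d : nat) (Hd : d = 2%N \/ d = 3%N)
  (Om : set 'rV[R]_d) (HOm : polytopal_domain Om)
  (HLip : d = 3%N -> lipschitz_boundary Om) (Hdiam : ediam Om <= 1)
  (k : R) (Hk : 0 < k)
  (A : 'rV[R]_d -> 'M[R]_d) (amax : R) (HA : elliptic Om A amax)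
  (Cstab : R) (Hstab : stable A k Om Cstab)
  (hs : set R) (Fh : R -> fe_space R d) (HF : fe_family Om hs Fh)
  (h1 : R) (Hh1 : resolution_threshold A k Om hs Fh h1)
  (h : R) (Hh : hs h) (Hhh1 : 0 < h < h1)
  (N : nat) (Omp : 'I_N -> set 'rV[R]_d) (layers : 'I_N -> nat)
  (Hpart : partition_resolved (Fh h) Omp Om)
  (Hlayers : forall i, (0 < layers i)%N)
  (nt s : 'I_N -> nat) (p : 'I_N -> nat -> 'rV[R]_d -> R)
  (lam : 'I_N -> nat -> \bar R)
  (Heig : forall i, eigensystem A k (Fh h) Omp layers i
                      (nt i) (s i) (p i) (lam i))
  (m : 'I_N -> nat) (Hm : forall i, (1 <= m i <= s i)%N)
  (r0 : nat) (e0 : 'I_r0 -> 'rV[R]_d -> R)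
  (He0 : is_basis (coarse_space (Fh h) Omp layers p m) e0)
  (Theta : R) (HTheta : Theta%:E = ((coarse_threshold lam m)^-1)%E) :
  let Lambda : R := (overlap (Fh h) Omp layers)%:R in
  let H := subdomain_diam (Fh h) Omp layers in
  let sval := 8 * Lambda * (2 + 3 * Lambda ^+ 2 * Theta) * (1 + Cstab) * k
            * Num.sqrt Theta in
  let tval := 6 * Num.sqrt 2 * Lambda * (2 + 3 * Lambda ^+ 2 * Theta) * H * k in
  let c1 := (1 - Num.max sval tval) / (2 + 3 * Lambda ^+ 2 * Theta) in
  let c2 := 18 + 8 * Lambda ^+ 2 in
  let B := B_mx A k (Fh h) Om in
  let Dk := D_mx A k (Fh h) Om in
  let Minv := two_level_mx A k (Fh h) Omp layers Om e0 in
  sval < 1 -> tval < 1 ->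
  [/\ sub_mx A k (Fh h) Om e0 \in unitmx,
    forall i, sub_mx A k (Fh h) Om (local_basis (Fh h) Omp layers i) \in unitmx
  & forall (f : 'rV[R]_d -> R) (u : nat -> 'cV[R]_(fe_dim (Fh h))),
      L2 Om f ->
      let g := Minv *m load (Fh h) Om f in
      let res j := g - Minv *m B *m u j in
      gmres Dk (Minv *m B) g u ->
      forall j, energy_norm Dk (res j) ^+ 2
        <= (1 - c1 ^+ 2 / c2 ^+ 2) ^+ j * energy_norm Dk (res 0%N) ^+ 2].
Proof.
move=> Lambda H sval tval c1 c2 B Dk Minv s1 t1.
have d2 : (2 <= d)%N by case: Hd => ->.
have d0 : (0 < d)%N by exact: leq_trans d2.
have [HT _ HC] := HF.1 h Hh.
have injE0 := coarse_E_mx_inj HC Hlayers He0.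
have injE i := local_E_mx_inj HC (Omp := Omp) Hlayers (i := i).
have [n0|npos] := posnP (fe_dim (Fh h)).
  have col0 (x : 'cV[R]_(fe_dim (Fh h))) : x = 0.
    by apply/colP => j; have := ltn_ord j; rewrite [X in (_ < X)%N]n0.
  split=> [|i|f u _ g res _ j].
  - by apply: unitmx_inj => y _; apply: injE0; exact: col0.
  - by apply: unitmx_inj => y _; apply: injE; exact: col0.
  - by rewrite !(col0 (res _)) /energy_norm mulmx0 mxE sqrtr0 expr0n mulr0.
have bOm := polytopal_bounded_open HOm.
have mOm : measurable Om by exact: bounded_open_measurable.
pose E i := subdomain (Fh h) Omp layers i `&` Om.
have mE i : measurable (E i).
  apply: measurableI => //; apply: measurable_rV_open.
  by have [D ->] := subdomain_layer (Fh h) Omp Hlayers i; exact: layer_open.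
have EOm i : E i `<=` Om by move=> z [].
have pA := psd_stiffness_on HOm HA HC mOm (@subset_refl _ Om).
have pS := psd_mass_on HOm HC mOm (@subset_refl _ Om).
have pAl i := psd_stiffness_on HOm HA HC (mE i) (@EOm i).
have pSl i := psd_mass_on HOm HC (mE i) (@EOm i).
have L1 : 1 <= Lambda.
  by rewrite ler1n; exact: (overlap_ge1 d0 HT HC Hpart Hlayers (Ordinal npos)).
have Th0 := Theta_ge0 d0 HOm HA HT HC Hlayers Heig Hm HTheta.
have C0 : 0 <= 1 + Cstab by apply: addr_ge0 => //; apply: ltW; have [] := Hstab.
have H0 : 0 <= H by rewrite /H /subdomain_diam; apply: bigmax_ge_id.
(* This is H k / sqrt 2, matching 2|w|^2 <= H^2 a(w, w); thus 12 eta = 6 sqrt 2 H k, the factor in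
   t. *)
pose eta := H * k * Num.sqrt 2 / 2.
have eta0 : 0 <= eta by rewrite divr_ge0// mulr_ge0 ?sqrtr_ge0// mulr_ge0// ltW.
have eta2 : eta ^+ 2 = H ^+ 2 * k ^+ 2 / 2.
  by rewrite /eta expr_div_n !exprMn sqr_sqrtr//; field.
have posS x : bf (mass_on (Fh h) Om) x x = 0 -> x = 0.
  by rewrite (bf_mass_on HOm HC)//; exact: (ip_fe_eq0 HOm HC).
have ovA x : \sum_i bf (stiffness_on Om A (Fh h) (E i)) x x <= Lambda * bf (stiffness_on Om A (Fh h) Om) x x.
  rewrite (bf_stiffness_on HOm HA HC)//.
  under eq_bigr do rewrite (bf_stiffness_on HOm HA HC _ _ (mE _) (@EOm _)).
  exact: (overlap_form d0 HOm HT HC Omp Hlayers HA).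
have ovS x : \sum_i bf (mass_on (Fh h) (E i)) x x <= Lambda * bf (mass_on (Fh h) Om) x x.
  rewrite (bf_mass_on HOm HC)//.
  under eq_bigr do rewrite (bf_mass_on HOm HC _ _ (mE _) (@EOm _)).
  exact: (overlap_ip d0 HOm HT HC Omp Hlayers).
have loc i x y : in_range (E_mx (Fh h) (local_basis (Fh h) Omp layers i)) x ->
    bf (stiffness_on Om A (Fh h) Om) x y = bf (stiffness_on Om A (Fh h) (E i)) x y /\
    bf (mass_on (Fh h) Om) x y = bf (mass_on (Fh h) (E i)) x y.
  move=> /(local_range HC Omp Hlayers) x0.
  rewrite (bf_stiffness_on HOm HA HC _ _ mOm (@subset_refl _ Om)).
  rewrite (bf_stiffness_on HOm HA HC _ _ (mE i) (@EOm i)).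
  rewrite (bf_mass_on HOm HC _ _ mOm (@subset_refl _ Om)).
  rewrite (bf_mass_on HOm HC _ _ (mE i) (@EOm i)).
  exact: (form_subdomain_local d0 HOm HT HC Hlayers HA).
have locA i x y Hx := (loc i x y Hx).1.
have locS i x y Hx := (loc i x y Hx).2.
have friedrichs i x : in_range (E_mx (Fh h) (local_basis (Fh h) Omp layers i)) x ->
    k ^+ 2 * bf (mass_on (Fh h) Om) x x <= eta ^+ 2 * bf (stiffness_on Om A (Fh h) Om) x x.
  move=> /(local_range HC Omp Hlayers) x0; rewrite (bf_stiffness_on HOm HA HC)// (bf_mass_on HOm HC)//.
  have := friedrichs_subdomain HOm HC Hlayers HA d2 x0; rewrite -/H.
  move=> /(ler_wpM2l (sqr_ge0 k)); rewrite eta2.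
  move: (ip _ _ _) (form_on _ _ _ _ _) => a b; lra.
have BE : B = stiffness_on Om A (Fh h) Om - k ^+ 2 *: mass_on (Fh h) Om by exact: B_mxE.
have DE : Dk = stiffness_on Om A (Fh h) Om + k ^+ 2 *: mass_on (Fh h) Om by exact: D_mxE.
have split := coarse_split d0 HOm HA HT HC Hpart Hlayers He0 Heig Hm HTheta.
have thr f : L2 Om f -> (exists! uh, discrete_solution A k Om (Fh h) f uh) /\
    forall u uh, weak_solution A k Om f u -> discrete_solution A k Om (Fh h) f uh ->
      norm1k A k Om (u \- uh) <= l2norm Om f by exact: Hh1.2 h Hh Hhh1 f.
have dual := discrete_dual HOm HA HC Hstab thr.
rewrite -/B -/Dk BE DE in dual; rewrite -/Dk DE in split.
have sE : 8 * (2 + 3 * Lambda ^+ 2 * Theta) * (Lambda * Num.sqrt Theta * (1 + Cstab) * k) = sval.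
  by rewrite /sval; ring.
have tE : 12 * Lambda * (2 + 3 * Lambda ^+ 2 * Theta) * eta = tval.
  by rewrite /tval /eta; field.
rewrite -sE in s1; rewrite -tE in t1.
have U0 := coarse_unit pA pS pAl pSl Hk L1 Th0 C0 eta0 posS ovA ovS locA locS injE0 split dual s1 t1.
have Ui := local_unit pA pS Hk L1 Th0 C0 eta0 posS friedrichs injE s1 t1.
split=> [|i|f u _ g res].
- by rewrite /sub_mx -/B BE.
- by rewrite /sub_mx -/B BE.
have PE : Minv *m B = galerkin B (E_mx (Fh h) e0) +
    \sum_i galerkin B (E_mx (Fh h) (local_basis (Fh h) Omp layers i)).
  by rewrite /Minv /two_level_mx mulmxDl mulmx_suml.
rewrite /res PE => Hg j; rewrite /c1 -sE -tE.
move: Hg; rewrite DE BE => Hg.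
exact: (two_level_gmres pA pS pAl pSl Hk L1 Th0 C0 eta0 posS ovA ovS locA locS friedrichs
  injE0 injE split dual s1 t1 Hg).
Qed.
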